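(* Let $\{f(\mathbf z;\boldsymbol\theta):\boldsymbol\theta\in\Theta\}$, $\Theta\subset\mathbb{R}^p$, be a family of probability mass or density functions on $\mathcal Z\subset\mathbb{R}^q$, and let $\mathbf z_1,\dots,\mathbf z_n$ be i.i.d. from $f(\cdot;\boldsymbol\theta_0)$. For $r\in\mathbb N$ let $\tilde f_r(\mathbf z;\boldsymbol\theta)$ be approximations of $f$ (the same for all observations), let $R:\mathbb N\to\mathbb N$, $\tilde L_n(\boldsymbol\theta)=\frac1n\sum_{i=1}^n\log\tilde f_{R(n)}(\mathbf z_i;\boldsymbol\theta)$ and $\hat{\boldsymbol\theta}_{MAL}=\arg\max_{\boldsymbol\theta\in\Theta}\tilde L_n(\boldsymbol\theta)$. Define $$\mathcal E(r)=\sup_{\mathbf z\in\mathcal Z,\boldsymbol\theta\in\Theta}|\tilde f_r(\mathbf z;\boldsymbol\theta)-f(\mathbf z;\boldsymbol\theta)|+\sup_{\mathbf z\in\mathcal Z,\boldsymbol\theta\in\Theta}\|\nabla_{\boldsymbol\theta}\tilde f_r(\mathbf z;\boldsymbol\theta)-\nabla_{\boldsymbol\theta}f(\mathbf z;\boldsymbol\theta)\|.$$ Assume: (a) for all $\boldsymbol\theta\ne\boldsymbol\theta_0$, $f(\cdot;\boldsymbol\theta)\ne f(\cdot;\boldsymbol\theta_0)$; $\boldsymbol\theta_0\in\Theta$ and $\Theta$ is compact; $\log f(\mathbf z;\boldsymbol\theta)$ is continuous at each $\boldsymbol\theta\in\Theta$ with probability one; $\mathbb E_{\mathbf z}[\sup_{\boldsymbol\theta\in\Theta}|\log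 f(\mathbf z;\boldsymbol\theta)|]<\infty$; (b) $\boldsymbol\theta_0\in\operatorname{interior}(\Theta)$; $f(\mathbf z;\boldsymbol\theta)$ is twice continuously differentiable and $f(\mathbf z;\boldsymbol\theta)>0$ in a neighborhood $\mathcal N$ of $\boldsymbol\theta_0$; $\int\sup_{\boldsymbol\theta\in\mathcal N}\|\nabla_{\boldsymbol\theta}f(\mathbf z;\boldsymbol\theta)\|\,d\mathbf z<\infty$ and $\int\sup_{\boldsymbol\theta\in\mathcal N}\|\nabla_{\boldsymbol\theta\boldsymbol\theta}f(\mathbf z;\boldsymbol\theta)\|\,d\mathbf z<\infty$; $\mathcal I=\mathbb E_{\mathbf z}[\nabla_{\boldsymbol\theta}\log f(\mathbf z;\boldsymbol\theta_0)(\nabla_{\boldsymbol\theta}\log f(\mathbf z;\boldsymbol\theta_0))^T]$ exists and is nonsingular; $\mathbb E_{\mathbf z}[\sup_{\boldsymbol\theta\in\mathcal N}\|\nabla_{\boldsymbol\theta}\log f(\mathbf z;\boldsymbol\theta_0)\|]<\infty$; (c) there exists $\bar\delta>0$ with $f(\mathbf z;\boldsymbol\theta)\ge\bar\delta$ for all $\mathbf z\in\mathcal Z,\boldsymbol\theta\in\Theta$; $\lim_{r\to\infty}\sup_{\mathbf z,\boldsymbol\theta}|\tilde f_r(\mathbf z;\boldsymbol\theta)-f(\mathbf z;\boldsymbol\theta)|=0$; $R$ is monotonically increasing with $\lim_{n\to\infty}R(n)=\infty$; (i) $\tilde f_r(\mathbf z;\boldsymbol\theta)$ is twice continuously differentiable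 in $\boldsymbol\theta\in\Theta$ and bounded for all $\mathbf z\in\mathcal Z$ and $r\in\mathbb N$; (ii) $\operatorname{plim}_{n\to\infty}\sqrt n\,\mathcal E(R(n))=0$; (iii) $\sup_{\mathbf z\in\mathcal Z,\boldsymbol\theta\in\Theta}\|\nabla_{\boldsymbol\theta\boldsymbol\theta}\tilde f_{R(n)}(\mathbf z;\boldsymbol\theta)-\nabla_{\boldsymbol\theta\boldsymbol\theta}f(\mathbf z;\boldsymbol\theta)\|\to0$ in probability. Then $\sqrt n(\hat{\boldsymbol\theta}_{MAL}-\boldsymbol\theta_0)\xrightarrow{d}N(\mathbf 0,\mathcal I^{-1})$.
   Context: $\nabla_{\boldsymbol\theta}$, $\nabla_{\boldsymbol\theta\boldsymbol\theta}$ denote gradient and Hessian in $\boldsymbol\theta$. *)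

(* Defs.v *)
From HB Require Import structures.
From mathcomp Require Import all_boot all_order all_algebra.
From mathcomp Require Import all_classical all_reals all_analysis.
Set Implicit Arguments. Unset Strict Implicit. Unset Printing Implicit Defensive.
Import Order.TTheory GRing.Theory Num.Theory.
Import numFieldNormedType.Exports.
Local Open Scope classical_set_scope.
Local Open Scope ring_scope.

Section defs.
Context {R : realType}.

Definition partial {p : nat} (g : 'rV[R]_p -> R) (j : 'I_p) : 'rV[R]_p -> R :=
  fun th => derive g th (delta_mx 0 j).

Definition grad {p : nat} (g : 'rV[R]_p -> R) (th : 'rV[R]_p) : 'rV[R]_p :=
  \row_j partial g j th.

Definition hess {p : nat} (g : 'rV[R]_p -> R) (th : 'rV[R]_p) : 'M[R]_p :=
  \matrix_(i, j) partial (partial g i) j th.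

Definition C2_on {p : nat} (U : set 'rV[R]_p) (g : 'rV[R]_p -> R) : Prop :=
  exists V : set 'rV[R]_p, [/\ open V, U `<=` V &
    forall th, V th ->
      [/\ differentiable g th,
          (forall i, differentiable (partial g i) th) &
          (forall i j, {for th, continuous (partial (partial g i) j)})]].

Definition supZT {T P : Type} (Z : set T) (Th : set P) (F : T -> P -> R)
  : \bar R := ereal_sup [set (F z t)%:E | z in Z & t in Th].

Definition mutually_independent {d dT : measure_display}
  {Om : measurableType d} {T : measurableType dT}
  (P : probability Om R) (X : nat -> Om -> T) : Prop :=
  forall (s : seq nat) (A : nat -> set T), uniq s ->
    (forall i, measurable (A i)) ->
    P (\bigcap_(i in [set` s]) (X i @^-1` A i)) =
    (\prod_(i <- s) P (X i @^-1` A i))%E.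

Definition is_gaussian_vec {d : measure_display} {Om : measurableType d}
  {p : nat} (Q : probability Om R) (Y : Om -> 'rV[R]_p) (S : 'M[R]_p) : Prop :=
  forall t : 'cV[R]_p,
    measurable_fun setT (fun w => (Y w *m t) 0 0) /\
    forall A : set R, measurable A ->
      Q ((fun w => (Y w *m t) 0 0) @^-1` A) =
      (if (t^T *m S *m t) 0 0 == 0 then \d_(0 : R) A
       else normal_prob 0 (Num.sqrt ((t^T *m S *m t) 0 0)) A).

Definition cvg_dist_gaussian {d : measure_display} {Om : measurableType d}
  {p : nat} (P : probability Om R) (X : nat -> Om -> 'rV[R]_p)
  (S : 'M[R]_p) : Prop :=
  exists (d' : measure_display) (Om' : measurableType d')
         (Q : probability Om' R) (Y : Om' -> 'rV[R]_p),
    is_gaussian_vec Q Y S /\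
    forall h : 'rV[R]_p -> R, continuous h ->
      (exists M : R, forall x, `|h x| <= M) ->
      (fun n => (\int[P]_w (h (X n w))%:E)%E) @ \oo -->
        (\int[Q]_w (h (Y w))%:E)%E.

Definition Ez {dT : measure_display} {T : measurableType dT} {p : nat}
  (mu : {measure set T -> \bar R}) (Z : set T) (f : T -> 'rV[R]_p -> R)
  (th0 : 'rV[R]_p) (g : T -> \bar R) : \bar R :=
  (\int[mu]_(x in Z) (g x * (f x th0)%:E))%E.

Definition fisher_info {dT : measure_display} {T : measurableType dT} {p : nat}
  (mu : {measure set T -> \bar R}) (Z : set T) (f : T -> 'rV[R]_p -> R)
  (th0 : 'rV[R]_p) : 'M[R]_p :=
  \matrix_(i, j) fine (\int[mu]_(x in Z)
     ((grad (fun s => ln (f x s)) th0) 0 i *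
      (grad (fun s => ln (f x s)) th0) 0 j * f x th0)%:E)%E.

Definition Ltilde {d : measure_display} {Om : measurableType d}
  {T : Type} {p : nat}
  (ft : nat -> T -> 'rV[R]_p -> R) (Rn : nat -> nat) (z : nat -> Om -> T)
  (n : nat) (w : Om) (th : 'rV[R]_p) : R :=
  n%:R^-1 * \sum_(i < n) ln (ft (Rn n) (z i w) th).

Definition approx_err {T : Type} {p : nat} (Z : set T) (Th : set 'rV[R]_p)
  (f : T -> 'rV[R]_p -> R) (ft : nat -> T -> 'rV[R]_p -> R) (r : nat)
  : \bar R :=
  (supZT Z Th (fun x t => `|ft r x t - f x t|%R) +
   supZT Z Th (fun x t => `|grad (ft r x) t - grad (f x) t|%R))%E.

End defs.

(* Main.v *)
Require Import Defs.
From HB Require Import structures.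
From mathcomp Require Import all_boot all_order all_algebra.
From mathcomp Require Import all_classical all_reals all_analysis.
From mathcomp Require Import measurable_realfun ring lra.
Set Implicit Arguments. Unset Strict Implicit. Unset Printing Implicit Defensive.
Import Order.TTheory GRing.Theory Num.Theory.
Import numFieldNormedType.Exports.
Local Open Scope classical_set_scope.
Local Open Scope ring_scope.

(** Write [e_i(D) = ft(z_i; th0 + D) / ft(z_i; th0) - 1], so that the approximate
    log-likelihood ratio is [sum_i ln (1 + e_i(D))]. Since [sqrt n * E(R n) -> 0],
    [e_i] agrees with the exact ratio [f(z_i; th0 + D) / f(z_i; th0) - 1] up to
    [o(n^-1/2) |D|], and a second order Taylor expansion of [f] together with the
    law of large numbers and [E s = 0], [E (hess f / f) = 0] gives
      [sum_i e_i(D) = sqrt n D.S_n + o(n |D|^2 + sqrt n |D|)]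
    for the normalised score [S_n]. From [ln (1 + e) <= e - min (e^2, 1) / 6] and a
    lower bound [c n |D|^2] for [sum_i min (e_i^2, 1)] (only [E s s^T] enters) the maximiser,
    consistent by Wald's argument, converges at rate [n^-1/2]; on that scale the
    log-likelihood ratio is [h.S_n - h I h^T / 2 + o(1)] uniformly, so that
    [sqrt n (thhat - th0) = S_n I^-1 + o(1)]. The central limit theorem is proved for
    the expectations of [cos (phi + t.S_n)], which determine the law by Bernstein
    approximation of bounded continuous functions by trigonometric polynomials. *)

(** * Trigonometric approximation *)

(** The assumptions give a square-integrable score at [th0] only, and an integrable supremum of the
    Hessian of f near [th0]. The ratio f(z; th0 + D) / f(z; th0) is linear in its numerator and its
    second-order remainder is dominated by the Hessian supremum; the logarithm is taken only
    afterwards, through scalar inequalities. Likewise e_i^2 has no integrable envelope, hence the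
    truncation min (e_i^2, 1), bounded below through the score on a set where everything is bounded.
    The factor |D| in the approximation error makes the rate sqrt n sufficient: it comes from the
    gradient part of E, whereas a plain sup bound would leave an error of order n E(R n). The free
    phase phi carries both the real and the imaginary part of the characteristic function, so that
    all computations stay real. *)

Section bernstein.
Context {R : realType}.
Implicit Types (u : R) (m k : nat).

Definition bern m k u : R := 'C(m, k)%:R * u ^+ k * (1 - u) ^+ (m - k).

Lemma bern_ge0 m k u : 0 <= u <= 1 -> 0 <= bern m k u.
Proof.
by case/andP=> u0 u1; rewrite /bern !mulr_ge0 ?exprn_ge0// subr_ge0.
Qed.

Lemma sum_bern m u : \sum_(k < m.+1) bern m k u = 1.
Proof.
rewrite -[RHS](expr1n _ m) -[in RHS](subrK u 1) exprDn.
by apply: eq_bigr => k _; rewrite /bern -mulr_natl; ring.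
Qed.

(** Absorption identity of binomial coefficients: it trades a factor k for an index shift, so that
    the binomial mean and second moment reduce to total mass 1. *)
Lemma bernS m k u : k.+1%:R * bern m.+1 k.+1 u = m.+1%:R * u * bern m k u.
Proof.
rewrite /bern subSS !mulrA -natrM -mul_bin_diag natrM exprS.
by ring.
Qed.

Lemma sum_bern1 m u : \sum_(k < m.+1) k%:R * bern m k u = m%:R * u.
Proof.
case: m => [|m]; first by rewrite big_ord1 !mul0r.
rewrite big_ord_recl mul0r add0r.
under eq_bigr do rewrite bernS.
by rewrite -mulr_sumr sum_bern mulr1.
Qed.

Lemma sum_bern2 m u :
  \sum_(k < m.+1) k%:R ^+ 2 * bern m k u = m%:R * u * (1 + m.-1%:R * u).
Proof.
case: m => [|m]; first by rewrite big_ord1 expr0n !mul0r.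
rewrite big_ord_recl expr0n mul0r add0r.
under eq_bigr do rewrite expr2 -mulrA bernS mulrCA.
rewrite -mulr_sumr; congr (_ * _).
under eq_bigr => k _ do rewrite lift0 -natr1 mulrDl mul1r.
by rewrite big_split /= sum_bern1 sum_bern addrC.
Qed.

(** Binomial variance u (1 - u) / M, bounded uniformly in u; this uniformity lets one degree serve
    all points in the approximation below. *)
Lemma sum_bern_var m u : 0 <= u <= 1 ->
  \sum_(k < m.+2) (k%:R / m.+1%:R - u) ^+ 2 * bern m.+1 k u <= m.+1%:R^-1.
Proof.
move=> u01; set M : R := m.+1%:R.
have M0 : M != 0 by rewrite pnatr_eq0.
have -> : \sum_(k < m.+2) (k%:R / M - u) ^+ 2 * bern m.+1 k u =
    M^-2 * (\sum_(k < m.+2) k%:R ^+ 2 * bern m.+1 k u)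
    - 2 * u / M * (\sum_(k < m.+2) k%:R * bern m.+1 k u)
    + u ^+ 2 * (\sum_(k < m.+2) bern m.+1 k u).
  rewrite !mulr_sumr -sumrB -big_split /=; apply: eq_bigr => k _.
  by field.
rewrite sum_bern sum_bern1 sum_bern2 -/M /=.
have -> : m%:R = M - 1 by rewrite /M -natr1 addrK.
have -> : M ^- 2 * (M * u * (1 + (M - 1) * u)) - 2 * u / M * (M * u) + u ^+ 2 * 1
   = M^-1 * (u * (1 - u)) by field.
rewrite ler_piMr ?invr_ge0 ?ler0n//.
by case/andP: u01 => ? ?; nra.
Qed.

End bernstein.

Section mx_norm_bounds.
Context {R : realType} {m n : nat}.
Implicit Types A : 'M[R]_(m, n).

Lemma le_coord_mx_norm A i j : `|A i j| <= `|A|.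
Proof.
rewrite [leRHS]mx_normrE.
exact: (le_bigmax_cond 0 (fun ij : 'I_m * 'I_n => `|A ij.1 ij.2|) (j := (i, j))).
Qed.

Lemma mx_norm_leP A (M : R) : 0 <= M ->
  `|A| <= M <-> forall i j, `|A i j| <= M.
Proof.
move=> M0; split=> [AM i j|AM]; first exact: le_trans (le_coord_mx_norm _ _ _) AM.
by rewrite [leLHS]mx_normrE; apply/bigmax_leP; split=> // -[i j] _; exact: AM.
Qed.

Lemma mx_norm_lt A (M : R) : 0 < M -> (forall i j, `|A i j| < M) -> `|A| < M.
Proof.
by move=> M0 AM; rewrite [ltLHS]mx_normrE; apply/bigmax_ltP; split=> // -[i j] _; exact: AM.
Qed.

End mx_norm_bounds.

Lemma continuous_rV {R : realType} {T : topologicalType} {p : nat} (a : T -> 'rV[R]_p) :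
  (forall j, continuous (fun v => a v 0 j)) -> continuous a.
Proof.
move=> ca v; apply/(@cvgrPdist_le _ _ _ (nbhs v) (nbhs_filter v)) => d d0.
have : \forall w \near v, forall j, `|a v 0 j - a w 0 j| <= d.
  apply: (@filter_forall _ _ _ (nbhs v) (nbhs_filter v)) => j.
  by have /cvgrPdist_le := ca j v; exact.
apply: filterS => w dw; apply/mx_norm_leP; first exact: ltW.
by move=> i j; rewrite ord1; have := dw j; rewrite !mxE.
Qed.

(** * Real trigonometric polynomials on row vectors *)

Section trig_polynomials.
Context {R : realType} {p : nat}.

(** The phase [phi] makes sines and constants special cases and keeps the class closed under
    products without complex exponentials. *)
Inductive trig_poly : ('rV[R]_p -> R) -> Prop :=
| trig_cos (c phi : R) (t : 'cV[R]_p) : trig_poly (fun x => c * cos (phi + (x *m t) 0 0))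
| trigD g h : trig_poly g -> trig_poly h -> trig_poly (fun x => g x + h x).

Lemma eq_trig_poly g h : trig_poly g -> g =1 h -> trig_poly h.
Proof. by move=> tg /funext <-. Qed.

Lemma trig_poly_cst c : trig_poly (fun=> c).
Proof.
apply: eq_trig_poly (trig_cos c 0 0) _ => x.
by rewrite mulmx0 mxE addr0 cos0 mulr1.
Qed.

Lemma trig_polyZ c g : trig_poly g -> trig_poly (fun x => c * g x).
Proof.
elim=> [c' phi t|g1 g2 _ ih1 _ ih2].
  by apply: eq_trig_poly (trig_cos (c * c') phi t) _ => x; rewrite mulrA.
by apply: eq_trig_poly (trigD ih1 ih2) _ => x; rewrite mulrDr.
Qed.

(** Product-to-sum formula on the generators: the phases and frequencies are added and
    subtracted. *)
Lemma trig_polyM g h : trig_poly g -> trig_poly h ->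
  trig_poly (fun x => g x * h x).
Proof.
elim=> [c phi t|g1 g2 _ ih1 _ ih2] th; last first.
  by apply: eq_trig_poly (trigD (ih1 th) (ih2 th)) _ => x; rewrite mulrDl.
elim: th => [c' phi' t'|h1 h2 _ ih1 _ ih2]; last first.
  by apply: eq_trig_poly (trigD ih1 ih2) _ => x; rewrite mulrDr.
apply: eq_trig_poly (trigD (trig_cos (c * c' / 2) (phi + phi') (t + t'))
  (trig_cos (c * c' / 2) (phi - phi') (t - t'))) _ => x.
rewrite mulmxDr mulmxBr !mxE.
set a := \sum_j _; set b := \sum_j _.
rewrite addrACA (_ : phi - phi' + (a - b) = (phi + a) - (phi' + b)); last by ring.
move: (phi + a) (phi' + b) => A B.
by rewrite cosB cosD; field.
Qed.

Lemma trig_poly_sum I (r : seq I) (F : I -> 'rV[R]_p -> R) :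
  (forall i, trig_poly (F i)) -> trig_poly (fun x => \sum_(i <- r) F i x).
Proof.
move=> tF; elim: r => [|i r ih].
  by apply: eq_trig_poly (trig_poly_cst 0) _ => x; rewrite big_nil.
by apply: eq_trig_poly (trigD (tF i) ih) _ => x; rewrite big_cons.
Qed.

Lemma trig_poly_prod I (r : seq I) (F : I -> 'rV[R]_p -> R) :
  (forall i, trig_poly (F i)) -> trig_poly (fun x => \prod_(i <- r) F i x).
Proof.
move=> tF; elim: r => [|i r ih].
  by apply: eq_trig_poly (trig_poly_cst 1) _ => x; rewrite big_nil.
by apply: eq_trig_poly (trig_polyM (tF i) ih) _ => x; rewrite big_cons.
Qed.

Lemma trig_polyX n g : trig_poly g -> trig_poly (fun x => g x ^+ n).
Proof.
move=> tg; elim: n => [|n ih].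
  by apply: eq_trig_poly (trig_poly_cst 1) _ => x; rewrite expr0.
by apply: eq_trig_poly (trig_polyM tg ih) _ => x; rewrite exprS.
Qed.

Lemma trig_poly_sin c j : trig_poly (fun x => sin (c * x 0 j)).
Proof.
apply: eq_trig_poly (trig_cos 1 (- (pi / 2)) (c *: delta_mx j 0)) _ => x.
rewrite mul1r -scalemxAr -colE !mxE addrC cosBpihalf.
by [].
Qed.

Lemma trig_poly_bern m k g : trig_poly g -> trig_poly (fun x => bern m k (g x)).
Proof.
move=> tg; apply: trig_polyM; first exact/trig_polyZ/trig_polyX.
apply: trig_polyX; apply: eq_trig_poly (trigD (trig_poly_cst 1) (trig_polyZ (-1) tg)) _.
by move=> x; rewrite mulN1r.
Qed.

End trig_polynomials.

(** Only [v] has to lie in [K]: halving the radius of continuity at each centre leaves room for any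
    nearby [w]. *)
Lemma uniform_continuity_compact {R : realType} {p : nat} (K : set 'rV[R]_p)
    (H : 'rV[R]_p -> R) (e : R) : compact K -> continuous H -> 0 < e ->
  exists2 dl, 0 < dl & forall v w, K v -> `|v - w| < dl -> `|H v - H w| <= e.
Proof.
move=> /compact_near_coveringP cK cH e0.
have : \forall dl \near 0^'+, K `<=` (fun v => forall w, `|v - w| < dl -> `|H v - H w| <= e).
  apply: cK => x Kx.
  have e20 : 0 < e / 2 by lra.
  have /cvgrPdist_lt /(_ _ e20) := cH x.
  move=> /nbhs_ballP[r /= r0 xr].
  exists (ball x (r / 2), [set dl | dl < r / 2]).
    split; first by apply: nbhsx_ballx; lra.
    by apply: nbhs_right_lt; lra.
  move=> [v dl] [/= xv dlr] w vw.
  have h1 : `|H x - H v| < e / 2.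
    by apply: xr; apply: le_ball xv; lra.
  have h2 : `|H x - H w| < e / 2.
    apply: xr; rewrite -ball_normE /=.
    rewrite (_ : x - w = (x - v) + (v - w)); last by rewrite addrA subrK.
    apply: le_lt_trans (ler_normD _ _) _.
    by move: xv; rewrite -ball_normE /= => xv; lra.
  by rewrite (_ : H v - H w = (H x - H w) - (H x - H v)); [|ring];
    rewrite (le_trans (ler_normB _ _))//; lra.
move=> Hd; near (0 : R)^'+ => dl; exists dl => [|v w Kv].
  by near: dl; exact: nbhs_right_gt.
by move: v Kv w; near: dl.
Unshelve. all: by end_near. Qed.

(** * Multivariate Bernstein operators in the variables sin (x_j / M) *)

Section bernstein_approximation.
Context {R : realType} {p : nat}.

Lemma sum_prod_weights m (b : 'I_p -> 'I_m -> R) :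
  (forall j, \sum_k b j k = 1) ->
  \sum_(k : {ffun 'I_p -> 'I_m}) \prod_j b j (k j) = 1.
Proof.
by move=> b1; rewrite -bigA_distr_bigA /= big1.
Qed.

(** The product weights are the law of independent grid indices; this is the marginal in coordinate
    [i]. *)
Lemma sum_prod_weights1 m (b : 'I_p -> 'I_m -> R) i (F : 'I_m -> R) :
  (forall j, \sum_k b j k = 1) ->
  \sum_(k : {ffun 'I_p -> 'I_m}) F (k i) * \prod_j b j (k j) =
  \sum_l F l * b i l.
Proof.
move=> b1.
transitivity (\sum_(k : {ffun 'I_p -> 'I_m})
    \prod_j ((if j == i then F (k j) else 1) * b j (k j))).
  apply: eq_bigr => k _; rewrite big_split /=; congr (_ * _).
  by rewrite -big_mkcond big_pred1_eq.
rewrite -(bigA_distr_bigA (fun j l => (if j == i then F l else 1) * b j l)) /=.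
rewrite (bigD1 i)//= eqxx [X in _ * X]big1 ?mulr1// => j ji.
by under eq_bigr do rewrite (negbTE ji) mul1r.
Qed.

(** The substitution (1 + sin (x_j / M)) / 2 maps the cube |x_j| <= M into [0, 1]^p and is inverted
    there by asin, since x_j / M stays in [-1, 1], inside the monotone range of sin. A Bernstein
    polynomial of [h] composed with the inverse is then trigonometric in x. Being a convex
    combination of values of [h], it keeps the bound [B] on the whole space and not only on the
    cube, which controls the tails later. *)
Lemma trig_poly_approx (h : 'rV[R]_p -> R) (B M e : R) :
  continuous h -> (forall x, `|h x| <= B) -> 0 < M -> 0 < e ->
  exists g, [/\ trig_poly g, (forall x, `|g x| <= B) &
    forall x : 'rV[R]_p, (forall j, `|x 0 j| <= M) -> `|g x - h x| <= e].
Proof.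
move=> ch hB M0 e0.
have B0 : 0 <= B by apply: le_trans (hB 0).
pose u (y : R) : R := (1 + sin (M^-1 * y)) / 2.
have u01 y : 0 <= u y <= 1.
  have := sin_geN1 (M^-1 * y); have := sin_le1 (M^-1 * y).
  by rewrite /u => ? ?; apply/andP; split; lra.
pose s : R := sin 1.
have pi1 : 1 < pi / 2 :> R.
  rewrite lt_neqAle pihalf_ge1 andbT; apply/negP => /eqP pi1.
  by have := @cos1_gt0 R; rewrite pi1 cos_pihalf ltxx.
have pih : (1 : R) \in `[(- (pi / 2)), pi / 2] by rewrite in_itv /=; lra.
have s1 : s < 1.
  rewrite /s -[ltRHS](@sin_pihalf R) ltr_sin//.
  by rewrite in_itv /=; lra.
have s0 : 0 < s by apply: sin_gt0_pihalf; lra.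
(* On the cube the sine is at most s = sin 1 < 1 in absolute value, so clipping changes nothing
   there; elsewhere it keeps the argument of asin in the open interval where asin is continuous. *)
pose clip (y : R) := Num.max (- s) (Num.min s y).
have clipI y : -1 < clip y < 1.
  rewrite /clip; apply/andP; split.
    by rewrite lt_max; apply/orP; left; lra.
  by rewrite gt_max; apply/andP; split; [lra|rewrite gt_min s1].
pose a (v : 'rV[R]_p) : 'rV[R]_p := \row_j (M * asin (clip (2 * v 0 j - 1))).
have ca : continuous a.
  apply: continuous_rV => j; rewrite /a; under eq_fun do rewrite mxE.
  have c1 : continuous (fun y : R => Num.max (- s) (Num.min s (2 * y - 1))).
    move=> y; apply: (@continuous_max R R (fun=> - s) (fun y => Num.min s (2 * y - 1))); first exact: cvg_cst.
    apply: (@continuous_min R R (fun=> s) (fun y => 2 * y - 1)); first exact: cvg_cst.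
    apply: cvgB; last exact: cvg_cst.
    by apply: cvgM; [exact: cvg_cst|exact: cvg_id].
  move=> v.
  have c2 : (fun w : 'rV[R]_p => clip (2 * w 0 j - 1)) @ v --> clip (2 * v 0 j - 1).
    exact: (cvg_comp _ _ (@coord_continuous _ _ _ _ _ v) (c1 _)).
  have c3 := cvg_comp _ _ c2 (continuous_asin (clipI _)).
  exact: (@cvgM _ _ (nbhs v) (nbhs_filter v) _ _ _ _ (@cvg_cst _ M _ (nbhs v) (nbhs_filter v)) c3).
pose H v := h (a v).
have cH : continuous H by move=> v; exact: (cvg_comp _ _ (ca v) (ch _)).
pose K : set 'rV[R]_p := [set v | forall j, `[0, 1]%classic (v ord0 j)].
have cK : compact K.
  exact: (@rV_compact R p (fun=> `[0, 1]%classic) (fun=> @segment_compact R 0 1)).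
have e20 : 0 < e / 2 by lra.
have [dl dl0 Hdl] := uniform_continuity_compact cK cH e20.
(* Chebyshev constant: when |w - v| >= dl, the trivial bound 2 B is at most C times the squared
   distance, whose mean under the weights is a sum of p binomial variances. *)
pose C := 2 * B / dl ^+ 2.
have C0 : 0 <= C by rewrite divr_ge0 ?sqr_ge0 ?mulr_ge0.
have Cp0 : 0 <= C * p%:R by rewrite mulr_ge0 ?ler0n.
have [m mC] : exists m : nat, C * p%:R / m.+1%:R <= e / 2.
  exists (Num.bound (C * p%:R * 2 / e)).
  have x0 : 0 <= C * p%:R * 2 / e by apply: divr_ge0; [exact: mulr_ge0|exact: ltW].
  have xn := archi_boundP x0; set n := Num.bound _ in xn *.
  rewrite ler_pdivrMr ?ltr0n//; apply: (@le_trans _ _ (e / 2 * n%:R)).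
    move: xn; rewrite ltr_pdivrMr// => xn.
    by rewrite (mulrAC e) ler_pdivlMr// (mulrC e) ltW.
  by rewrite ler_wpM2l ?ltW// ltr_nat.
pose b (x : 'rV[R]_p) (j : 'I_p) (k : 'I_m.+2) : R := bern m.+1 k (u (x 0 j)).
have b0 x j k : 0 <= b x j k by exact: bern_ge0.
have b1 x j : \sum_k b x j k = 1 by exact: sum_bern.
pose nd (k : {ffun 'I_p -> 'I_m.+2}) : 'rV[R]_p := \row_j ((k j)%:R / m.+1%:R).
pose g (x : 'rV[R]_p) := \sum_(k : {ffun 'I_p -> 'I_m.+2}) H (nd k) * \prod_j b x j (k j).
have w0 x (k : {ffun 'I_p -> 'I_m.+2}) : 0 <= \prod_j b x j (k j).
  by apply: prodr_ge0.
exists g; split.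
- apply: trig_poly_sum => k; apply: trig_polyZ; apply: trig_poly_prod => j.
  apply: trig_poly_bern.
  apply: eq_trig_poly (trig_polyZ 2^-1 (trigD (trig_poly_cst 1) (trig_poly_sin M^-1 j))) _.
  by move=> x; rewrite /u mulrC.
- move=> x; rewrite -[leRHS]mulr1 -(sum_prod_weights (b1 x)) mulr_sumr.
  apply: le_trans (ler_norm_sum _ _ _) _; apply: ler_sum => k _.
  by rewrite normrM [X in _ * X]ger0_norm// ler_wpM2r// hB.
move=> x xM.
pose v : 'rV[R]_p := \row_j u (x 0 j).
have hxE : h x = H v.
  rewrite /H; congr h; apply/rowP => j; rewrite !mxE /u.
  have -> : 2 * ((1 + sin (M^-1 * x 0 j)) / 2) - 1 = sin (M^-1 * x 0 j) by field.
  have y1 : -1 <= M^-1 * x 0 j <= 1.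
    by rewrite -ler_norml normrM gtr0_norm ?invr_gt0// mulrC ler_pdivrMr// mul1r.
  have yI : M^-1 * x 0 j \in `[(- (pi / 2)), pi / 2] by rewrite in_itv /=; lra.
  have cE : clip (sin (M^-1 * x 0 j)) = sin (M^-1 * x 0 j).
    have h1 : sin (M^-1 * x 0 j) <= s.
      by rewrite /s leNgt ltr_sin// -leNgt; lra.
    have h2 : - s <= sin (M^-1 * x 0 j).
      rewrite /s -sinN leNgt ltr_sin//; last by rewrite in_itv /=; lra.
      by rewrite -leNgt; lra.
    by rewrite /clip min_r// max_r.
  by rewrite cE sinK// mulrA divff ?mul1r// gt_eqF.
have modulus (w : 'rV[R]_p) : (forall j, 0 <= w 0 j <= 1) ->
    `|H w - H v| <= e / 2 + C * \sum_j (w 0 j - v 0 j) ^+ 2.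
  move=> w01.
  have S0 : 0 <= \sum_j (w 0 j - v 0 j) ^+ 2 by apply: sumr_ge0 => j _; exact: sqr_ge0.
  have [wv|] := ltP `|w - v| dl.
    have Kw : K w by move=> j; rewrite /= in_itv /=; exact: w01.
    by apply: le_trans (Hdl w v Kw wv) _; rewrite lerDl mulr_ge0.
  move=> wv.
  have [j wvj] : exists j, dl <= `|w 0 j - v 0 j|.
    apply: contrapT => /forallNP nj.
    move: wv; rewrite leNgt => /negP; apply.
    apply: mx_norm_lt => // i j.
    by rewrite ord1 !mxE ltNge; apply/negP; have := nj j; rewrite !mxE.
  have S1 : dl ^+ 2 <= \sum_j (w 0 j - v 0 j) ^+ 2.
    rewrite (bigD1 j)//= ler_wpDr ?sumr_ge0// => [i _|]; first exact: sqr_ge0.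
    by rewrite -[leRHS]real_normK ?num_real// lerXn2r// ?nnegrE// ltW.
  have : 2 * B <= C * \sum_j (w 0 j - v 0 j) ^+ 2.
    by rewrite /C mulrAC ler_pdivlMr ?exprn_gt0// ler_wpM2l// mulr_ge0.
  move=> S2; apply: le_trans (ler_normB _ _) _.
  have := hB (a w); have := hB (a v); rewrite -/(H w) -/(H v).
  by move=> ? ?; lra.
have nd01 k j : 0 <= nd k 0 j <= 1.
  rewrite mxE divr_ge0//= ler_pdivrMr ?ltr0n// mul1r ler_nat.
  by rewrite -ltnS ltn_ord.
rewrite hxE -[X in _ - X]mulr1 -(sum_prod_weights (b1 x)) mulr_sumr -sumrB.
under eq_bigr do rewrite -mulrBl.
apply: le_trans (ler_norm_sum _ _ _) _.
apply: (@le_trans _ _ (\sum_(k : {ffun 'I_p -> 'I_m.+2})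
   (e / 2 + C * \sum_j (nd k 0 j - v 0 j) ^+ 2) * \prod_j b x j (k j))).
  apply: ler_sum => k _.
  by rewrite normrM [X in _ * X]ger0_norm// ler_wpM2r// modulus.
under eq_bigr do rewrite mulrDl -(mulrA C) mulr_suml.
rewrite big_split /= -mulr_sumr sum_prod_weights// mulr1 -mulr_sumr exchange_big /=.
have : \sum_j \sum_(k : {ffun 'I_p -> 'I_m.+2})
    (nd k 0 j - v 0 j) ^+ 2 * \prod_j0 b x j0 (k j0) <= p%:R / m.+1%:R.
  apply: (@le_trans _ _ (\sum_(j < p) m.+1%:R^-1)); last first.
    by rewrite big_const_ord iter_addr_0 mulrC mulr_natr.
  apply: ler_sum => j _.
  rewrite (_ : \sum_k _ = \sum_(l < m.+2) (l%:R / m.+1%:R - u (x 0 j)) ^+ 2 * b x j l).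
    exact: sum_bern_var.
  rewrite -(sum_prod_weights1 j _ (b1 x)); apply: eq_bigr => k _.
  by rewrite /nd /v !mxE.
move=> hS.
have := ler_wpM2l C0 hS; rewrite mulrA => hS'.
by apply: (@le_trans _ _ (e / 2 + e / 2)); [rewrite lerD2l (le_trans hS')|lra].
Qed.

End bernstein_approximation.

(** * Expectations and convergence in probability *)

Section measurable_levels.
Context {R : realType} {d : measure_display} {T : measurableType d}.
Implicit Types X : T -> R.

Lemma measurable_geset X a : measurable_fun setT X -> measurable [set w | a <= X w].
Proof.
move=> mX; have := mX measurableT `[a, +oo[%classic (measurable_itv _).
by rewrite setTI; congr measurable; apply/seteqP; split=> w /=; rewrite in_itv /= andbT.
Qed.

Lemma measurable_gtset X a : measurable_fun setT X -> measurable [set w | a < X w].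
Proof.
move=> mX; have := mX measurableT `]a, +oo[%classic (measurable_itv _).
by rewrite setTI; congr measurable; apply/seteqP; split=> w /=; rewrite in_itv /= andbT.
Qed.

End measurable_levels.

Section expectation.
Context {R : realType} {d : measure_display} {T : measurableType d}.
Variable P : probability T R.
Implicit Types X Y : T -> R.

Definition L1 X := P.-integrable setT (EFin \o X).
Definition Ex X : R := \int[P]_w X w.

Lemma L1_meas X : L1 X -> measurable_fun setT X.
Proof. by move=> /integrableP[+ _] => /measurable_EFinP. Qed.

Lemma L1_le X Y : measurable_fun setT X -> (forall w, `|X w| <= Y w) -> L1 Y -> L1 X.
Proof.
move=> mX XY; apply: le_integrable => //; first exact/measurable_EFinP.
by move=> w _ /=; rewrite lee_fin (le_trans (XY w))// ler_norm.
Qed.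

Lemma L1_cst c : L1 (fun=> c).
Proof. exact: finite_measure_integrable_cst. Qed.

Lemma L1_bounded X M : measurable_fun setT X -> (forall w, `|X w| <= M) -> L1 X.
Proof. by move=> mX XM; apply: L1_le (L1_cst M). Qed.

Lemma L1D X Y : L1 X -> L1 Y -> L1 (fun w => X w + Y w).
Proof. by move=> lX lY; exact: (integrableD measurableT lX lY). Qed.

Lemma L1B X Y : L1 X -> L1 Y -> L1 (fun w => X w - Y w).
Proof. by move=> lX lY; exact: (integrableB measurableT lX lY). Qed.

Lemma L1Z c X : L1 X -> L1 (fun w => c * X w).
Proof. by move=> lX; exact: (integrableZl measurableT c lX). Qed.

Lemma L1_norm X : L1 X -> L1 (fun w => `|X w|).
Proof. exact: integrable_norm. Qed.

Lemma L1_sum I (r : seq I) (X : I -> T -> R) : (forall i, L1 (X i)) ->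
  L1 (fun w => \sum_(i <- r) X i w).
Proof.
move=> lX; elim: r => [|i r ih].
  by under eq_fun do rewrite big_nil; exact: L1_cst.
by under eq_fun do rewrite big_cons; exact: L1D.
Qed.

Lemma ExD X Y : L1 X -> L1 Y -> Ex (fun w => X w + Y w) = Ex X + Ex Y.
Proof. by move=> lX lY; rewrite /Ex RintegralD. Qed.

Lemma ExB X Y : L1 X -> L1 Y -> Ex (fun w => X w - Y w) = Ex X - Ex Y.
Proof. by move=> lX lY; rewrite /Ex RintegralB. Qed.

Lemma ExZ c X : L1 X -> Ex (fun w => c * X w) = c * Ex X.
Proof. by move=> lX; rewrite /Ex RintegralZl. Qed.

Lemma Ex_cst c : Ex (fun=> c) = c.
Proof. by rewrite /Ex Rintegral_cst//= (probability_setT P) /= mulr1. Qed.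

Lemma Ex_sum I (r : seq I) (X : I -> T -> R) : (forall i, L1 (X i)) ->
  Ex (fun w => \sum_(i <- r) X i w) = \sum_(i <- r) Ex (X i).
Proof.
move=> lX; elim: r => [|i r ih].
  by under eq_fun do rewrite big_nil; rewrite Ex_cst big_nil.
by under eq_fun do rewrite big_cons; rewrite ExD ?ih ?big_cons//; exact: L1_sum.
Qed.

Lemma Ex_le X Y : L1 X -> L1 Y -> (forall w, X w <= Y w) -> Ex X <= Ex Y.
Proof. by move=> lX lY XY; exact: le_Rintegral. Qed.

Lemma Ex_ge0 X : (forall w, 0 <= X w) -> 0 <= Ex X.
Proof. by move=> X0; exact: Rintegral_ge0. Qed.

Lemma Ex_norm X : L1 X -> `|Ex X| <= Ex (fun w => `|X w|).
Proof. by move=> lX; exact: le_normr_Rintegral. Qed.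

Lemma Ex_bound X M : measurable_fun setT X -> (forall w, `|X w| <= M) -> `|Ex X| <= M.
Proof.
move=> mX XM; have lX := L1_bounded mX XM.
by rewrite (le_trans (Ex_norm lX))// -[leRHS]Ex_cst Ex_le//; [exact: L1_norm|exact: L1_cst].
Qed.

Lemma Ex_indic A : measurable A -> Ex (\1_A) = fine (P A).
Proof. by move=> mA; rewrite /Ex /Rintegral integral_indic// setIT. Qed.

Lemma EFin_Ex X : L1 X -> (Ex X)%:E = (\int[P]_w (X w)%:E)%E.
Proof. by move=> lX; rewrite /Ex /Rintegral fineK// integrable_fin_num. Qed.

Lemma L1_indic A : measurable A -> L1 (\1_A).
Proof.
move=> mA; apply: (@L1_bounded _ 1) => // w.
by rewrite indicE; case: (_ \in _); rewrite ?normr1 ?normr0.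
Qed.

Lemma markov_ineq X a : L1 X -> (forall w, 0 <= X w) -> 0 < a ->
  (P [set w | (a <= X w)%R] <= (Ex X / a)%:E)%E.
Proof.
move=> lX X0 a0; set A := [set w | _].
have mA : measurable A.
  exact: (measurable_geset _ (L1_meas lX)).
rewrite -(fineK (fin_num_measure P A mA)) lee_fin ler_pdivlMr// mulrC -Ex_indic//.
rewrite -ExZ; last exact: L1_indic.
apply: Ex_le => //; first exact/L1Z/L1_indic.
move=> w; rewrite indicE; case: (boolP (w \in A)) => [|_]; last by rewrite mulr0.
by rewrite inE mulr1.
Qed.

Lemma Ex_dominated_cvg (X_ : nat -> T -> R) X Y :
  (forall n, measurable_fun setT (X_ n)) -> L1 Y ->
  (forall n w, `|X_ n w| <= Y w) -> (forall w, X_ n w @[n --> \oo] --> X w) ->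
  Ex (X_ n) @[n --> \oo] --> Ex X.
Proof.
move=> mX lY XY cX.
have mXl : measurable_fun setT X by apply: measurable_fun_cvg mX _ => w _; exact: cX.
have lX : L1 X.
  apply: L1_le lY => // w.
  have cn : `|X_ n w| @[n --> \oo] --> `|X w| by apply: cvg_norm; exact: cX.
  rewrite -(cvg_lim (@Rhausdorff R) cn); apply: limr_le; first exact: cvgP cn.
  by apply: nearW => n; exact: XY.
have lXn n : L1 (X_ n) by apply: L1_le lY.
apply: fine_cvg; rewrite [X in _ --> X](EFin_Ex lX).
apply: (@dominated_cvg _ _ _ P setT measurableT _ _ (EFin \o Y)) => //.
- by move=> n; apply/measurable_EFinP.
- by move=> w _; apply: cvg_EFin; [exact: nearW|exact: cX].
- by move=> n w _ /=; rewrite lee_fin.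
Qed.

End expectation.

(** * Events of high probability and tightness *)

Section stochastic_order.
Context {R : realType} {d : measure_display} {Om : measurableType d}.
Variable P : probability Om R.

(* The events holding with (inner) probability tending to 1, as a filter on
   nat * Om, so that the near tactics combine them. *)
Definition whp : set_system (nat * Om) := [set A | forall e : R, 0 < e ->
  \forall n \near \oo, exists B, [/\ measurable B, (P B <= e%:E)%E &
    forall w, ~ B w -> A (n, w)]].

Global Instance whp_filter : Filter whp.
Proof.
split.
- by move=> e e0; near=> n; exists set0; split=> //; rewrite measure0 lee_fin ltW.
- move=> A A' hA hA' e e0; have e20 : 0 < e / 2 by lra.
  have := hA _ e20; have := hA' _ e20; apply: filterS2 => n.
  move=> [B' [mB' PB' BA']] [B [mB PB BA]]; exists (B `|` B'); split.
  + exact: measurableU.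
  + rewrite (le_trans (measureU2 _ mB mB'))// (splitr e) EFinD leeD//.
  + by move=> w /not_orP[nB nB']; split; [exact: BA|exact: BA'].
- move=> A A' AA' hA e e0; have := hA _ e0; apply: filterS => n [B [mB PB BA]].
  by exists B; split=> // w nB; apply/AA'/BA.
Unshelve. all: by end_near. Qed.

Lemma whp_near (Q : nat -> Prop) : (\forall n \near \oo, Q n) ->
  \forall nw \near whp, Q nw.1.
Proof.
move=> hQ e e0; apply: filterS hQ => n Qn.
by exists set0; split=> //; rewrite measure0 lee_fin ltW.
Qed.

Definition tight (X : nat -> Om -> R) := forall e : R, 0 < e ->
  exists2 M, 0 < M & \forall n \near \oo, exists B, [/\ measurable B,
    (P B <= e%:E)%E & forall w, ~ B w -> `|X n w| <= M].

(** A tight quantity may be treated as bounded by a constant [M] fixed before n. *)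
Lemma tight_whp X (A : set (nat * Om)) : tight X ->
  (forall M, 0 < M -> \forall nw \near whp, `|X nw.1 nw.2| <= M -> A nw) ->
  whp A.
Proof.
move=> tX hA e e0; have e20 : 0 < e / 2 by lra.
have [M M0 hM] := tX _ e20; have := hA _ M0 _ e20; move: hM.
apply: filterS2 => n [B [mB PB BX]] [B' [mB' PB' BA']]; exists (B `|` B'); split.
- exact: measurableU.
- by rewrite (le_trans (measureU2 _ mB mB'))// (splitr e) EFinD leeD.
- by move=> w /not_orP[nB nB']; apply: BA' => //=; exact: BX.
Qed.

Lemma tight_le X Y : tight Y -> (\forall nw \near whp, `|X nw.1 nw.2| <= `|Y nw.1 nw.2|) ->
  tight X.
Proof.
move=> tY XY e e0; have e20 : 0 < e / 2 by lra.
have [M M0 hM] := tY _ e20; have := XY _ e20; move: hM => hM hXY; exists M => //.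
move: hM hXY; apply: filterS2 => n [B [mB PB BX]] [B' [mB' PB' BA']].
exists (B `|` B'); split.
- exact: measurableU.
- by rewrite (le_trans (measureU2 _ mB mB'))// (splitr e) EFinD leeD.
- by move=> w /not_orP[nB nB']; apply: (le_trans (BA' _ nB')) => //=; exact: BX.
Qed.

Lemma tight_Ex X C : (forall n, L1 P (X n)) ->
  (\forall n \near \oo, Ex P (fun w => `|X n w|) <= C) -> tight X.
Proof.
move=> lX XC e e0; pose M := (`|C| + 1) / e.
have M0 : 0 < M by rewrite divr_gt0 ?ltr_wpDl.
exists M => //; apply: filterS XC => n XC; exists [set w | M <= `|X n w|]; split.
- by apply: measurable_geset; apply: L1_meas; exact: L1_norm.
- apply: le_trans (markov_ineq (L1_norm (lX n)) _ M0) _ => //.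
  rewrite lee_fin ler_pdivrMr// /M mulrCA divff ?gt_eqF// mulr1.
  by rewrite (le_trans XC)// (le_trans (ler_norm _))// lerDl.
- by move=> w /negP; rewrite -ltNge => /ltW.
Qed.

Lemma whp_Ex X (a : R) : 0 < a -> (forall n, L1 P (X n)) ->
  Ex P (fun w => `|X n w|) @[n --> \oo] --> 0 ->
  \forall nw \near whp, `|X nw.1 nw.2| <= a.
Proof.
move=> a0 lX cX e e0.
have /cvgrPdist_le /(_ (e * a)) := cX; rewrite mulr_gt0// => /(_ isT).
apply: filterS => n; rewrite sub0r normrN ger0_norm ?Ex_ge0// => Xn.
exists [set w | a <= `|X n w|]; split.
- by apply: measurable_geset; apply: L1_meas; exact: L1_norm.
- apply: le_trans (markov_ineq (L1_norm (lX n)) _ a0) _ => //.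
  by rewrite lee_fin ler_pdivrMr.
- by move=> w /negP; rewrite -ltNge => /ltW.
Qed.

Lemma Ex_close (u v : Om -> R) (A : set Om) B e dl :
  measurable_fun setT u -> measurable_fun setT v ->
  (forall w, `|u w| <= B) -> (forall w, `|v w| <= B) ->
  measurable A -> (P A <= dl%:E)%E -> 0 <= e ->
  (forall w, ~ A w -> `|u w - v w| <= e) ->
  `|Ex P u - Ex P v| <= e + 2 * B * dl.
Proof.
move=> m_u m_v uB vB mA PA e0 uv.
have B0 : 0 <= B by have := uB point; apply: le_trans.
have lu : L1 P u := L1_bounded P m_u uB.
have lv : L1 P v := L1_bounded P m_v vB.
rewrite -ExB//; apply: le_trans (Ex_norm (L1B lu lv)) _.
apply: (@le_trans _ _ (Ex P (fun w => e + 2 * B * \1_A w))).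
  apply: Ex_le; first exact/L1_norm/L1B.
    by apply: L1D; [exact: L1_cst|apply/L1Z/L1_indic].
  move=> w; rewrite indicE; case: (boolP (w \in A)) => [_|].
    rewrite mulr1 (le_trans (ler_normB _ _))//.
    by have := uB w; have := vB w; lra.
  by rewrite notin_setE mulr0 addr0; exact: uv.
rewrite ExD ?ExZ ?Ex_cst ?Ex_indic//; first last.
- by apply/L1Z/L1_indic.
- exact: L1_cst.
- exact: L1_indic.
rewrite lerD2l ler_wpM2l ?mulr_ge0//.
by rewrite -lee_fin fineK// fin_num_measure.
Qed.

Lemma Ex_close_whp (X Y : nat -> Om -> R) B :
  (forall n, measurable_fun setT (X n)) -> (forall n, measurable_fun setT (Y n)) ->
  (forall n w, `|X n w| <= B) -> (forall n w, `|Y n w| <= B) ->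
  (forall e, 0 < e -> \forall nw \near whp, `|X nw.1 nw.2 - Y nw.1 nw.2| <= e) ->
  Ex P (X n) - Ex P (Y n) @[n --> \oo] --> 0.
Proof.
move=> mX mY XB YB XY; apply/cvgrPdist_le => e e0.
have B0 : 0 <= B by have := XB 0%N point; apply: le_trans.
have e20 : 0 < e / 2 by lra.
pose dl := e / 2 / (2 * B + 1).
have dl0 : 0 < dl by rewrite divr_gt0// ltr_wpDl ?mulr_ge0.
have := XY _ e20 _ dl0; apply: filterS => n [A [mA PA hA]].
rewrite sub0r normrN; apply: le_trans (Ex_close (mX n) (mY n) (XB n) (YB n) mA PA _ hA) _.
  exact: ltW.
rewrite [leRHS](splitr e) lerD2l.
rewrite /dl mulrCA ger_pMr// ler_pdivrMr ?mul1r; first by lra.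
by lra.
Qed.

End stochastic_order.

Section measurable_vectors.
Context {R : realType} {d : measure_display} {Om : measurableType d} {p : nat}.
Implicit Types X : Om -> 'rV[R]_p.

Definition vmeas X := forall j, measurable_fun setT (fun w => X w 0 j).

Lemma vmeas_mulmx X (t : 'cV[R]_p) : vmeas X ->
  measurable_fun setT (fun w => (X w *m t) 0 0).
Proof.
move=> mX; under eq_fun do rewrite mxE.
by apply: measurable_sum => j; apply: measurable_funM => //; exact: mX.
Qed.

Lemma L1_cos (P : probability Om R) X phi (t : 'cV[R]_p) : vmeas X ->
  L1 P (fun w => cos (phi + (X w *m t) 0 0)).
Proof.
move=> mX; apply: (@L1_bounded _ _ _ _ _ 1).
  apply: (measurableT_comp (continuous_measurable_fun (@continuous_cos R))).
  by apply: measurable_funD => //; exact: vmeas_mulmx.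
by move=> w; rewrite ler_norml cos_geN1 cos_le1.
Qed.

Lemma L1_trig_poly (P : probability Om R) X g : vmeas X -> trig_poly g ->
  L1 P (fun w => g (X w)).
Proof.
move=> mX; elim=> [c phi t|g1 g2 _ ih1 _ ih2]; last exact: L1D.
exact/L1Z/L1_cos.
Qed.

(** Vectors are measurable by coordinates, which covers trigonometric polynomials at once; a bounded
    continuous [h] is a pointwise limit of these, with radius and accuracy both driven by m. *)
Lemma measurable_continuous_comp (P : probability Om R) X (h : 'rV[R]_p -> R) B : vmeas X ->
  continuous h -> (forall x, `|h x| <= B) -> measurable_fun setT (fun w => h (X w)).
Proof.
move=> mX ch hB.
have : forall m, exists g, [/\ trig_poly g, (forall x, `|g x| <= B) &
    forall x : 'rV[R]_p, (forall j, `|x 0 j| <= m.+1%:R) -> `|g x - h x| <= m.+1%:R^-1].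
  by move=> m; apply: trig_poly_approx.
move=> /choice[g gP].
apply: (@measurable_fun_cvg _ _ _ _ (fun m w => g m (X w))).
  by move=> m; have [tg _ _] := gP m; exact: L1_meas (L1_trig_poly P mX tg).
move=> w _; apply/cvgrPdist_le => e e0; near=> m.
rewrite distrC; have [_ _ /(_ (X w))] := gP m.
have hm : `|X w| <= m.+1%:R.
  apply: (@le_trans _ _ m%:R); last by rewrite ler_nat.
  by near: m; exact: nbhs_infty_ger.
move=> /(_ (fun j => le_trans (le_coord_mx_norm _ _ _) hm)) gh.
rewrite (le_trans gh)//; apply: ltW; near: m.
exact: (near_infty_natSinv_lt (PosNum e0)).
Unshelve. all: by end_near. Qed.

Lemma measurable_norm_vec X : vmeas X -> measurable_fun setT (fun w => `|X w|).
Proof.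
move=> mX.
have -> : (fun w => `|X w|) = (fun w => \big[Num.max/0]_(j < p) `|X w 0 j|).
  apply/funext => w; apply/le_anti/andP; split.
    apply/mx_norm_leP; first exact: bigmax_ge_id.
    by move=> i j; rewrite ord1; exact: (le_bigmax_cond 0 (fun j => `|X w 0 j|)).
  by apply/bigmax_leP; split=> // j _; exact: le_coord_mx_norm.
elim: (index_enum _) => [|j r ih].
  by under eq_fun do rewrite big_nil; exact: measurable_cst.
under eq_fun do rewrite big_cons; apply: measurable_maxr => //.
by apply: measurableT_comp => //; exact: mX.
Qed.

Lemma tight_single (P : probability Om R) (X : Om -> R) :
  measurable_fun setT X -> tight P (fun=> X).
Proof.
move=> mX e e0.
have mXn : measurable_fun setT (fun w => `|X w|) by exact: measurableT_comp.
pose F (m : nat) := [set w | m%:R < `|X w|].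
have mF m : measurable (F m) by exact: measurable_gtset.
have F0 : \bigcap_m F m = set0.
  apply/seteqP; split=> // w; rewrite /bigcap /F /= => h.
  by have := archi_boundP (normr_ge0 (X w)); rewrite ltNge ltW ?h.
have : P (F n) @[n --> \oo] --> 0%E.
  rewrite -(measure0 P) -F0; apply: nonincreasing_cvg_mu => //.
  - by rewrite (le_lt_trans (probability_le1 _ _))// ltry.
  - by rewrite F0.
  - move=> n m nm; apply/subsetPset => w; rewrite /F /=; apply: le_lt_trans.
    by rewrite ler_nat.
move=> /fine_cvgP[_ /cvgrPdist_le /(_ _ e0)] [N _ hN].
exists N.+1%:R => //; near=> n; exists (F N.+1); split => //.
  have := hN N.+1 (leqnSn _); rewrite sub0r normrN ger0_norm ?fine_ge0//= => h.
  by rewrite -(fineK (fin_num_measure P _ (mF _))) lee_fin.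
by move=> w /negP; rewrite -leNgt.
Unshelve. all: by end_near. Qed.

End measurable_vectors.

(** * Levy's continuity theorem for tight sequences *)

Section levy.
Context {R : realType} {d d' : measure_display} {Om : measurableType d}
  {Om' : measurableType d'} {p : nat}.
Variables (P : probability Om R) (Q : probability Om' R).
Variables (X : nat -> Om -> 'rV[R]_p) (Y : Om' -> 'rV[R]_p).
Hypotheses (mX : forall n, vmeas (X n)) (mY : vmeas Y).

(** Tightness confines both laws to a cube up to small probability; inside, [h] is close to a
    trigonometric polynomial [g], and outside the common bound [B] on [g] and [h] is enough. *)
Lemma levy_continuity : tight P (fun n w => `|X n w|) ->
  (forall phi (t : 'cV[R]_p), Ex P (fun w => cos (phi + (X n w *m t) 0 0)) @[n --> \oo]
     --> Ex Q (fun w => cos (phi + (Y w *m t) 0 0))) ->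
  forall h B, continuous h -> (forall x, `|h x| <= B) ->
    Ex P (fun w => h (X n w)) @[n --> \oo] --> Ex Q (fun w => h (Y w)).
Proof.
move=> tX cX h B ch hB.
have cg g : trig_poly g -> Ex P (fun w => g (X n w)) @[n --> \oo] --> Ex Q (fun w => g (Y w)).
  elim=> [c phi t|g1 g2 tg1 ih1 tg2 ih2].
    have E1 n : Ex P (fun w => c * cos (phi + (X n w *m t) 0 0)) =
        c * Ex P (fun w => cos (phi + (X n w *m t) 0 0)) by apply/ExZ/L1_cos.
    rewrite (_ : Ex Q _ = c * Ex Q (fun w => cos (phi + (Y w *m t) 0 0))); last exact/ExZ/L1_cos.
    by under eq_fun do rewrite E1; apply: cvgM; [exact: cvg_cst|exact: cX].
  have E1 n : Ex P (fun w => g1 (X n w) + g2 (X n w)) =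
      Ex P (fun w => g1 (X n w)) + Ex P (fun w => g2 (X n w)).
    by apply: ExD; exact: L1_trig_poly.
  rewrite (_ : Ex Q _ = Ex Q (fun w => g1 (Y w)) + Ex Q (fun w => g2 (Y w))); last first.
    by apply: ExD; exact: L1_trig_poly.
  by under eq_fun do rewrite E1; exact: cvgD.
apply/cvgrPdist_le => e e0.
have B0 : 0 <= B by have := hB 0; apply: le_trans.
(* Replacing [h] by [g] costs e' + 2 B e' under each of the two laws, and the convergence for [g]
   costs e'. *)
pose e' := e / (3 + 4 * B).
have e'0 : 0 < e' by rewrite divr_gt0//; lra.
have [M1 M10 h1] := tX _ e'0.
have [M2 M20 h2] := tight_single Q (measurable_norm_vec mY) e'0.
have M0 : 0 < Num.max M1 M2 by rewrite lt_max M10.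
have [g [tg gB gh]] := trig_poly_approx ch hB M0 e'0.
have [N _ /(_ N (leqnn N)) [B2 [mB2 PB2 hB2]]] := h2.
have EQ : `|Ex Q (fun w => h (Y w)) - Ex Q (fun w => g (Y w))| <= e' + 2 * B * e'.
  apply: (Ex_close _ _ _ _ mB2) => //; [| |exact: ltW|].
  - exact: (measurable_continuous_comp Q mY ch hB).
  - exact: L1_meas (L1_trig_poly Q mY tg).
  - move=> w /hB2; rewrite normr_id => Yw; rewrite distrC; apply: gh => j.
    by rewrite (le_trans (le_coord_mx_norm _ _ _))// (le_trans Yw)// le_max lexx orbT.
have /cvgrPdist_le /(_ _ e'0) := cg _ tg.
move: h1; apply: filterS2 => n [B1 [mB1 PB1 hB1]] hn.
have EP : `|Ex P (fun w => g (X n w)) - Ex P (fun w => h (X n w))| <= e' + 2 * B * e'.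
  apply: (Ex_close _ _ _ _ mB1) => //; [| |exact: ltW|].
  - exact: L1_meas (L1_trig_poly P (mX n) tg).
  - exact: (measurable_continuous_comp P (mX n) ch hB).
  - move=> w /hB1; rewrite normr_id => Yw; apply: gh => j.
    by rewrite (le_trans (le_coord_mx_norm _ _ _))// (le_trans Yw)// le_max lexx.
have eE : e = (3 + 4 * B) * e' by rewrite mulrC divfK//; lra.
move: EQ EP hn; move: (Ex Q _) (Ex Q _) (Ex P _) (Ex P _) => a b a' b'.
rewrite !ler_distl eE => /andP[? ?] /andP[? ?] /andP[? ?]; apply/andP; split; lra.
Qed.

End levy.

(** * Change of measure through a density *)

Section density.
Context {R : realType} {d : measure_display} {T : measurableType d}.
Variables (mu nu : {measure set T -> \bar R}) (D : set T) (h : T -> R).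
Hypotheses (mD : measurable D) (mh : measurable_fun D h).
Hypothesis h0 : forall x, D x -> 0 <= h x.
Hypothesis nuE : forall A, measurable A ->
  nu A = (\int[mu]_(x in A `&` D) (h x)%:E)%E.
Local Open Scope ereal_scope.
Import HBNNSimple.

Let density_nnsfun (g : {nnsfun T >-> R}) :
  \int[nu]_x (g x)%:E = \int[mu]_(x in D) ((g x)%:E * (h x)%:E).
Proof.
under [LHS]eq_integral do rewrite fimfunE -fsumEFin//.
rewrite [LHS]ge0_integral_fsum//; last 2 first.
  - by move=> r; exact/measurable_EFinP/measurableT_comp.
  - by move=> n x _; exact: nnfun_muleindic_ge0.
under [RHS]eq_integral.
  move=> x xD; rewrite fimfunE -fsumEFin// ge0_mule_fsuml; last first.
    by move=> r; exact: nnfun_muleindic_ge0.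
  over.
rewrite [RHS]ge0_integral_fsum//; last 2 first.
  - move=> r; apply: emeasurable_funM; last exact/measurable_EFinP.
    by apply/measurable_EFinP/measurable_funTS; exact: measurable_funM.
  - by move=> n x Dx; apply: mule_ge0; [exact: nnfun_muleindic_ge0|rewrite lee_fin h0].
apply: eq_fsbigr => r _.
have [r0|r0] := leP 0%R r; last first.
  rewrite !integral0_eq// => x _; rewrite preimage_nnfun0// indic0 mulr0//.
  by rewrite mul0e.
under eq_integral do rewrite EFinM.
rewrite ge0_integralZl_EFin//; last exact/measurable_EFinP.
rewrite integral_indic// setIT nuE//.
under [RHS]eq_integral do rewrite EFinM -muleA.
rewrite ge0_integralZl_EFin//; last 2 first.
  - by move=> x Dx; rewrite mule_ge0 ?lee_fin ?h0.
  - apply: emeasurable_funM; last exact/measurable_EFinP.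
    by apply/measurable_EFinP/measurable_funTS.
congr (_ * _); rewrite setIC integral_mkcondr; apply: eq_integral => x _.
by rewrite patchE indicE; case: ifPn => _; rewrite ?mul1e ?mul0e.
Qed.

Lemma ge0_integral_density (g : T -> \bar R) : measurable_fun setT g ->
  (forall x, 0 <= g x) ->
  \int[nu]_x g x = \int[mu]_(x in D) (g x * (h x)%:E).
Proof.
move=> mg g0; pose g_ := nnsfun_approx measurableT mg.
have gE x : g x = limn (fun n => (g_ n x)%:E).
  by apply/esym/cvg_lim => //; apply: cvg_nnsfun_approx.
have mgn n : measurable_fun D (fun x => (g_ n x)%:E * (h x)%:E).
  apply: emeasurable_funM; last exact/measurable_EFinP.
  by apply/measurable_EFinP/measurable_funTS.
under [LHS]eq_integral => x _ do rewrite gE.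
rewrite monotone_convergence//; first last.
- by move=> x _ a b ab; rewrite lee_fin//; exact/lefP/nd_nnsfun_approx.
- by move=> n x _; rewrite lee_fin.
- by move=> n; apply/measurable_EFinP.
transitivity (\int[mu]_(x in D) limn (fun n => (g_ n x)%:E * (h x)%:E)); last first.
  apply: eq_integral => x _; apply/cvg_lim => //; apply: cvgeZr => //.
  exact: cvg_nnsfun_approx.
rewrite monotone_convergence//.
- by congr (limn _); apply/funext => n; exact: density_nnsfun.
- by move=> n x Dx; rewrite mule_ge0 ?lee_fin ?h0.
- move=> x Dx a b ab; rewrite lee_wpmul2r ?lee_fin ?h0//.
  exact/lefP/nd_nnsfun_approx.
Qed.

Lemma integrable_density (g : T -> R) : measurable_fun setT g ->
  nu.-integrable setT (EFin \o g) <->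
  mu.-integrable D (fun x => (g x * h x)%:E).
Proof.
move=> mg.
have E : \int[nu]_x `|(g x)%:E| = \int[mu]_(x in D) `|(g x * h x)%:E|.
  rewrite ge0_integral_density//; last by apply: measurableT_comp => //; exact/measurable_EFinP.
  by apply: eq_integral => x /[!inE] Dx; rewrite EFinM abseM (gee0_abs (_ : 0 <= (h x)%:E))// lee_fin h0.
split=> /integrableP[_ gfin]; apply/integrableP; split.
- apply/measurable_EFinP/measurable_funM => //; exact: measurable_funTS.
- by rewrite -E.
- exact/measurable_EFinP.
- by rewrite E.
Qed.

Lemma Rintegral_density (g : T -> R) : nu.-integrable setT (EFin \o g) ->
  (\int[nu]_x g x = \int[mu]_(x in D) (g x * h x))%R.
Proof.
move=> ig; have mg : measurable_fun setT g.
  by case/integrableP: ig => /measurable_EFinP.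
rewrite /Rintegral; congr fine.
rewrite integralE [RHS]integralE; congr (_ - _).
- rewrite ge0_integral_density//; last exact/measurable_funepos/measurable_EFinP.
  apply: eq_integral => x /[!inE] Dx; rewrite !funeposE/= -EFin_max -EFinM -EFin_max.
  by congr EFin; rewrite maxr_pMl ?h0// mul0r.
- rewrite ge0_integral_density//; last exact/measurable_funeneg/measurable_EFinP.
  apply: eq_integral => x /[!inE] Dx; rewrite !funenegE/= -?EFinN -?EFin_max -?EFinM -?EFinN -?EFin_max.
  by congr EFin; rewrite maxr_pMl ?h0// mul0r mulNr.
Qed.

End density.

(** * Gaussian vectors *)

Section normal_cosine_transform.
Context {R : realType}.
Variable sg : R.
Hypothesis sg0 : 0 < sg.
Let N : probability _ R := normal_prob 0 sg.
Notation leb := (@lebesgue_measure R).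

Let sgN0 : sg != 0. Proof. by rewrite gt_eqF. Qed.

Let pdf := normal_pdf 0 sg.

Let pdfE x : pdf x = normal_peak sg * expR (- (x ^+ 2 / (sg ^+ 2 *+ 2))).
Proof. by rewrite /pdf normal_pdfE// /normal_fun subr0 mulNr. Qed.

Let NE A : measurable A -> N A = (\int[leb]_(x in A `&` setT) (pdf x)%:E)%E.
Proof. by rewrite setIT. Qed.

Let mpdf : measurable_fun setT pdf. Proof. exact: measurable_normal_pdf. Qed.

Let pdf0 x : setT x -> 0 <= pdf x. Proof. by move=> _; exact: normal_pdf_ge0. Qed.

(** Domination by the normal density of variance 2 sg^2: with y = x^2 / (4 sg^2), half of the
    exponent exp (- 2 y) is spent on |x| <= 1 + x^2 <= (1 + 4 sg^2) (1 + y) <= (1 + 4 sg^2) exp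
    y. *)
Lemma normal_prob_L1_id : L1 N (fun x => x).
Proof.
apply: (proj2 (@integrable_density _ _ _ leb N setT pdf measurableT mpdf pdf0 NE _ _)) => //.
pose tau := Num.sqrt 2 * sg.
have tau0 : 0 < tau by rewrite mulr_gt0// sqrtr_gt0.
have tauN0 : tau != 0 by rewrite gt_eqF.
have tau2 : tau ^+ 2 = sg ^+ 2 * 2 by rewrite /tau exprMn sqr_sqrtr// mulrC.
pose C := normal_peak sg * (1 + 4 * sg ^+ 2) / normal_peak tau.
apply: (@le_integrable _ _ R leb setT measurableT (fun x => (x * pdf x)%:E)
  (fun x => (C * normal_pdf 0 tau x)%:E)).
- by apply/measurable_EFinP/measurable_funM.
- move=> x _; rewrite !abse_EFin lee_fin.
  have k0 : 0 < normal_peak tau by exact: normal_peak_gt0.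
  have k1 : 0 < normal_peak sg by exact: normal_peak_gt0.
  have s2_gt0 : 0 < sg ^+ 2 by exact: exprn_gt0.
  have C0 : 0 <= C.
    by rewrite /C divr_ge0 ?mulr_ge0 ?ltW// addr_gt0// mulr_gt0// exprn_gt0.
  rewrite (ger0_norm (mulr_ge0 C0 (normal_pdf_ge0 0 tau x))) normrM.
  rewrite (ger0_norm (pdf0 I : 0 <= pdf x)) pdfE normal_pdfE// /normal_fun subr0 tau2.
  rewrite /C (mulrA (_ / _)) divfK ?gt_eqF// mulrCA -(mulrA (normal_peak sg)) ler_wpM2l ?(ltW k1)//.
  set y := x ^+ 2 / (sg ^+ 2 * 2 *+ 2).
  have -> : - (x ^+ 2 / (sg ^+ 2 *+ 2)) = - y - y.
    by rewrite /y !mulr2n; field; apply/andP; split; rewrite gt_eqF//; lra.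
  rewrite mulNr -/y expRD mulrA ler_wpM2r ?expR_ge0//.
  rewrite expRN -ler_pdivlMr ?invr_gt0 ?expR_gt0// invrK.
  apply: (@le_trans _ _ ((1 + 4 * sg ^+ 2) * (1 + y))); last first.
    rewrite ler_wpM2l ?expR_ge1Dx// ltW// addr_gt0// mulr_gt0// exprn_gt0.
  have x2 : x ^+ 2 = 4 * sg ^+ 2 * y.
    by rewrite /y !mulr2n; field; rewrite gt_eqF//; lra.
  have y0 : 0 <= y.
    by rewrite /y divr_ge0 ?sqr_ge0// mulrn_wge0// mulr_ge0// sqr_ge0.
  have s20 : 0 <= sg ^+ 2 by exact: sqr_ge0.
  apply: (@le_trans _ _ (1 + x ^+ 2)).
    by rewrite -(@real_normK _ x) ?num_real//; have := normr_ge0 x; nra.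
  rewrite x2; nra.
- under eq_fun do rewrite EFinM; apply: integrableZl => //.
  exact: integrable_normal_pdf.
Qed.

Variable phi : R.

Let pdf_derive x : is_derive x (1 : R) pdf (- (x / sg ^+ 2) * pdf x).
Proof.
have -> : pdf = (fun y => normal_peak sg * expR (- (y ^+ 2 / (sg ^+ 2 *+ 2)))).
  by apply/funext => y; exact: pdfE.
apply: is_derive_eq.
rewrite /GRing.scale /= -pdfE pdfE !mulr2n; field.
by rewrite sgN0 gt_eqF//; have : 0 < sg ^+ 2; [exact: exprn_gt0|lra].
Qed.

Let mtrig (F : R -> R) s : continuous F -> measurable_fun (setT : set R) (fun x : R => F (phi + s * x)).
Proof.
move=> cF; apply: (measurableT_comp (continuous_measurable_fun cF)).
by apply: measurable_funD => //; exact: measurable_funM.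
Qed.

Let L1_xsin s : L1 N (fun x : R => x * sin (phi + s * x)).
Proof.
apply: L1_le (L1_norm normal_prob_L1_id).
  by apply: measurable_funM => //; apply: (mtrig (F := @sin R)); exact: continuous_sin.
by move=> x; rewrite normrM ler_piMr// ler_norml sin_geN1 sin_le1.
Qed.

Let L1_cosx s : L1 N (fun x : R => cos (phi + s * x)).
Proof.
apply: (@L1_bounded _ _ _ _ _ 1); first by apply: (mtrig (F := @cos R)); exact: continuous_cos.
by move=> x; rewrite ler_norml cos_geN1 cos_le1.
Qed.

Let pdf_decay x : 0 < x -> pdf x <= normal_peak sg * (sg ^+ 2 *+ 2) / x ^+ 2.
Proof.
move=> x0; have s0 : 0 < sg ^+ 2 *+ 2 by rewrite pmulrn_lgt0// exprn_gt0.
rewrite pdfE -mulrA ler_wpM2l ?normal_peak_ge0//.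
set t := x ^+ 2 / _; have t0 : 0 < t by rewrite divr_gt0// exprn_gt0.
rewrite -[leRHS]invrK invf_div -/t expRN lef_pV2 ?posrE ?expR_gt0//.
by have := expR_ge1Dx t; lra.
Qed.

(** Stein's identity for the function sin (phi + s x): the derivative of sin (phi + s x) times the
    density integrates to 0, the boundary terms vanishing by [pdf_decay]. *)
Lemma normal_stein s :
  Ex N (fun x : R => x * sin (phi + s * x)) = sg ^+ 2 * s * Ex N (fun x : R => cos (phi + s * x)).
Proof.
pose k x := s * cos (phi + s * x) - (sg ^+ 2)^-1 * (x * sin (phi + s * x)).
pose g x := sin (phi + s * x) * pdf x.
pose g' x := k x * pdf x.
have g_derive x : is_derive x (1 : R) g (g' x).
  have pd := pdf_derive x.
  rewrite /g; apply: is_derive_eq.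
  rewrite /GRing.scale /= /g' /k; field.
  by rewrite sgN0.
have Lk : L1 N k by apply: L1B; exact: L1Z.
have cg' : continuous g'.
  move=> x; have pd := pdf_derive x.
  have dg' : derivable g' x 1 by rewrite /g' /k; apply: ex_derive.
  by apply: differentiable_continuous; apply/derivable1_diffP.
have ig' : leb.-integrable setT (EFin \o g').
  exact: (proj1 (@integrable_density _ _ _ leb N setT pdf measurableT mpdf pdf0 NE _ (L1_meas Lk))).
have FTC n : (\int[leb]_(x in `[(- n.+1%:R)%R, n.+1%:R%R]) (g' x)%:E = (g n.+1%:R - g (- n.+1%:R))%:E)%E.
  rewrite (@continuous_FTC2 _ g' g)//.
  - by rewrite gtrN// ltr0n.
  - exact: continuous_subspaceT.
  - split=> [x _|/=|/=].
    + by have hd := g_derive x; exact: ex_derive.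
    + apply: cvg_at_right_filter; apply: differentiable_continuous; apply/derivable1_diffP.
      by have hd := g_derive (- n.+1%:R); exact: ex_derive.
    + apply: cvg_at_left_filter; apply: differentiable_continuous; apply/derivable1_diffP.
      by have hd := g_derive n.+1%:R; exact: ex_derive.
  - by move=> x _; rewrite derive1E; have hd := g_derive x; exact: derive_val.
have lim1 : (\int[leb]_(x in `[(- n.+1%:R)%R, n.+1%:R%R]) (g' x)%:E)%E @[n --> \oo] --> (\int[leb]_x (g' x)%:E)%E.
  under eq_fun do rewrite integral_mkcond.
  apply: (@dominated_cvg _ _ _ leb setT measurableT _ _ (fun x => `|g' x|%:E)) => //.
  - move=> n; apply/(measurable_restrictT _ _).1 => //; apply: measurable_funTS.
    exact: measurable_int ig'.
  - move=> x _; apply: cvg_near_cst; near=> n; rewrite patchE ifT// inE /= in_itv /=.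
    have : `|x| <= n.+1%:R.
      apply: (@le_trans _ _ n%:R); last by rewrite ler_nat.
      by near: n; exact: nbhs_infty_ger.
    by rewrite ler_norml.
  - by move/integrable_norm : ig'.
  - move=> n x _; rewrite patchE; case: ifP => _ //=.
    by rewrite ?abse0 ?normr0 lee_fin.
have lim0 : (g n.+1%:R - g (- n.+1%:R)) @[n --> \oo] --> (0 : R).
  apply: norm_cvg0; pose K := 2 * (normal_peak sg * (sg ^+ 2 *+ 2)).
  have K0 : 0 <= K by rewrite mulr_ge0// mulr_ge0 ?normal_peak_ge0// mulrn_wge0// sqr_ge0.
  apply: (@squeeze_cvgr _ _ _ _ (cst 0) (fun n => K * harmonic n)).
  - apply: nearW => n; rewrite normr_ge0/=.
    apply: le_trans (ler_normB _ _) _; rewrite /g !normrM.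
    have sin1 y : `|sin y| <= 1 :> R by rewrite ler_norml sin_geN1 sin_le1.
    have -> : pdf (- n.+1%:R) = pdf n.+1%:R by rewrite !pdfE sqrrN.
    rewrite (ger0_norm (pdf0 I : 0 <= pdf n.+1%:R)).
    have p1 := @pdf_decay n.+1%:R (ltr0Sn _ _).
    have p0 : 0 <= pdf n.+1%:R by exact: pdf0.
    have s1 := ler_wpM2r p0 (sin1 (phi + s * n.+1%:R)).
    have s2 := ler_wpM2r p0 (sin1 (phi + s * - n.+1%:R)).
    have h3 : normal_peak sg * (sg ^+ 2 *+ 2) / n.+1%:R ^+ 2 <= normal_peak sg * (sg ^+ 2 *+ 2) * harmonic n.
      rewrite ler_wpM2l//; first by rewrite mulr_ge0 ?normal_peak_ge0// mulrn_wge0// sqr_ge0.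
      rewrite /harmonic /= lef_pV2 ?posrE ?exprn_gt0 ?ltr0n// expr2 ler_peMr ?ler0n//.
      by rewrite ler1n.
    have p2 := le_trans p1 h3.
    have -> : K * harmonic n = 2 * (normal_peak sg * (sg ^+ 2 *+ 2) * harmonic n).
      by rewrite /K !mulrA.
    move: p2 s1 s2; move: (pdf _) (_ * harmonic n) => u v; rewrite !mul1r => uv s1 s2.
    by rewrite (le_trans (lerD s1 s2))//; lra.
  - exact: cvg_cst.
  - by rewrite -(mulr0 K); apply: cvgM; [exact: cvg_cst|exact: cvg_harmonic].
have I0 : \int[leb]_x g' x = 0.
  rewrite /Rintegral; suff -> : (\int[leb]_x (g' x)%:E = 0)%E by [].
  move: lim1; rewrite (funext FTC) => lim1; apply: cvg_unique lim1 _ => //.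
  by apply: cvg_EFin; [exact: nearW|exact: lim0].
have : Ex N k = 0.
  by rewrite /Ex (@Rintegral_density _ _ _ leb N setT pdf measurableT mpdf pdf0 NE _ Lk).
rewrite /k ExB ?ExZ//; [|exact: L1Z|exact: L1Z].
move=> /eqP; rewrite subr_eq0 => /eqP h.
by rewrite -mulrA h mulrA divff ?mul1r// expf_neq0.
Unshelve. all: by end_near. Qed.

(** Differentiation under the integral and Stein's identity give F' = - sg^2 s F, so that F times
    exp (s^2 sg^2 / 2) is constant and equal to its value cos phi at s = 0. *)
Lemma normal_cosine_transform s :
  Ex N (fun x : R => cos (phi + s * x)) = expR (- (s ^+ 2 * sg ^+ 2 / 2)) * cos phi.
Proof.
pose F s := Ex N (fun x : R => cos (phi + s * x)).
have dF a : is_derive a (1 : R) F (- (sg ^+ 2 * a * F a)).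
  pose f (s x : R) := cos (phi + s * x).
  have d1 y x : is_derive y (1 : R) (f ^~ x) (- (x * sin (phi + y * x))).
    by rewrite /f; apply: is_derive_eq; rewrite /GRing.scale /=; ring.
  have Ia : `]a - 1, a + 1[%classic a by rewrite /= in_itv /=; lra.
  have intf y : `]a - 1, a + 1[%classic y -> N.-integrable setT (EFin \o f y).
    by move=> _; exact: L1_cosx.
  have derf x y : `]a - 1, a + 1[%classic x -> setT y -> derivable (f ^~ y) x 1.
    by move=> _ _; have hd := d1 x y; exact: ex_derive.
  have d1E x y : partial1of2 f x y = - (y * sin (phi + x * y)).
    by rewrite partial1of2E; have hd := d1 x y; exact: derive_val.
  have Gub x y : `]a - 1, a + 1[%classic x -> setT y -> `|partial1of2 f x y| <= `|y|.
    move=> _ _; rewrite d1E normrN normrM ler_piMr//.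
    by rewrite ler_norml sin_geN1 sin_le1.
  have LN := L1_norm normal_prob_L1_id.
  have G0 (y : R) : 0 <= `|y| by [].
  have h1 := derivable_under_integral measurableT Ia intf derf G0 LN Gub.
  have h2 := differentiation_under_integral measurableT Ia intf derf G0 LN Gub.
  apply: DeriveDef; first exact: h1.
  rewrite -derive1E h2; under eq_Rintegral do rewrite d1E.
  rewrite -/(Ex N (fun y => - (y * sin (phi + a * y)))).
  have -> : Ex N (fun y => - (y * sin (phi + a * y))) = - Ex N (fun y => y * sin (phi + a * y)).
    rewrite -[RHS]mulN1r -ExZ//; congr Ex; apply/funext => y; rewrite mulN1r//.
  by rewrite normal_stein.
pose G s := F s * expR (s ^+ 2 * sg ^+ 2 / 2).
have dG a : is_derive a (1 : R) G 0.
  have := dF a => dFa.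
  rewrite /G; apply: is_derive_eq; rewrite /GRing.scale /=. by field.
have : G s = G 0.
  apply: is_derive_0_is_cst => x; exact: dG.
rewrite /G expr0n /= !mul0r expR0 mulr1 {2}/F.
under eq_fun do rewrite mul0r addr0.
rewrite Ex_cst => <-.
by rewrite mulrCA -expRD addNr expR0 mulr1.
Qed.

End normal_cosine_transform.

Section law.
Context {R : realType} {d d' : measure_display} {Om : measurableType d}
  {T : measurableType d'}.
Variables (P : probability Om R) (X : Om -> T) (mX : measurable_fun setT X).

Definition law : probability T R := distribution P (mfun_Sub (mem_set mX)).

Lemma lawE A : law A = P (X @^-1` A).
Proof. by []. Qed.

Lemma L1_law (g : T -> R) : measurable_fun setT g ->
  L1 P (fun w => g (X w)) <-> L1 law g.
Proof.
move=> mg; have E : (\int[law]_x `|(g x)%:E| = \int[P]_w `|(g (X w))%:E|)%E.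
  rewrite ge0_integral_distribution//.
  by apply/measurableT_comp => //; exact/measurable_EFinP.
split=> /integrableP[_ gfin]; apply/integrableP; split.
- exact/measurable_EFinP.
- by rewrite E.
- by apply/measurable_EFinP; exact: measurableT_comp mg mX.
- by move: gfin; rewrite E.
Qed.

Lemma Ex_law (g : T -> R) : L1 law g -> Ex law g = Ex P (fun w => g (X w)).
Proof.
move=> lg; have mg := L1_meas lg; rewrite /Ex /Rintegral integral_distribution//.
  exact/measurable_EFinP.
exact/(L1_law mg).
Qed.

End law.

(** * Cosine transforms determine laws on the line *)

Section cosine_transform_uniqueness.
Context {R : realType} {d : measure_display} {Om : measurableType d}.
Variables (P : probability Om R) (X : Om -> R) (N : probability (measurableTypeR R) R).
Hypothesis mX : measurable_fun setT X.
Hypothesis XN : forall phi s,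
  Ex P (fun w => cos (phi + s * X w)) = Ex N (fun x : R => cos (phi + s * x)).

(** Levy's theorem applied to a constant sequence of one-dimensional vectors: equal transforms
    converge trivially, and uniqueness of limits identifies the expectations. *)
Let Ex_continuous (h : R -> R) B : continuous h -> (forall x, `|h x| <= B) ->
  Ex P (fun w => h (X w)) = Ex N h.
Proof.
move=> ch hB.
have mXv : vmeas (fun w => const_mx (X w) : 'rV[R]_1).
  by move=> j; under eq_fun do rewrite mxE.
have mYv : vmeas (fun x : measurableTypeR R => const_mx x : 'rV[R]_1).
  by move=> j; under eq_fun do rewrite mxE; exact: measurable_id.
have constM (x : R) (t : 'cV[R]_1) : ((const_mx x : 'rV[R]_1) *m t) 0 0 = t 0 0 * x.
  by rewrite mxE big_ord1 mxE mulrC.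
have := @levy_continuity R _ _ _ _ 1 P N (fun=> fun w => const_mx (X w)) _
  (fun=> mXv) mYv (tight_single P (measurable_norm_vec mXv)).
move=> /(_ _ (fun x : 'rV[R]_1 => h (x 0 0)) B).
have c1 : continuous (fun x : 'rV[R]_1 => h (x 0 0)).
  by move=> x; exact: (cvg_comp _ _ (@coord_continuous _ _ _ _ _ x) (ch _)).
move=> /(_ _ c1 (fun x => hB _)).
have Xe : (fun w => h ((const_mx (X w) : 'rV[R]_1) 0 0)) = (fun w => h (X w)).
  by apply/funext => w; rewrite mxE.
have Ye : (fun x : R => h ((const_mx x : 'rV[R]_1) 0 0)) = h.
  by apply/funext => w; rewrite mxE.
rewrite Xe Ye => L; apply: cvg_unique (L _) => //.
  exact: cvg_cst.
move=> phi t.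
rewrite (_ : (fun n => _) = fun=> Ex N (fun x : R => cos (phi + t 0 0 * x))); last first.
  apply/funext => _; rewrite -XN; congr Ex; apply/funext => w.
  by rewrite constM.
rewrite (_ : (fun x : measurableTypeR R => cos (phi + (const_mx x *m t) 0 0)) =
    (fun x : R => cos (phi + t 0 0 * x))); first exact: cvg_cst.
by apply/funext => x; rewrite constM.
Qed.

Let cdf_eq a : P (X @^-1` `]-oo, a]) = N `]-oo, a]%classic.
Proof.
(* Continuous ramps, equal to 1 up to a and to 0 from a + 1/m on, converging pointwise to the
   indicator of the half-line. *)
pose h (m : nat) (x : R) : R := Num.max 0 (Num.min 1 (1 - m%:R * (x - a))).
have h01 m x : `|h m x| <= 1.
  by rewrite ger0_norm /h ?le_max ?lexx// ge_max ler01 ge_min lexx.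
have ch m : continuous (h m).
  move=> x; rewrite /h; apply: (@continuous_max R R (fun=> 0) (fun y => Num.min 1 (1 - m%:R * (y - a)))); first exact: cvg_cst.
  apply: (@continuous_min R R (fun=> 1) (fun y => 1 - m%:R * (y - a))); first exact: cvg_cst.
  apply: cvgB; first exact: cvg_cst.
  apply: cvgM; first exact: cvg_cst.
  by apply: cvgB; [exact: cvg_id|exact: cvg_cst].
have hlim (x : R) : h m x @[m --> \oo] --> (\1_(`]-oo, a]%classic) x : R).
  have [xa|ax] := leP x a.
    apply: cvg_near_cst; near=> m.
    rewrite indicE mem_set ?in_itv//= /h.
    have : 0 <= m%:R * (a - x) by rewrite mulr_ge0// subr_ge0.
    move=> mx; rewrite min_l; first by rewrite max_r.
    by rewrite lerDl oppr_ge0 -(opprB a x) mulrN oppr_le0.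
  apply: cvg_near_cst; near=> m.
  rewrite indicE memNset ?in_itv/=; last by rewrite in_itv/= leNgt ax.
  rewrite /h max_l// ge_min; apply/orP; right.
  rewrite subr_le0 -ler_pdivrMr ?subr_gt0//.
  by near: m; exact: nbhs_infty_ger.
have mI : measurable (`]-oo, a]%classic : set R) by exact: measurable_itv.
have E1 : Ex P (fun w => h m (X w)) @[m --> \oo] --> Ex P (fun w => \1_(`]-oo, a]%classic) (X w)).
  apply: (Ex_dominated_cvg (Y := fun=> 1)) => //; last exact: L1_cst.
  by move=> m; apply: measurableT_comp => //; exact: continuous_measurable_fun.
have E2 : Ex N (h m) @[m --> \oo] --> Ex N (\1_(`]-oo, a]%classic)).
  apply: (Ex_dominated_cvg (Y := fun=> 1)) => //; last exact: L1_cst.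
  by move=> m; exact: continuous_measurable_fun.
have E3 : (fun m => Ex P (fun w => h m (X w))) = (fun m => Ex N (h m)).
  by apply/funext => m; exact: Ex_continuous (h01 m).
rewrite E3 in E1.
have h1 := cvg_unique (@Rhausdorff R) E1 E2.
have mA : measurable (X @^-1` `]-oo, a]) by rewrite -[X in measurable X]setTI; exact: mX.
have hP : Ex P (fun w => \1_(`]-oo, a]%classic) (X w)) = fine (P (X @^-1` `]-oo, a])).
  by rewrite -Ex_indic//; congr Ex; apply/funext => w; rewrite !indicE.
have hN := Ex_indic N mI.
by rewrite -(fineK (fin_num_measure P _ mA)) -(fineK (fin_num_measure N _ mI)) -hP -hN h1.
Unshelve. all: by end_near. Qed.

Lemma cosine_transform_unique A : measurable A -> P (X @^-1` A) = N A.
Proof.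
move=> mA.
have mX' : measurable_fun setT (X : Om -> measurableTypeR R) by exact: mX.
rewrite -(lawE P mX').
pose g (n : nat) : set R := `](- n%:R), n%:R]%classic.
apply: (@measure_unique _ R (measurableTypeR R) (@ocitv R) g erefl _ _ _ (law P mX') N) => //.
- exact: ocitvI.
- by move=> n; exact: is_ocitv.
- apply/seteqP; split=> // x _.
  exists (Num.bound `|x|).+1 => //; rewrite /g /= in_itv /=.
  have := archi_boundP (normr_ge0 x); set n := Num.bound _ => xn.
  have xn1 : `|x| < n.+1%:R by apply: lt_trans xn _; rewrite ltr_nat.
  by move: xn1; rewrite ltr_norml => /andP[-> /ltW ->].
- move=> _ [[a b] _ <-] /=.
  have [ba|ab] := leP b a; first by rewrite set_itv_ge ?measure0// bnd_simp -leNgt.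
  have -> : `]a, b]%classic = `]-oo, b] `\` `]-oo, a] :> set R.
    apply/seteqP; split=> x /=; rewrite !in_itv /=.
      by move=> /andP[ax xb]; split=> //; apply/negP; rewrite -ltNge.
    by move=> [-> /negP]; rewrite -ltNge => ->.
  have sub : `]-oo, b] `&` `]-oo, a] = `]-oo, a]%classic :> set R.
    by apply/setIidPr => x /=; rewrite !in_itv /= => /le_trans; apply; exact: ltW.
  rewrite !measureD ?sub//=; last 2 first.
  + by rewrite (le_lt_trans (probability_le1 _ _))// ltry.
  + by rewrite (le_lt_trans (probability_le1 _ _))// ltry.
  by rewrite -!cdf_eq.
- move=> k; apply: (@le_lt_trans _ _ 1%E); last exact: ltry.
  by apply: probability_le1; exact: measurable_itv.
Qed.

End cosine_transform_uniqueness.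

(** * Gaussian vectors with prescribed covariance *)

Section gaussian_vectors.
Context {R : realType}.

Lemma sum_sqr_mulmx m (t : 'cV[R]_m) : (t^T *m t) 0 0 = \sum_j t j 0 ^+ 2.
Proof. by rewrite mxE; apply: eq_bigr => j _; rewrite !mxE expr2. Qed.

Lemma sqr_norm_col_mx m (t : 'cV[R]_(1 + m)) : (t^T *m t) 0 0 =
  usubmx t 0 0 ^+ 2 + ((dsubmx t)^T *m dsubmx t) 0 0.
Proof.
rewrite -[X in X^T *m X]vsubmxK tr_col_mx mul_row_col mxE; congr (_ + _).
by rewrite sum_sqr_mulmx big_ord1.
Qed.

(** An independent normal coordinate is adjoined through a product space. The free phase makes the
    induction work: it absorbs the other coordinates while the new one is integrated out. *)
Lemma standard_gaussian_exists p :
  exists (d : measure_display) (Om : measurableType d) (Q : probability Om R)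
    (G : Om -> 'rV[R]_p), vmeas G /\
    forall phi (t : 'cV[R]_p), Ex Q (fun w => cos (phi + (G w *m t) 0 0)) =
      expR (- ((t^T *m t) 0 0 / 2)) * cos phi.
Proof.
elim: p => [|p [d [Om [Q [G [mG GE]]]]]].
  exists _, (measurableTypeR R), (normal_prob 0 1 : probability _ R), (fun=> 0); split.
    by move=> j; under eq_fun do rewrite mxE; exact: measurable_cst.
  move=> phi t; under eq_fun do rewrite mul0mx mxE addr0.
  by rewrite Ex_cst mxE big_ord0 mul0r oppr0 expR0 mul1r.
pose N : probability (measurableTypeR R) R := normal_prob 0 1.
pose G' (w : Om * measurableTypeR R) : 'rV[R]_(1 + p) :=
  row_mx (const_mx w.2) (G w.1).
have mG' : vmeas G'.
  move=> j; rewrite /G'; under eq_fun do rewrite mxE.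
  case: (fintype.split j) => k.
    by under eq_fun do rewrite mxE; exact: measurable_snd.
  exact: (measurableT_comp (mG k) measurable_fst).
exists _, (Om * measurableTypeR R)%type, (Q \x N : probability _ R)%E, G'; split => //.
move=> phi t; pose t1 := usubmx (t : 'cV_(1 + p)) 0 0; pose t2 := dsubmx (t : 'cV_(1 + p)).
have G'E (w : Om) (x : R) : phi + (G' (w, x) *m t) 0 0 = phi + (G w *m t2) 0 0 + t1 * x.
  rewrite -[t](@vsubmxK _ 1 p) mul_row_col mxE -addrA; congr (_ + _); rewrite addrC.
  by congr (_ + _); rewrite mxE big_ord1 mxE /t1 mulrC -[t in RHS](@vsubmxK _ 1 p) col_mxKu.
have tE : (t^T *m t) 0 0 = t1 ^+ 2 + (t2^T *m t2) 0 0.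
  exact: sqr_norm_col_mx.
have L := L1_cos (Q \x N : probability _ R)%E phi t mG'.
have -> : Ex (Q \x N)%E (fun w => cos (phi + (G' w *m t) 0 0)) =
    Ex Q (fun w => Ex N (fun x : R => cos (phi + (G' (w, x) *m t) 0 0))).
  rewrite /Ex /Rintegral -integral12_prod_meas1//.
  congr fine; apply: eq_integral => w _; rewrite /fubini_F fineK//.
  apply: integrable_fin_num => //.
  apply: (@L1_bounded _ _ _ N _ 1) => [|x]; last by rewrite ler_norml cos_geN1 cos_le1.
  rewrite (_ : (fun x : measurableTypeR R => _) = (fun x : R => cos (phi + (G w *m t2) 0 0 + t1 * x))).
    apply: (measurableT_comp (continuous_measurable_fun (@continuous_cos R))).
    by apply: measurable_funD => //; exact: measurable_funM.
  by apply/funext => x; rewrite G'E.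
have inner w : Ex N (fun x : R => cos (phi + (G' (w, x) *m t) 0 0)) =
    expR (- (t1 ^+ 2 / 2)) * cos (phi + (G w *m t2) 0 0).
  under eq_fun do rewrite G'E.
  by rewrite /N (@normal_cosine_transform R 1 ltr01) expr1n mulr1.
under eq_fun do rewrite inner.
rewrite ExZ; last exact: L1_cos.
by rewrite GE mulrA -expRD tE -opprD -mulrDl.
Qed.

(** Block elimination of the first coordinate: the induction hypothesis is applied to the Schur
    complement of the corner entry. *)
Lemma cholesky p (S : 'M[R]_p) : S^T = S ->
  (forall v : 'cV[R]_p, v != 0 -> 0 < (v^T *m S *m v) 0 0) ->
  exists L : 'M[R]_p, S = L^T *m L.
Proof.
elim: p S => [|p ih] S Ssym Spos; first by exists 0; apply/matrixP => -[].
pose S' : 'M[R]_(1 + p) := S.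
pose a := ulsubmx S' 0 0; pose b := ursubmx S'; pose C := drsubmx S'.
have SE : S' = block_mx a%:M b b^T C.
  rewrite -[LHS]submxK /a -mx11_scalar; congr block_mx.
  by rewrite /b trmx_ursub /S' Ssym.
have Spos' : forall v : 'cV[R]_(1 + p), v != 0 -> 0 < (v^T *m S' *m v) 0 0 := Spos.
have a0 : 0 < a.
  pose v : 'cV[R]_(1 + p) := col_mx 1%:M 0.
  have v0 : v != 0.
    apply/eqP => /(congr1 usubmx); rewrite col_mxKu => /matrixP /(_ 0 0).
    by rewrite /usubmx !mxE /= => /eqP; rewrite oner_eq0.
  have := Spos' v v0; rewrite SE /v tr_col_mx trmx1 trmx0.
  rewrite mul_row_block !mul1mx !mul0mx !addr0 mul_row_col mulmx1 mulmx0 addr0.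
  by rewrite mxE mulr1n.
have aN0 : a != 0 by rewrite gt_eqF.
pose C' := C - a^-1 *: (b^T *m b).
have Csym : C^T = C by rewrite /C trmx_drsub /S' Ssym.
have [L' L'E] : exists L' : 'M[R]_p, C' = L'^T *m L'.
  apply: ih.
    by rewrite /C' linearB linearZ /= trmx_mul trmxK Csym.
  (* [u] minimises the form of S over its first coordinate with the others equal to [v]; the minimum
     is the form of the Schur complement at [v]. *)
  move=> v v0; pose u : 'cV[R]_(1 + p) := col_mx (- a^-1 *: (b *m v)) v.
  have u0 : u != 0.
    apply: contra v0 => /eqP /(congr1 dsubmx); rewrite col_mxKd => ->.
    by apply/eqP/matrixP => i j; rewrite !mxE.
  have := Spos' u u0; rewrite SE /u tr_col_mx mul_row_block mul_row_col.
  set x := b *m v; have xT : x^T = v^T *m b^T by rewrite trmx_mul.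
  rewrite mul_mx_scalar (_ : (- a^-1 *: x)^T = - a^-1 *: x^T); last by rewrite linearZ.
  rewrite scalerA mulrN mulfV// scaleN1r xT addNr mul0mx add0r.
  suff -> : (- a^-1 *: (v^T *m b^T) *m b + v^T *m C) *m v = v^T *m C' *m v by [].
  congr (_ *m _); rewrite /C' mulmxBr -scalemxAr -scalemxAl mulmxA scaleNr.
  by rewrite addrC.
pose r := Num.sqrt a.
have r0 : r != 0 by rewrite gt_eqF// sqrtr_gt0.
have rr : r * r = a by rewrite -expr2 sqr_sqrtr// ltW.
exists (block_mx r%:M (r^-1 *: b) 0 L' : 'M[R]_(1 + p)).
rewrite -/S' SE; pose L := block_mx r%:M (r^-1 *: b) 0 L'.
suff -> : block_mx a%:M b b^T C = L^T *m L by [].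
rewrite /L tr_block_mx trmx0 tr_scalar_mx mulmx_block !mulmx0 !mul0mx !addr0.
rewrite -scalar_mxM rr mul_scalar_mx scalerA mulfV// scale1r.
rewrite mul_mx_scalar (_ : (r^-1 *: b)^T = r^-1 *: b^T); last by rewrite linearZ.
rewrite scalerA mulfV// scale1r.
rewrite -L'E -scalemxAl -scalemxAr scalerA -invfM rr /C' addrC subrK.
by [].
Qed.

(** The vector G L has the required transform. Each projection is then normal by uniqueness of
    cosine transforms; a vanishing variance forces t = 0 by definiteness, and the projection is
    constant. *)
Lemma gaussian_vec_exists p (S : 'M[R]_p) : S^T = S ->
  (forall v : 'cV[R]_p, v != 0 -> 0 < (v^T *m S *m v) 0 0) ->
  exists (d : measure_display) (Om : measurableType d) (Q : probability Om R)
    (Y : Om -> 'rV[R]_p), [/\ vmeas Y, is_gaussian_vec Q Y S &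
    forall phi (t : 'cV[R]_p), Ex Q (fun w => cos (phi + (Y w *m t) 0 0)) =
      expR (- ((t^T *m S *m t) 0 0 / 2)) * cos phi].
Proof.
move=> Ssym Spos; have [L SL] := cholesky Ssym Spos.
have [d [Om [Q [G [mG GE]]]]] := standard_gaussian_exists p.
pose Y w := G w *m L.
have mY : vmeas Y.
  by move=> j; under eq_fun do rewrite mxE; apply: measurable_sum => k;
    apply: measurable_funM => //; exact: mG.
have YE phi (t : 'cV[R]_p) : Ex Q (fun w => cos (phi + (Y w *m t) 0 0)) =
    expR (- ((t^T *m S *m t) 0 0 / 2)) * cos phi.
  rewrite /Y; under eq_fun do rewrite -mulmxA.
  by rewrite GE SL trmx_mul !mulmxA.
exists d, Om, Q, Y; split => // t; split; first exact: vmeas_mulmx.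
move=> A mA; have [tS|tS] := eqVneq ((t^T *m S *m t) 0 0) 0.
  have t0 : t = 0 by apply/eqP/negPn/negP => /Spos; rewrite tS ltxx.
  rewrite t0; have Y0 : (fun w => (Y w *m (0 : 'cV[R]_p)) 0 0) = cst 0.
    by apply/funext => w; rewrite mulmx0 mxE.
  rewrite Y0 diracE preimage_cst; case: (0 \in A).
    by rewrite probability_setT.
  by rewrite measure0.
have tS0 : 0 < (t^T *m S *m t) 0 0.
  by apply: Spos; apply: contra tS => /eqP ->; rewrite mulmx0 mxE.
have sg0 : 0 < Num.sqrt ((t^T *m S *m t) 0 0) by rewrite sqrtr_gt0.
apply: (cosine_transform_unique (N := normal_prob 0 (Num.sqrt ((t^T *m S *m t) 0 0)) : probability _ R)) => //.
  exact: vmeas_mulmx.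
move=> phi s; rewrite (@normal_cosine_transform R _ sg0) sqr_sqrtr ?ltW//.
transitivity (Ex Q (fun w => cos (phi + (Y w *m (s *: t)) 0 0))).
  congr (Ex _ _); apply/funext => w; congr cos; rewrite -scalemxAr.
  by rewrite [in RHS]mxE.
rewrite YE; congr (expR (- (_ / 2)) * _).
rewrite (_ : (s *: t)^T = s *: t^T); last by rewrite linearZ.
by rewrite -!scalemxAl -scalemxAr scalerA [in LHS]mxE -expr2.
Qed.

End gaussian_vectors.

(** * Limit theorems for i.i.d. sequences *)

(** The range is cut into bins of width e. The approximation is uniform, so that replacing one
    factor of a bounded product costs a controlled error. *)
Lemma bounded_simple_approx {R : realType} {d : measure_display} {T : measurableType d}
    (g : T -> R) (M e : R) : measurable_fun setT g -> (forall x, `|g x| <= M) -> 0 < e ->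
  exists K (c : 'I_K -> R) (A : 'I_K -> set T), (forall k, measurable (A k)) /\
    forall x, `|g x - \sum_k c k * \1_(A k) x| <= e.
Proof.
move=> mg gM e0.
pose K := (Num.truncn (2 * M / e)).+1.
pose A (k : 'I_K) := [set x | Num.truncn ((g x + M) / e) = k].
pose c (k : 'I_K) := k%:R * e - M.
exists K, c, A; split=> [k|x].
  have -> : A k = [set x | k%:R * e - M <= g x] `\` [set x | k.+1%:R * e - M <= g x].
    apply/seteqP; split=> x; rewrite /A /=.
      have x0 : 0 <= (g x + M) / e.
        by rewrite divr_ge0 ?(ltW e0)//; have := gM x; rewrite ler_norml; lra.
      move=> xk; have := truncn_itv x0; rewrite xk ler_pdivlMr// ltr_pdivrMr//.
      by move=> /andP[? ?]; split; [lra|apply/negP; rewrite -ltNge; lra].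
    move=> [h1 /negP]; rewrite -ltNge => h2; apply: truncn_def.
    by rewrite ler_pdivlMr// ltr_pdivrMr//; apply/andP; split; lra.
  by apply: measurableD; exact: measurable_geset.
have x0 : 0 <= (g x + M) / e.
  by rewrite divr_ge0 ?(ltW e0)//; have := gM x; rewrite ler_norml; lra.
have kK : (Num.truncn ((g x + M) / e) < K)%N.
  rewrite /K ltnS; apply: le_truncn.
  by rewrite ler_wpM2r ?invr_ge0 ?(ltW e0)//; have := gM x; rewrite ler_norml; lra.
have -> : \sum_k c k * \1_(A k) x = c (Ordinal kK).
  rewrite (bigD1 (Ordinal kK))//= big1 ?addr0; last first.
    move=> k /eqP kn; rewrite indicE memNset ?mulr0// => xk; apply: kn.
    by apply/val_inj; rewrite /= xk.
  by rewrite indicE mem_set// mulr1.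
rewrite /c /=.
have := truncn_itv x0; set k := Num.truncn _.
rewrite ler_pdivlMr// ltr_pdivrMr// -natr1 => /andP[h1 h2].
by rewrite ler_norml; apply/andP; split; lra.
Qed.

Section iid.
Context {R : realType} {d d' : measure_display} {Om : measurableType d}
  {T : measurableType d'}.
Variables (P : probability Om R) (nu : probability T R) (z : nat -> Om -> T).
Hypothesis mz : forall i, measurable_fun setT (z i).
Hypothesis indep : mutually_independent P z.
Hypothesis zP : forall i A, measurable A -> P (z i @^-1` A) = nu A.
Implicit Types g h : T -> R.

Lemma L1_z i g : L1 nu g -> L1 P (fun w => g (z i w)).
Proof.
move=> lg; have mg := L1_meas lg; apply/(L1_law P (mz i) mg).
case/integrableP: lg => ? lg; apply/integrableP; split=> //.
by rewrite (eq_measure_integral nu)// => A mA _; exact: zP.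
Qed.

Lemma Ex_z i g : L1 nu g -> Ex P (fun w => g (z i w)) = Ex nu g.
Proof.
move=> lg; have mg := L1_meas lg.
rewrite -(@Ex_law _ _ _ _ _ P _ (mz i)); last by apply/(L1_law P (mz i) mg); exact: L1_z.
rewrite /Ex /Rintegral; congr fine; apply: eq_measure_integral => A mA _.
exact: zP.
Qed.

Definition bmeas g := measurable_fun setT g /\ exists M, forall x, `|g x| <= M.

Lemma bmeas_L1 g : bmeas g -> L1 nu g.
Proof. by case=> mg [M gM]; exact: L1_bounded mg gM. Qed.

Lemma prod_bounded n (G : 'I_n -> T -> R) (Q : pred 'I_n) :
  (forall i, bmeas (G i)) ->
  measurable_fun setT (fun w => \prod_(i < n | Q i) G i (z i w)) /\
  exists2 M, 0 <= M & forall w, `|\prod_(i < n | Q i) G i (z i w)| <= M.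
Proof.
move=> bG; split.
  rewrite (_ : (fun w => _) = fun w => \prod_(i < n) (if Q i then G i (z i w) else 1)); last first.
    by apply/funext => w; rewrite big_mkcond.
  apply: measurable_prod => i _; case: (Q i) => //.
  by apply: measurableT_comp (mz i); case: (bG i).
have /choice[M MP] : forall i, exists M, forall x, `|G i x| <= M by move=> i; case: (bG i).
exists (\prod_(i < n | Q i) `|M i|); first exact: prodr_ge0.
move=> w; rewrite normr_prod; apply: ler_prod => i _.
by rewrite normr_ge0 (le_trans (MP i _))// ler_norm.
Qed.

Let Ex_prod_indic n (A : 'I_n -> set T) : (forall i, measurable (A i)) ->
  Ex P (fun w => \prod_(i < n) \1_(A i) (z i w)) = \prod_(i < n) Ex nu (\1_(A i)).
Proof.
move=> mA.
(* Independence is stated for families indexed by all natural numbers; indices from n on receive the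
   full space. *)
pose B k := if insub k is Some i then A i else setT.
have BE (i : 'I_n) : B i = A i by rewrite /B valK.
have mB k : measurable (B k) by rewrite /B; case: insub.
pose I := \bigcap_(i in [set` iota 0 n]) (z i @^-1` B i).
have PI := indep (iota_uniq 0 n) mB.
have mI : measurable I.
  rewrite /I; apply: bigcap_measurableType => k _.
  by rewrite -[X in measurable X]setTI; exact: mz.
transitivity (Ex P (\1_I)).
  congr (Ex _ _); apply/funext => w; rewrite indicE.
  case: (boolP (w \in I)) => [|].
    rewrite inE => wI; rewrite big1// => i _; rewrite indicE mem_set// -BE.
    by apply: wI => /=; rewrite mem_iota /= add0n.
  rewrite notin_setE => nwI; have [i ni] : exists i : 'I_n, ~ A i (z i w).
    apply: contrapT => /forallNP ni; apply: nwI => k /=; rewrite mem_iota add0n => kn.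
    have := ni (Ordinal kn) => /contrapT.
    by rewrite -BE.
  by rewrite (bigD1 i)//= indicE memNset// mul0r.
rewrite Ex_indic// /I PI.
have -> : (\prod_(i <- iota 0 n) P (z i @^-1` B i) = \prod_(i <- iota 0 n) (fine (nu (B i)))%:E)%E.
  by apply: eq_bigr => i _; rewrite zP// fineK// fin_num_measure.
rewrite -(big_morph EFin EFinM erefl) /=.
have -> : iota 0 n = index_iota 0 n by rewrite /index_iota subn0.
rewrite big_mkord.
by apply: eq_bigr => i _; rewrite Ex_indic// BE.
Qed.

(** Factors are released one at a time: in the induction only the first [m] may fail to be
    indicators. Factor [m] is approximated uniformly by simple functions, and both sides are linear
    in it and bounded by its sup norm. *)
Lemma Ex_prod n (G : 'I_n -> T -> R) : (forall i, bmeas (G i)) ->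
  Ex P (fun w => \prod_(i < n) G i (z i w)) = \prod_(i < n) Ex nu (G i).
Proof.
suff H m : forall G : 'I_n -> T -> R, (forall i, bmeas (G i)) ->
    (forall i : 'I_n, (m <= i)%N -> exists2 A, measurable A & G i = \1_A) ->
    Ex P (fun w => \prod_(i < n) G i (z i w)) = \prod_(i < n) Ex nu (G i).
  by move=> bG; apply: (H n) => // i; rewrite leqNgt ltn_ord.
elim: m => [|m ih] {}G bG Gind.
  have /choice[A AP] : forall i, exists A, measurable A /\ G i = \1_A.
    by move=> i; have [A mA ->] := Gind i (leq0n _); exists A.
  have -> : G = fun i => \1_(A i) by apply/funext => i; case: (AP i).
  by apply: Ex_prod_indic => i; case: (AP i).
have [nm|mn] := leqP n m.
  by apply: ih => // i mi; have := ltn_ord i; rewrite ltnNge (leq_trans nm mi).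
pose m0 := Ordinal mn.
have [mW [B B0 WB]] := prod_bounded (fun i => i != m0) bG.
set W := (fun w => _) in mW.
pose c := \prod_(i < n | i != m0) Ex nu (G i).
have PE g : Ex P (fun w => \prod_(i < n) (if i == m0 then g else G i) (z i w)) =
    Ex P (fun w => g (z m w) * W w).
  congr (Ex _ _); apply/funext => w; rewrite (bigD1 m0)//= eqxx; congr (_ * _).
  by apply: eq_bigr => i /negbTE ->.
have NE g : \prod_(i < n) Ex nu (if i == m0 then g else G i) = Ex nu g * c.
  rewrite (bigD1 m0)//= eqxx; congr (_ * _).
  by apply: eq_bigr => i /negbTE ->.
have indE A : measurable A -> Ex P (fun w => \1_A (z m w) * W w) = Ex nu (\1_A) * c.
  move=> mA; rewrite -PE -NE; apply: ih => [i|i mi].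
    case: ifP => _ //; split; first exact: measurable_indic.
    by exists 1 => x; rewrite indicE; case: (_ \in _); rewrite ?normr1 ?normr0.
  case: (eqVneq i m0) => [_|im]; first by exists A.
  apply: Gind; rewrite ltn_neqAle mi andbT eq_sym.
  by apply: contra im => /eqP im; apply/eqP/val_inj.
have LW A : measurable A -> L1 P (fun w => \1_A (z m w) * W w).
  move=> mA; apply: (@L1_bounded _ _ _ _ _ B).
    by apply: measurable_funM => //; apply: (measurableT_comp _ (mz m)); exact: measurable_indic.
  move=> w; rewrite normrM indicE; case: (_ \in _) => /=; last by rewrite normr0 mul0r.
  by rewrite normr1 mul1r; exact: WB.
have [mg [M gM]] := bG m0.
have LgW : L1 P (fun w => G m0 (z m w) * W w).
  apply: (@L1_bounded _ _ _ _ _ (M * B)).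
    by apply: measurable_funM => //; exact: (measurableT_comp mg (mz m)).
  by move=> w; rewrite normrM ler_pM//; exact: WB.
have -> : Ex P (fun w => \prod_(i < n) G i (z i w)) = Ex P (fun w => G m0 (z m w) * W w).
  by congr (Ex _ _); apply/funext => w; rewrite (bigD1 m0).
rewrite [RHS](bigD1 m0)//= -/c.
apply/eqP; rewrite -subr_eq0 -normr_le0; apply/ler_addgt0Pl => e e0; rewrite addr0.
pose e' := e / (B + `|c| + 1).
have Bc : 0 < B + `|c| + 1 by rewrite ltr_wpDl// addr_ge0.
have e'0 : 0 < e' by rewrite divr_gt0.
have [K [a [A [mA gA]]]] := bounded_simple_approx mg gM e'0.
pose s x := \sum_k a k * \1_(A k) x.
have Ls : L1 nu s by apply: L1_sum => k; exact/L1Z/L1_indic.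
have sWE w : s (z m w) * W w = \sum_k a k * (\1_(A k) (z m w) * W w).
  by rewrite /s mulr_suml; apply: eq_bigr => k _; rewrite mulrA.
have LsW : L1 P (fun w => s (z m w) * W w).
  by under eq_fun do rewrite sWE; apply: L1_sum => k; exact/L1Z/LW.
have sE : Ex P (fun w => s (z m w) * W w) = Ex nu s * c.
  under eq_fun do rewrite sWE.
  rewrite Ex_sum; last by move=> k; exact/L1Z/LW.
  rewrite Ex_sum; last by move=> k; exact/L1Z/L1_indic.
  rewrite mulr_suml; apply: eq_bigr => k _.
  by rewrite ExZ ?indE ?ExZ ?mulrA//; [exact: L1_indic|exact: LW].
have Lg : L1 nu (G m0) := bmeas_L1 (bG m0).
have -> : Ex P (fun w => G m0 (z m w) * W w) - Ex nu (G m0) * c =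
   Ex P (fun w => G m0 (z m w) * W w - s (z m w) * W w) -
   Ex nu (fun x => G m0 x - s x) * c.
  by rewrite ExB// ExB// sE; ring.
apply: (@le_trans _ _ (e' * B + e' * `|c|)).
  apply: le_trans (ler_normB _ _) _; apply: lerD.
    apply: Ex_bound; first exact: (L1_meas (L1B LgW LsW)).
    by move=> w; rewrite -mulrBl normrM ler_pM//; exact: WB.
  rewrite normrM ler_wpM2r//; apply: Ex_bound; last by move=> x; exact: gA.
  exact: (L1_meas (L1B Lg Ls)).
rewrite -mulrDr /e' mulrAC ler_pdivrMr// ler_wpM2l ?(ltW e0)//.
by rewrite lerDl.
Qed.

Lemma Ex_pair i j g h : i != j -> bmeas g -> bmeas h ->
  Ex P (fun w => g (z i w) * h (z j w)) = Ex nu g * Ex nu h.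
Proof.
move=> ij bg bh; pose n := (maxn i j).+1.
have i_n : (i < n)%N by rewrite ltnS leq_maxl.
have jn : (j < n)%N by rewrite ltnS leq_maxr.
pose i0 := Ordinal i_n; pose j0 := Ordinal jn.
have ji0 : j0 != i0 by rewrite eq_sym.
pose G (k : 'I_n) : T -> R := if k == i0 then g else if k == j0 then h else fun=> 1.
have bG k : bmeas (G k).
  rewrite /G; case: ifP => // _; case: ifP => // _.
  by split=> //; exists 1 => x; rewrite normr1.
have := Ex_prod bG.
rewrite (bigD1 i0)//= (bigD1 j0)//= [X in _ * (_ * X)]big1; last first.
  by move=> k /andP[/negbTE k1 /negbTE k2]; rewrite /G k1 k2 Ex_cst.
rewrite mulr1 /G eqxx (negbTE ji0) eqxx => <-.
congr (Ex _ _); apply/funext => w; rewrite (bigD1 i0)//= (bigD1 j0)//= big1.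
  by rewrite mulr1 eqxx (negbTE ji0) eqxx.
by move=> k /andP[/negbTE k1 /negbTE k2]; rewrite k1 k2.
Qed.

End iid.

(** * Taylor bounds for sine, cosine and exponential *)

Section elementary_bounds.
Context {R : realType}.
Implicit Types x y : R.

(** Each use raises the order of a Taylor bound by one, from |cos| <= 1 to the cubic and quartic
    remainders below, at the price of losing the factorials. *)
Lemma mvt_bound (f f' : R -> R) x B : (forall y, is_derive y (1 : R) f (f' y)) ->
  (forall y, `|y| <= `|x| -> `|f' y| <= B) -> `|f x - f 0| <= B * `|x|.
Proof.
move=> df bf.
have cf a b : {within `[a, b], continuous f}.
  apply: continuous_subspaceT => y; apply: differentiable_continuous.
  by apply/derivable1_diffP; have dfy := df y; exact: ex_derive.
have [x0|x0|->] := ltgtP x 0; last by rewrite subrr normr0 mulr0.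
- have [c /[!in_itv]/= /andP[xc c0] E] := MVT x0 (fun y _ => df y) (cf _ _).
  rewrite distrC E sub0r normrM normrN ler_wpM2r// bf//.
  by rewrite !ltr0_norm// ?lerN2 ?ltW// (lt_trans xc).
- have [c /[!in_itv]/= /andP[c0 cx] E] := MVT x0 (fun y _ => df y) (cf _ _).
  rewrite E subr0 normrM ler_wpM2r// bf//.
  by rewrite !gtr0_norm// ltW.
Qed.

Lemma norm_sin_le x : `|sin x| <= `|x|.
Proof.
have := @mvt_bound sin cos x 1 (@is_derive_sin R); rewrite sin0 subr0 mul1r; apply => y _.
by rewrite ler_norml cos_geN1 cos_le1.
Qed.

Lemma norm_cos1_le x : `|cos x - 1| <= x ^+ 2.
Proof.
have := @mvt_bound cos (fun y => - sin y) x `|x| (@is_derive_cos R).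
rewrite cos0 -expr2 real_normK ?num_real//; apply => y yx.
by rewrite normrN (le_trans (norm_sin_le y)).
Qed.

Lemma sin_taylor x : `|sin x - x| <= `|x| ^+ 3.
Proof.
have d y : is_derive y (1 : R) (fun y => sin y - y) (cos y - 1).
  by apply: is_derive_eq; rewrite /GRing.scale /=; ring.
have := @mvt_bound _ _ x (`|x| ^+ 2) d.
rewrite sin0 subrr subr0 -exprSr; apply => y yx.
by rewrite (le_trans (norm_cos1_le y))// -(@real_normK _ y) ?num_real// lerXn2r.
Qed.

Lemma cos_taylor x : `|cos x - 1 + x ^+ 2 / 2| <= `|x| ^+ 4.
Proof.
have d y : is_derive y (1 : R) (fun y => cos y - 1 + y ^+ 2 / 2) (y - sin y).
  by apply: is_derive_eq; rewrite /GRing.scale /=; field.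
have := @mvt_bound _ _ x (`|x| ^+ 3) d.
rewrite cos0 subrr expr0n /= mul0r addr0 subr0 -exprSr; apply => y yx.
by rewrite distrC (le_trans (sin_taylor y))// lerXn2r.
Qed.

(** A quadratic bound valid on the whole line: at x = g / sqrt n, multiplied by n, it is dominated
    by 2 g^2, while the cubic bound supplies the pointwise limit. *)
Lemma sin_taylor2 x : `|sin x - x| <= 2 * x ^+ 2.
Proof.
rewrite -(@real_normK _ x) ?num_real//; have x0 := normr_ge0 x.
have [x1|x1] := leP `|x| 1.
  by rewrite (le_trans (sin_taylor x))// exprS; nra.
by rewrite (le_trans (ler_normB _ _))//; have := norm_sin_le x; nra.
Qed.

Lemma cos_taylor2 x : `|cos x - 1 + x ^+ 2 / 2| <= 2 * x ^+ 2.
Proof.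
rewrite (le_trans (ler_normD _ _))//; have := norm_cos1_le x.
by have x0 := sqr_ge0 x; rewrite (@ger0_norm _ (_ / 2)) ?divr_ge0//; lra.
Qed.

Lemma expRN_taylor y : 0 <= y -> `|expR (- y) - 1 + y| <= y ^+ 2.
Proof.
move=> y0; have h1 := expR_ge1Dx (- y).
have h2 : expR (- y) <= (1 + y)^-1.
  by rewrite expRN lef_pV2 ?posrE ?expR_gt0 ?expR_ge1Dx//; lra.
have h3 : (1 + y)^-1 <= 1 - y + y ^+ 2.
  rewrite -[leLHS]mul1r ler_pdivrMr; last lra.
  rewrite (_ : (1 - y + y ^+ 2) * (1 + y) = 1 + y ^+ 3); last by ring.
  by rewrite lerDl exprn_ge0.
by rewrite ger0_norm; lra.
Qed.

End elementary_bounds.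

Lemma sum_ord_cst {R : realType} n (c : R) : \sum_(i < n) c = n%:R * c.
Proof. by rewrite big_const_ord iter_addr_0 mulr_natl. Qed.

Lemma norm_sum_ord_le {R : realType} n (F : 'I_n -> R) M :
  (forall i, `|F i| <= M) -> `|\sum_(i < n) F i| <= n%:R * M.
Proof.
move=> FM; rewrite -sum_ord_cst (le_trans (ler_norm_sum _ _ _))//.
by apply: ler_sum.
Qed.

(** * Weak law of large numbers *)

Section iid_limits.
Context {R : realType} {d d' : measure_display} {Om : measurableType d}
  {T : measurableType d'}.
Variables (P : probability Om R) (nu : probability T R) (z : nat -> Om -> T).
Hypothesis mz : forall i, measurable_fun setT (z i).
Hypothesis indep : mutually_independent P z.
Hypothesis zP : forall i A, measurable A -> P (z i @^-1` A) = nu A.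
Implicit Types g h : T -> R.

Let L1z := L1_z mz zP.
Let Exz := Ex_z mz zP.

Lemma Ex_sqr_sum n g : bmeas g -> Ex nu g = 0 ->
  Ex P (fun w => (\sum_(i < n) g (z i w)) ^+ 2) = n%:R * Ex nu (fun x => g x ^+ 2).
Proof.
move=> [mg [M gM]] g0.
have bg : bmeas g by split=> //; exists M.
have L i j : L1 P (fun w => g (z i w) * g (z j w)).
  apply: (@L1_bounded _ _ _ _ _ (M * M)).
    by apply: measurable_funM; apply: (measurableT_comp mg (mz _)).
  by move=> w; rewrite normrM ler_pM.
have -> : (fun w => (\sum_(i < n) g (z i w)) ^+ 2) =
    (fun w => \sum_(i < n) \sum_(j < n) g (z i w) * g (z j w)).
  by apply/funext => w; rewrite expr2 mulr_suml; apply: eq_bigr => i _; rewrite mulr_sumr.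
rewrite Ex_sum; last by move=> i; exact: L1_sum.
have -> : n%:R * Ex nu (fun x => g x ^+ 2) = \sum_(i < n) Ex nu (fun x => g x ^+ 2).
  by rewrite sum_ord_cst.
apply: eq_bigr => i _; rewrite Ex_sum// (bigD1 i)//= big1 ?addr0.
  rewrite -(Exz i); last first.
    apply: (@L1_bounded _ _ _ _ _ (M * M)); first by apply: measurable_funM.
    by move=> x; rewrite normrM ler_pM.
  by congr (Ex _ _); apply/funext => w; rewrite expr2.
move=> j ji; rewrite (Ex_pair mz indep zP _ bg bg); first by rewrite g0 mul0r.
by apply: contra ji => /eqP ij; apply/eqP/val_inj.
Qed.

(** Integrates 2 a |X| <= a^2 + X^2, in place of the Cauchy-Schwarz inequality. *)
Lemma Ex_norm_sqr (X : Om -> R) a : L1 P X -> L1 P (fun w => X w ^+ 2) -> 0 < a ->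
  Ex P (fun w => `|X w|) <= (a + Ex P (fun w => X w ^+ 2) / a) / 2.
Proof.
move=> lX lX2 a0.
have -> : (a + Ex P (fun w => X w ^+ 2) / a) / 2 = Ex P (fun w => a / 2 + (2 * a)^-1 * X w ^+ 2).
  rewrite ExD ?Ex_cst ?ExZ//; last 2 first.
  - exact: L1_cst.
  - exact: L1Z.
  by field; rewrite gt_eqF.
apply: Ex_le; first exact: L1_norm.
  by apply: L1D; [exact: L1_cst|exact: L1Z].
move=> w; rewrite -(@real_normK _ (X w)) ?num_real//.
rewrite -subr_ge0 (_ : _ - _ = (2 * a)^-1 * (a - `|X w|) ^+ 2); last by field; rewrite gt_eqF.
by rewrite mulr_ge0 ?sqr_ge0// invr_ge0 mulr_ge0// ltW.
Qed.

Lemma truncation g e : L1 nu g -> 0 < e ->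
  exists h, [/\ bmeas h, (forall x, `|h x| <= `|g x|) & Ex nu (fun x => `|g x - h x|) <= e].
Proof.
move=> lg e0; have mg := L1_meas lg.
pose tr (n : nat) x := Num.max (- n%:R) (Num.min n%:R (g x)).
have mtr n : measurable_fun setT (tr n).
  by apply: measurable_maxr => //; exact: measurable_minr.
have trn n x : `|tr n x| <= n%:R.
  by rewrite ler_norml /tr le_max lexx /= ge_max ge_min lexx /= andbT -subr_ge0 opprK addr_ge0.
have trg n x : `|tr n x| <= `|g x|.
  have n0 : 0 <= n%:R :> R by [].
  rewrite /tr; have [h1|h1] := leP n%:R (g x).
    rewrite max_r; last by lra.
    by rewrite ger0_norm// (le_trans h1)// ler_norm.
  have [h2|h2] := leP (- n%:R) (g x) => //.
  by rewrite normrN ger0_norm// -(normrN (g x)) (le_trans _ (ler_norm _))//; lra.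
have trl x : `|g x - tr n x| @[n --> \oo] --> (0 : R).
  apply: cvg_near_cst; near=> n; rewrite /tr.
  have gn : `|g x| <= n%:R by near: n; exact: nbhs_infty_ger.
  move: gn; rewrite ler_norml => /andP[g1 g2].
  by rewrite min_r// max_r// subrr normr0.
have L2 : L1 nu (fun x => 2 * `|g x|) by apply/L1Z/L1_norm.
have : Ex nu (fun x => `|g x - tr n x|) @[n --> \oo] --> Ex nu (fun=> 0).
  apply: (Ex_dominated_cvg (Y := fun x => 2 * `|g x|)) => //.
    by move=> n; apply: measurableT_comp => //; exact: measurable_funB.
  move=> n x; rewrite normr_id (le_trans (ler_normB _ _))//.
  by have := trg n x; lra.
rewrite Ex_cst => /cvgrPdist_le /(_ _ e0) [N _ /(_ N (leqnn N))].
rewrite sub0r normrN ger0_norm ?Ex_ge0// => h.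
exists (tr N); split=> //; split=> //; exists N%:R => x; exact: trn.
Unshelve. all: by end_near. Qed.

Definition mean n g w : R := n%:R^-1 * \sum_(i < n) g (z i w).

Lemma L1_mean n g : L1 nu g -> L1 P (mean n g).
Proof. by move=> lg; apply/L1Z/L1_sum => i; exact: (L1z i lg). Qed.

Lemma Ex_norm_mean n g : L1 nu g -> Ex P (fun w => `|mean n g w|) <= Ex nu (fun x => `|g x|).
Proof.
move=> lg; have lgn := L1_norm lg.
apply: (@le_trans _ _ (Ex P (mean n (fun x => `|g x|)))).
  apply: Ex_le; [exact/L1_norm/L1_mean|exact: L1_mean|move=> w].
  by rewrite normrM ger0_norm ?invr_ge0// ler_wpM2l ?invr_ge0// ler_norm_sum.
rewrite ExZ; last by apply: L1_sum => i; exact: (L1z i lgn).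
rewrite Ex_sum; last by move=> i; exact: (L1z i lgn).
under eq_bigr => i _ do rewrite (Exz i lgn).
rewrite sum_ord_cst mulrA.
case: n => [|n]; first by rewrite mulr0 mul0r Ex_ge0.
by rewrite mulVf ?mul1r// pnatr_eq0.
Qed.

(** Only integrability is available, so [g] is truncated: the centred bounded part has second moment
    V / n and the rest is small in L1 uniformly in n. The means thus converge in L1, and Markov's
    inequality concludes. *)
Lemma weak_lln g e : L1 nu g -> 0 < e ->
  \forall nw \near whp P, `|mean nw.1 g nw.2 - Ex nu g| <= e.
Proof.
move=> lg e0; apply: (@whp_Ex _ _ _ P (fun n w => mean n g w - Ex nu g)) => //.
  by move=> n; apply: L1B; [exact: L1_mean|exact: L1_cst].
apply/cvgrPdist_le => ep ep0.
have ep4 : 0 < ep / 4 by rewrite divr_gt0.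
have [h [bh _ gh]] := truncation lg ep4.
have lh := bmeas_L1 nu bh.
pose k x := h x - Ex nu h.
have bk : bmeas k.
  case: bh => mh [M hM]; split; first exact: measurable_funB.
  by exists (M + `|Ex nu h|) => x; rewrite (le_trans (ler_normB _ _))// lerD2r.
have lk := bmeas_L1 nu bk.
have k0 : Ex nu k = 0 by rewrite /k ExB ?Ex_cst ?subrr//; exact: L1_cst.
pose V := Ex nu (fun x => k x ^+ 2).
have V0 : 0 <= V by apply: Ex_ge0 => x; exact: sqr_ge0.
near=> n; rewrite sub0r normrN ger0_norm ?Ex_ge0//.
have n0 : (0 < n)%N by near: n; exact: nbhs_infty_gt.
have nR0 : 0 < n%:R :> R by rewrite ltr0n.
have lgh : L1 nu (fun x => g x - h x) by exact: L1B.
have E w : mean n g w - Ex nu g = mean n k w + mean n (fun x => g x - h x) w + (Ex nu h - Ex nu g).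
  have -> : mean n k w = mean n h w - Ex nu h.
    rewrite /mean /k sumrB mulrBr; congr (_ - _).
    by rewrite sum_ord_cst mulrA mulVf ?mul1r// gt_eqF.
  by rewrite /mean sumrB mulrBr; ring.
apply: (@le_trans _ _ (Ex P (fun w => `|mean n k w| + `|mean n (fun x => g x - h x) w| + ep / 4))).
  apply: Ex_le.
  - by apply/L1_norm/L1B; [exact: L1_mean|exact: L1_cst].
  - by apply: L1D; [apply: L1D; exact/L1_norm/L1_mean|exact: L1_cst].
  - move=> w; rewrite E (le_trans (ler_normD _ _))// lerD//; first exact: ler_normD.
    rewrite -ExB// (le_trans (Ex_norm (L1B lh lg)))//.
    by rewrite (le_trans _ gh)// le_eqVlt; apply/orP; left; apply/eqP; congr (Ex _ _);
      apply/funext => x; rewrite distrC.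
rewrite ExD; [|by apply: L1D; exact/L1_norm/L1_mean|exact: L1_cst].
rewrite ExD ?Ex_cst; [|exact/L1_norm/L1_mean|exact/L1_norm/L1_mean].
have h1 := le_trans (Ex_norm_mean n lgh) gh.
have lk2 : L1 P (fun w => mean n k w ^+ 2).
  case: bk => mk [M kM].
  have M0 : 0 <= M by apply: le_trans (kM point).
  apply: (@L1_bounded _ _ _ _ _ (M ^+ 2)).
    by apply: measurable_funX; exact: L1_meas (L1_mean n lk).
  move=> w; rewrite normrX lerXn2r ?nnegrE//.
  rewrite /mean normrM ger0_norm ?invr_ge0 ?ler0n// ler_pdivrMl//.
  by apply: norm_sum_ord_le => i; exact: kM.
have h2 := Ex_norm_sqr (L1_mean n lk) lk2 ep4.
have h3 : Ex P (fun w => mean n k w ^+ 2) = V / n%:R.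
  rewrite /mean; under eq_fun do rewrite exprMn.
  have -> : Ex P (fun w => n%:R^-1 ^+ 2 * (\sum_(i < n) k (z i w)) ^+ 2) = n%:R^-1 ^+ 2 * (n%:R * V).
    rewrite ExZ ?Ex_sqr_sum//.
    case: bk => mk [M kM].
    apply: (@L1_bounded _ _ _ _ _ ((n%:R * M) ^+ 2)).
      apply: measurable_funX; apply: measurable_sum => i.
      exact: (measurableT_comp mk (mz i)).
    move=> w; rewrite normrX lerXn2r ?nnegrE//; last first.
      by apply: norm_sum_ord_le => i; exact: kM.
    by rewrite mulr_ge0//; apply: le_trans (kM point).
  by field; rewrite gt_eqF.
have h4 : V / n%:R <= (ep / 4) ^+ 2.
  rewrite ler_pdivrMr// mulrC -ler_pdivrMr ?exprn_gt0//.
  by near: n; exact: nbhs_infty_ger.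
rewrite h3 in h2.
have h5 : V / n%:R / (ep / 4) <= ep / 4 by rewrite ler_pdivrMr// -expr2.
lra.
Unshelve. all: by end_near. Qed.

End iid_limits.

(** * Maxima, normalised sums and the central limit theorem *)

Section central_limit.
Context {R : realType} {d d' : measure_display} {Om : measurableType d}
  {T : measurableType d'}.
Variables (P : probability Om R) (nu : probability T R) (z : nat -> Om -> T).
Hypothesis mz : forall i, measurable_fun setT (z i).
Hypothesis indep : mutually_independent P z.
Hypothesis zP : forall i A, measurable A -> P (z i @^-1` A) = nu A.
Implicit Types g h : T -> R.

Let L1z := L1_z mz zP.
Let Exz := Ex_z mz zP.

(** Union bound followed by Markov's inequality on the tail: n nu(g > eta n) <= E[g; g > eta n] /
    eta, which tends to 0 by integrability. *)
Lemma whp_max g eta : L1 nu g -> (forall x, 0 <= g x) -> 0 < eta ->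
  \forall nw \near whp P, forall i, (i < nw.1)%N -> g (z i nw.2) <= eta * nw.1%:R.
Proof.
move=> lg g0 eta0 e e0; have mg := L1_meas lg.
pose tl (n : nat) x := g x * \1_[set x | eta * n%:R < g x] x.
have mA (n : nat) : measurable [set x | eta * n%:R < g x] by exact: measurable_gtset.
have mtl n : measurable_fun setT (tl n).
  by apply: measurable_funM => //; exact: measurable_indic.
have tlg n x : `|tl n x| <= g x.
  rewrite /tl indicE normrM ger0_norm//; case: (_ \in _) => /=.
    by rewrite normr1 mulr1.
  by rewrite normr0 mulr0.
have ltl n : L1 nu (tl n) by apply: L1_le lg.
have : Ex nu (tl n) @[n --> \oo] --> Ex nu (fun=> 0).
  apply: (Ex_dominated_cvg (Y := g)) => // x; apply: cvg_near_cst; near=> n.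
  rewrite /tl indicE memNset ?mulr0//=; apply/negP; rewrite -leNgt.
  rewrite mulrC -ler_pdivrMr//; near: n; exact: nbhs_infty_ger.
have ee0 : 0 < e * eta by rewrite mulr_gt0.
rewrite Ex_cst => /cvgrPdist_le /(_ _ ee0); apply: filterS => n.
rewrite sub0r normrN => tle.
pose A := [set x | eta * n%:R < g x].
have mzA i : measurable (z i @^-1` A).
  by rewrite -[X in measurable X]setTI; apply: mz => //; exact: mA.
exists (\bigcup_(i < n) (z i @^-1` A)); split.
- by apply: fin_bigcup_measurable.
- rewrite bigcup_mkord; apply: (@le_trans _ _ (\sum_(i < n) P (z i @^-1` A))%E).
    exact: (@Boole_inequality _ _ _ P (fun i => z i @^-1` A) n (fun i _ => mzA i)).
  have -> : (\sum_(i < n) P (z i @^-1` A) = \sum_(i < n) (fine (nu A))%:E)%E.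
    by apply: eq_bigr => i _; rewrite (zP _ (mA n)) fineK// fin_num_measure//; exact: mA.
  rewrite sumEFin lee_fin sum_ord_cst -(Ex_indic nu (mA n)) -/A.
  have h : eta * n%:R * Ex nu (\1_A) <= Ex nu (tl n).
    rewrite -ExZ; last exact: (L1_indic nu (mA n)).
    apply: Ex_le => //; first exact: (L1Z _ (L1_indic nu (mA n))).
    move=> x; rewrite /tl -/A indicE; case: (boolP (x \in A)) => [|_]; last by rewrite !mulr0.
    by rewrite inE /A /= !mulr1 => /ltW.
  rewrite -(ler_pM2l eta0) mulrA; apply: (le_trans h); apply: le_trans (ler_norm _) _.
  by rewrite (mulrC eta e).
- move=> w nB i /= i_n; rewrite leNgt; apply/negP => h; apply: nB.
  by exists i.
Unshelve. all: by end_near. Qed.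

Lemma Ex_norm_sum g V n : L1 nu g -> L1 nu (fun x => g x ^+ 2) -> Ex nu g = 0 ->
  Ex nu (fun x => g x ^+ 2) <= V ->
  Ex P (fun w => `|(Num.sqrt n%:R)^-1 * \sum_(i < n) g (z i w)|) <= V + 3.
Proof.
move=> lg lg2 g0 gV; case: n => [|n].
  under eq_fun do rewrite big_ord0 mulr0 normr0.
  rewrite Ex_cst addr_ge0// (le_trans _ gV)// Ex_ge0// => x; exact: sqr_ge0.
set m := n.+1; pose r : R := Num.sqrt m%:R.
have r0 : 0 < r by rewrite sqrtr_gt0 ltr0n.
have rr : r ^+ 2 = m%:R by rewrite sqr_sqrtr.
have rm1 : 0 < r^-1 by rewrite invr_gt0.
(* The second moment of a sum is known for bounded functions only. A truncation error of n^(-1/2)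
   offsets the factor sqrt n in front of the mean of g - h and of the centring [Ex nu h]: each
   contributes at most 1. *)
have [h [bh hg gh]] := truncation lg rm1.
have lh := bmeas_L1 nu bh.
pose k x := h x - Ex nu h.
have bk : bmeas k.
  case: bh => mh [M hM]; split; first exact: measurable_funB.
  by exists (M + `|Ex nu h|) => x; rewrite (le_trans (ler_normB _ _))// lerD2r.
have lk := bmeas_L1 nu bk.
have k0 : Ex nu k = 0 by rewrite /k ExB ?Ex_cst ?subrr//; exact: L1_cst.
have lh2 : L1 nu (fun x => h x ^+ 2).
  apply: L1_le lg2; first by apply: measurable_funX; exact: L1_meas lh.
  by move=> x; rewrite normrX -[leRHS](real_normK (num_real _)) lerXn2r ?nnegrE.
have kV : Ex nu (fun x => k x ^+ 2) <= V.
  have E : Ex nu (fun x => k x ^+ 2) = Ex nu (fun x => h x ^+ 2) - Ex nu h ^+ 2.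
    have -> : (fun x => k x ^+ 2) = (fun x => h x ^+ 2 + (- 2 * Ex nu h) * h x + Ex nu h ^+ 2).
      by apply/funext => x; rewrite /k; ring.
    rewrite (ExD (L1D lh2 (L1Z _ lh)) (L1_cst nu _)) (ExD lh2 (L1Z _ lh)) ExZ// Ex_cst.
    by ring.
  rewrite E (le_trans _ gV)// lerBlDr ler_wpDr ?sqr_ge0//.
  apply: Ex_le => // x.
  by rewrite -(@real_normK _ (h x)) ?num_real// -(@real_normK _ (g x)) ?num_real// lerXn2r ?nnegrE.
have lgh : L1 nu (fun x => g x - h x) by exact: L1B.
have hg1 : `|Ex nu h| <= r^-1.
  rewrite -[Ex nu h]subr0 -g0 -ExB//; rewrite (le_trans (Ex_norm (L1B lh lg)))//.
  rewrite (le_trans _ gh)// le_eqVlt; apply/orP; left; apply/eqP; congr (Ex _ _).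
  by apply/funext => x; rewrite distrC.
have LS g' : L1 nu g' -> L1 P (fun w => r^-1 * \sum_(i < m) g' (z i w)).
  by move=> lg'; apply/L1Z/L1_sum => i; exact: (L1z i lg').
have E w : r^-1 * \sum_(i < m) g (z i w) = r^-1 * \sum_(i < m) k (z i w)
    + r * mean z m (fun x => g x - h x) w + r * Ex nu h.
  rewrite /mean /k !sumrB sum_ord_cst -rr.
  by field; rewrite gt_eqF.
apply: (@le_trans _ _ (Ex P (fun w => `|r^-1 * \sum_(i < m) k (z i w)|
    + r * `|mean z m (fun x => g x - h x) w| + 1))).
  apply: Ex_le.
  - by apply: L1_norm; exact: LS.
  - apply: L1D; last exact: L1_cst.
    apply: L1D; first by apply: L1_norm; exact: LS.
    by apply/L1Z/L1_norm; exact: (L1_mean mz zP).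
  - move=> w; rewrite E (le_trans (ler_normD _ _))// lerD//.
      rewrite (le_trans (ler_normD _ _))// lerD2l normrM ger0_norm// ltW//.
    rewrite normrM ger0_norm ?(ltW r0)//.
    by rewrite -(@mulfV _ r) ?gt_eqF// ler_wpM2l// ltW.
have l1 : L1 P (fun w => `|r^-1 * \sum_(i < m) k (z i w)|) by apply: L1_norm; exact: LS.
have l2 : L1 P (fun w => r * `|mean z m (fun x => g x - h x) w|).
  by apply/L1Z/L1_norm; exact: (L1_mean mz zP).
rewrite ExD ?Ex_cst; [|exact: L1D|exact: L1_cst].
rewrite ExD// ExZ; last by apply/L1_norm; exact: (L1_mean mz zP).
have h1 : r * Ex P (fun w => `|mean z m (fun x => g x - h x) w|) <= 1.
  rewrite -(@mulfV _ r) ?gt_eqF// ler_wpM2l ?(ltW r0)//.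
  exact: le_trans (Ex_norm_mean mz zP m lgh) gh.
have lk2 : L1 P (fun w => (r^-1 * \sum_(i < m) k (z i w)) ^+ 2).
  case: bk => mk [M kM].
  have M0 : 0 <= M by apply: le_trans (kM point).
  apply: (@L1_bounded _ _ _ _ _ ((r^-1 * (m%:R * M)) ^+ 2)).
    by apply: measurable_funX; exact: L1_meas (LS _ lk).
  move=> w; rewrite normrX lerXn2r ?nnegrE//.
    by rewrite mulr_ge0 ?(ltW rm1)// mulr_ge0.
  by rewrite normrM gtr0_norm// ler_wpM2l ?(ltW rm1)//; apply: norm_sum_ord_le.
have h2 := Ex_norm_sqr (LS _ lk) lk2 ltr01.
have h3 : Ex P (fun w => (r^-1 * \sum_(i < m) k (z i w)) ^+ 2) <= V.
  under eq_fun do rewrite exprMn.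
  rewrite ExZ ?(Ex_sqr_sum mz indep zP)//.
    by rewrite mulrA exprVn rr mulVf ?mul1r ?pnatr_eq0.
  case: bk => mk [M kM].
  have M0 : 0 <= M by apply: le_trans (kM point).
  apply: (@L1_bounded _ _ _ _ _ ((m%:R * M) ^+ 2)).
    by apply: measurable_funX; apply: measurable_sum => i; exact: (measurableT_comp mk (mz i)).
  move=> w; rewrite normrX lerXn2r ?nnegrE//; first by rewrite mulr_ge0.
  by apply: norm_sum_ord_le.
rewrite divr1 in h2.
have V0 : 0 <= V by apply: le_trans gV; apply: Ex_ge0 => x; exact: sqr_ge0.
move: h1 h2 h3; lra.
Qed.

Section cosine_recursion.
Variable v : T -> R.
Hypothesis mv : measurable_fun setT v.

Let A k w := \sum_(i < k) v (z i w).

Let bcos : bmeas (fun x => cos (v x)).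
Proof.
split; first exact: (measurableT_comp (continuous_measurable_fun (@continuous_cos R)) mv).
by exists 1 => x; rewrite ler_norml cos_geN1 cos_le1.
Qed.

Let bsin : bmeas (fun x => sin (v x)).
Proof.
split; first exact: (measurableT_comp (continuous_measurable_fun (@continuous_sin R)) mv).
by exists 1 => x; rewrite ler_norml sin_geN1 sin_le1.
Qed.

Let mA k : measurable_fun setT (A k).
Proof. by apply: measurable_sum => i; exact: (measurableT_comp mv (mz i)). Qed.

Let lcosA k phi : L1 P (fun w => cos (phi + A k w)).
Proof.
apply: (@L1_bounded _ _ _ _ _ 1); last by move=> w; rewrite ler_norml cos_geN1 cos_le1.
apply: (measurableT_comp (continuous_measurable_fun (@continuous_cos R))).
exact: measurable_funD.
Qed.

Let cosS k phi w : cos (phi + A k.+1 w) =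
  cos (phi + A k w) * cos (v (z k w)) + cos (phi + pi / 2 + A k w) * sin (v (z k w)).
Proof.
rewrite /A big_ord_recr /= addrA cosD -(addrAC phi) cosDpihalf.
by ring.
Qed.

(** Independence of the partial sum from the later observations. A cosine of a sum is not a product
    of functions of single observations, so the addition formula peels off one summand at a time;
    arbitrary later factors [H i] are carried along so that cos (v) or sin (v) of the peeled
    observation can join them. *)
Let cos_prod k : forall phi N (H : nat -> T -> R), (forall i, bmeas (H i)) -> (k <= N)%N ->
  Ex P (fun w => cos (phi + A k w) * \prod_(i < N | (k <= i)%N) H i (z i w)) =
  Ex P (fun w => cos (phi + A k w)) * \prod_(i < N | (k <= i)%N) Ex nu (H i).
Proof.
elim: k => [|k ih] phi N H bH kN.
  have E w : cos (phi + A 0 w) = cos phi by rewrite /A big_ord0 addr0.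
  have -> : Ex P (fun w => cos (phi + A 0 w)) = cos phi.
    by under eq_fun do rewrite E; rewrite Ex_cst.
  under eq_fun do rewrite E.
  have [mB [B _ bB]] := prod_bounded mz xpredT (fun i : 'I_N => bH i).
  rewrite ExZ; last exact: (@L1_bounded _ _ _ _ _ B).
  by rewrite (Ex_prod mz indep zP (fun i : 'I_N => bH i)).
pose H' u i := if i == k then u else H i.
have bH' u : bmeas u -> forall i, bmeas (H' u i).
  by move=> bu i; rewrite /H'; case: ifP.
pose k0 := Ordinal kN.
have pred_k (i : 'I_N) : (k <= i)%N && (i != k0) = (k < i)%N.
  by rewrite ltn_neqAle andbC eq_sym.
have split1 u w : \prod_(i < N | (k <= i)%N) H' u i (z i w) =
    u (z k w) * \prod_(i < N | (k < i)%N) H i (z i w).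
  rewrite (bigD1 k0)//= /H' eqxx; congr (_ * _); apply: eq_big => [i|i /andP[_]].
    exact: pred_k.
  by move=> ik; rewrite ifF//; apply/negbTE; apply: contra ik => /eqP ik; apply/eqP/val_inj.
have split2 u : \prod_(i < N | (k <= i)%N) Ex nu (H' u i) =
    Ex nu u * \prod_(i < N | (k < i)%N) Ex nu (H i).
  rewrite (bigD1 k0)//= /H' eqxx; congr (_ * _); apply: eq_big => [i|i /andP[_]].
    exact: pred_k.
  by move=> ik; rewrite ifF//; apply/negbTE; apply: contra ik => /eqP ik; apply/eqP/val_inj.
have step1 psi u : bmeas u ->
    Ex P (fun w => cos (psi + A k w) * u (z k w)) = Ex P (fun w => cos (psi + A k w)) * Ex nu u.
  move=> bu; have := ih psi k.+1 (H' u) (bH' _ bu) (leqnSn k).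
  rewrite big_mkcond big_ord_recr /= leqnn big1 => [|i]; last by rewrite leqNgt ltn_ord.
  rewrite mul1r /H' eqxx => <-; congr (Ex _ _); apply/funext => w.
  rewrite big_mkcond big_ord_recr /= leqnn big1 => [|i]; last by rewrite leqNgt ltn_ord.
  by rewrite mul1r eqxx.
have step2 psi u : bmeas u ->
    Ex P (fun w => cos (psi + A k w) * u (z k w) * \prod_(i < N | (k < i)%N) H i (z i w)) =
    Ex P (fun w => cos (psi + A k w)) * Ex nu u * \prod_(i < N | (k < i)%N) Ex nu (H i).
  move=> bu; rewrite -mulrA -split2 -ih//; last 2 first.
  - exact: bH'.
  - exact: ltnW.
  by congr (Ex _ _); apply/funext => w; rewrite split1 mulrA.
have lcu psi u : bmeas u -> L1 P (fun w => cos (psi + A k w) * u (z k w)).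
  move=> [mu_ [M uM]]; apply: (@L1_bounded _ _ _ _ _ (1 * M)).
    by apply: measurable_funM; [exact: L1_meas (lcosA k psi)|exact: (measurableT_comp mu_ (mz k))].
  by move=> w; rewrite normrM ler_pM// ler_norml cos_geN1 cos_le1.
have [mB [B B0 bB]] := prod_bounded mz (fun i : 'I_N => (k < i)%N) (fun i : 'I_N => bH i).
have lcuB psi u : bmeas u ->
    L1 P (fun w => cos (psi + A k w) * u (z k w) * \prod_(i < N | (k < i)%N) H i (z i w)).
  move=> bu; have ml := L1_meas (lcu psi _ bu); case: bu => mu_ [M uM].
  apply: (@L1_bounded _ _ _ _ _ (1 * M * B)); first exact: measurable_funM.
  by move=> w; rewrite normrM ler_pM// normrM ler_pM// ler_norml cos_geN1 cos_le1.
under eq_fun do rewrite cosS mulrDl.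
rewrite (ExD (lcuB _ _ bcos) (lcuB _ _ bsin)).
rewrite (step2 _ _ bcos) (step2 _ _ bsin) -mulrDl; congr (_ * _).
under [in RHS]eq_fun do rewrite cosS.
by rewrite (ExD (lcu _ _ bcos) (lcu _ _ bsin)) (step1 _ _ bcos) (step1 _ _ bsin).
Qed.

Lemma Ex_cos_sumS k phi : Ex P (fun w => cos (phi + A k.+1 w)) =
  Ex nu (fun x => cos (v x)) * Ex P (fun w => cos (phi + A k w)) +
  Ex nu (fun x => sin (v x)) * Ex P (fun w => cos (phi + pi / 2 + A k w)).
Proof.
have step1 psi u : bmeas u ->
    Ex P (fun w => cos (psi + A k w) * u (z k w)) = Ex nu u * Ex P (fun w => cos (psi + A k w)).
  move=> bu; rewrite mulrC; have := @cos_prod k psi k.+1 (fun=> u) (fun=> bu) (leqnSn k).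
  rewrite big_mkcond big_ord_recr /= leqnn big1 => [|i]; last by rewrite leqNgt ltn_ord.
  rewrite mul1r => <-; congr (Ex _ _); apply/funext => w.
  rewrite big_mkcond big_ord_recr /= leqnn big1 => [|i]; last by rewrite leqNgt ltn_ord.
  by rewrite mul1r.
have lcu psi u : bmeas u -> L1 P (fun w => cos (psi + A k w) * u (z k w)).
  move=> [mu_ [M uM]]; apply: (@L1_bounded _ _ _ _ _ (1 * M)).
    by apply: measurable_funM; [exact: L1_meas (lcosA k psi)|exact: (measurableT_comp mu_ (mz k))].
  by move=> w; rewrite normrM ler_pM// ler_norml cos_geN1 cos_le1.
under eq_fun do rewrite cosS.
by rewrite (ExD (lcu _ _ bcos) (lcu _ _ bsin)) (step1 _ _ bcos) (step1 _ _ bsin).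
Qed.

(** Compares the recursion for the cosines with the pure geometric recursion of ratio [psi]. Since
    |psi| <= 1 and the expectations are at most 1, the one-step errors simply add up. *)
Lemma Ex_cos_sum_close psi k phi : `|psi| <= 1 ->
  `|Ex P (fun w => cos (phi + A k w)) - psi ^+ k * cos phi| <=
  k%:R * (`|Ex nu (fun x => cos (v x)) - psi| + `|Ex nu (fun x => sin (v x))|).
Proof.
move=> psi1; elim: k phi => [|k ih] phi.
  under eq_fun do rewrite /A big_ord0 addr0.
  by rewrite Ex_cst expr0 mul1r subrr normr0 mul0r.
have c1 f : `|Ex P (fun w => cos (f + A k w))| <= 1.
  apply: Ex_bound; first exact: L1_meas (lcosA k f).
  by move=> w; rewrite ler_norml cos_geN1 cos_le1.
rewrite Ex_cos_sumS exprS.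
have := ih phi; move: (c1 phi) (c1 (phi + pi / 2)).
set al := Ex nu _; set be := Ex nu _.
set c := Ex P _; set c' := Ex P _ => cb cb' ihk.
have -> : al * c + be * c' - psi * psi ^+ k * cos phi =
    (al - psi) * c + be * c' + psi * (c - psi ^+ k * cos phi) by ring.
rewrite -natr1 [leRHS]mulrDl mul1r [leRHS]addrC; apply: le_trans (ler_normD _ _) _.
apply: lerD; last by rewrite normrM -[leRHS]mul1r ler_pM.
apply: le_trans (ler_normD _ _) _; rewrite !normrM; apply: lerD.
  by rewrite -[leRHS]mulr1 ler_wpM2l.
by rewrite -[leRHS]mulr1 ler_wpM2l.
Qed.

End cosine_recursion.

(** It suffices that n times the one-step error tends to 0; this follows from the Taylor bounds by
    dominated convergence, the first-order term of the sine vanishing because [g] is centred. *)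
Lemma central_limit_cos g phi : L1 nu g -> L1 nu (fun x => g x ^+ 2) -> Ex nu g = 0 ->
  Ex P (fun w => cos (phi + (Num.sqrt n%:R)^-1 * \sum_(i < n) g (z i w))) @[n --> \oo] -->
    expR (- (Ex nu (fun x => g x ^+ 2) / 2)) * cos phi.
Proof.
move=> lg lg2 g0; have mg := L1_meas lg.
set V := Ex nu _; have V0 : 0 <= V by apply: Ex_ge0 => x; exact: sqr_ge0.
pose r (n : nat) : R := (Num.sqrt n%:R)^-1.
have r2 n : (0 < n)%N -> n%:R * r n ^+ 2 = 1.
  move=> n0; rewrite /r exprVn sqr_sqrtr// mulfV// pnatr_eq0 -lt0n//.
have r0 n : 0 <= r n by rewrite invr_ge0 sqrtr_ge0.
have rcvg : r n @[n --> \oo] --> (0 : R).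
  apply/cvgrPdist_le => e e0; near=> n; rewrite sub0r normrN ger0_norm//.
  have n0 : (0 < n)%N by near: n; exact: nbhs_infty_gt.
  rewrite /r -[leRHS]invrK lef_pV2 ?posrE ?invr_gt0 ?sqrtr_gt0 ?ltr0n//.
  apply: le_trans (ler_norm _) _; rewrite -sqrtr_sqr; apply: ler_wsqrtr.
  by near: n; exact: nbhs_infty_ger.
(* The one-step factor exp (- V / (2 n)), whose n-th power is exactly the limit. *)
pose ps n : R := expR (- (V / 2 * r n ^+ 2)).
have ps1 n : `|ps n| <= 1.
  rewrite ger0_norm ?expR_ge0// -expR0 ler_expR oppr_le0.
  by rewrite mulr_ge0 ?sqr_ge0// divr_ge0.
have psn n : (0 < n)%N -> ps n ^+ n = expR (- (V / 2)).
  by move=> n0; rewrite -expRM_natl mulrN mulrCA r2// mulr1.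
have lgr n : L1 nu (fun x => r n * g x) by exact: L1Z.
have mvn n : measurable_fun setT (fun x => r n * g x) := L1_meas (lgr n).
pose al n := Ex nu (fun x => cos (r n * g x)).
pose be n := Ex nu (fun x => sin (r n * g x)).
have mcos n : measurable_fun setT (fun x => cos (r n * g x)).
  exact: (measurableT_comp (continuous_measurable_fun (@continuous_cos R)) (mvn n)).
have msin n : measurable_fun setT (fun x => sin (r n * g x)).
  exact: (measurableT_comp (continuous_measurable_fun (@continuous_sin R)) (mvn n)).
have lcos n : L1 nu (fun x => cos (r n * g x)).
  by apply: (@L1_bounded _ _ _ _ _ 1) => // x; rewrite ler_norml cos_geN1 cos_le1.
have lsin n : L1 nu (fun x => sin (r n * g x)).
  by apply: (@L1_bounded _ _ _ _ _ 1) => // x; rewrite ler_norml sin_geN1 sin_le1.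
(* [q = 0] serves the cubic remainder of the sine, [q = 1] the quartic remainder of the cosine. *)
have pw q (x : T) : n%:R * `|r n * g x| ^+ q.+3 @[n --> \oo] --> (0 : R).
  have : `|g x| ^+ q.+3 * r n ^+ q.+1 @[n --> \oo] --> `|g x| ^+ q.+3 * 0 ^+ q.+1.
    by apply: cvgM; [exact: cvg_cst|exact: (cvg_comp _ _ rcvg (@exprn_continuous _ _ _))].
  rewrite expr0n mulr0; apply: cvg_trans; apply: near_eq_cvg; near=> n.
  have n0 : (0 < n)%N by near: n; exact: nbhs_infty_gt.
  suff -> : n%:R * `|r n * g x| ^+ q.+3 = `|g x| ^+ q.+3 * r n ^+ q.+1 by [].
  rewrite normrM exprMn (ger0_norm (r0 n)) mulrA [RHS]mulrC; congr (_ * _).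
  by rewrite -[q.+3]/(2 + q.+1)%N exprD mulrA r2// mul1r.
have dom (F : R -> R) (n : nat) (x : T) : (forall y, `|F y| <= 2 * y ^+ 2) ->
    `|n%:R * F (r n * g x)| <= 2 * g x ^+ 2.
  move=> FF; rewrite normrM ger0_norm//.
  have [->|n0] := posnP n; first by rewrite mul0r mulr_ge0// sqr_ge0.
  apply: le_trans (ler_wpM2l (ler0n _ n) (FF _)) _.
  by rewrite exprMn mulrCA (mulrA n%:R) r2// mul1r.
have lim_be : n%:R * be n @[n --> \oo] --> (0 : R).
  pose F n x := n%:R * (sin (r n * g x) - r n * g x).
  have : Ex nu (F n) @[n --> \oo] --> Ex nu (fun=> 0).
    apply: (Ex_dominated_cvg (Y := fun x => 2 * g x ^+ 2)).
    - by move=> n; apply: measurable_funM => //; exact: measurable_funB.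
    - exact: L1Z.
    - by move=> n x; apply: (dom (fun y => sin y - y)) => y; exact: sin_taylor2.
    - move=> x; apply: norm_cvg0; apply: (@squeeze_cvgr _ _ _ _ (cst 0) _ _ _ _ _ (pw 0%N x)).
      + by apply: nearW => n; rewrite normr_ge0 normrM ger0_norm//= ler_wpM2l// sin_taylor.
      + exact: cvg_cst.
  have E n : n%:R * be n = Ex nu (F n).
    rewrite /F ExZ; last exact: L1B.
    by rewrite (ExB (lsin n) (lgr n)) ExZ// g0 mulr0 subr0.
  by rewrite Ex_cst => h; under eq_fun do rewrite E; exact: h.
have lim_al : n%:R * (al n - 1 + V / 2 * r n ^+ 2) @[n --> \oo] --> (0 : R).
  pose F n x := n%:R * (cos (r n * g x) - 1 + (r n * g x) ^+ 2 / 2).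
  have l2 n : L1 nu (fun x => (r n * g x) ^+ 2 / 2).
    rewrite (_ : (fun x => _) = (fun x => (r n ^+ 2 / 2) * g x ^+ 2)); first exact: L1Z.
    by apply/funext => x; rewrite exprMn mulrAC.
  have l1 n : L1 nu (fun x => cos (r n * g x) - 1) by apply: L1B => //; exact: L1_cst.
  have : Ex nu (F n) @[n --> \oo] --> Ex nu (fun=> 0).
    apply: (Ex_dominated_cvg (Y := fun x => 2 * g x ^+ 2)).
    - by move=> n; apply: measurable_funM => //; exact: (L1_meas (L1D (l1 n) (l2 n))).
    - exact: L1Z.
    - by move=> n x; apply: (dom (fun y => cos y - 1 + y ^+ 2 / 2)) => y; exact: cos_taylor2.
    - move=> x; apply: norm_cvg0; apply: (@squeeze_cvgr _ _ _ _ (cst 0) _ _ _ _ _ (pw 1%N x)).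
      + by apply: nearW => n; rewrite normr_ge0 normrM ger0_norm//= ler_wpM2l// cos_taylor.
      + exact: cvg_cst.
  have E n : n%:R * (al n - 1 + V / 2 * r n ^+ 2) = Ex nu (F n).
    rewrite /F ExZ; last exact: L1D.
    rewrite (ExD (l1 n) (l2 n)) (ExB (lcos n) (L1_cst nu 1)) Ex_cst.
    rewrite (_ : (fun x => (r n * g x) ^+ 2 / 2) = (fun x => (r n ^+ 2 / 2) * g x ^+ 2)).
      by rewrite ExZ// -/V; congr (_ * (_ + _)); rewrite mulrC mulrA mulrAC.
    by apply/funext => x; rewrite exprMn mulrAC.
  by rewrite Ex_cst => h; under eq_fun do rewrite E; exact: h.
have lim_ps : n%:R * (ps n - 1 + V / 2 * r n ^+ 2) @[n --> \oo] --> (0 : R).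
  have : (V / 2) ^+ 2 * r n ^+ 2 @[n --> \oo] --> (V / 2) ^+ 2 * 0 ^+ 2.
    by apply: cvgM; [exact: cvg_cst|exact: (cvg_comp _ _ rcvg (@exprn_continuous _ _ _))].
  rewrite expr0n mulr0 => h; apply: norm_cvg0.
  apply: (@squeeze_cvgr _ _ _ _ (cst 0) _ _ _ _ _ h); last exact: cvg_cst.
  near=> n; rewrite normr_ge0 normrM ger0_norm//=.
  have n0 : (0 < n)%N by near: n; exact: nbhs_infty_gt.
  have y0 : 0 <= V / 2 * r n ^+ 2 by rewrite mulr_ge0 ?sqr_ge0// divr_ge0.
  apply: le_trans (ler_wpM2l (ler0n _ n) (expRN_taylor y0)) _.
  by rewrite exprMn mulrCA (expr2 (r n ^+ 2)) (mulrA n%:R) r2// mul1r.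
have lim : n%:R * (`|al n - ps n| + `|be n|) @[n --> \oo] --> (0 : R).
  have := cvgD (cvg_norm (cvgB lim_al lim_ps)) (cvg_norm lim_be).
  have E n : n%:R * (`|al n - ps n| + `|be n|) =
      `|n%:R * (al n - 1 + V / 2 * r n ^+ 2) - n%:R * (ps n - 1 + V / 2 * r n ^+ 2)| + `|n%:R * be n|.
    rewrite -mulrBr !normrM (ger0_norm (ler0n _ n)) -mulrDr; congr (_ * (`|_| + _)).
    by ring.
  by rewrite subr0 normr0 addr0 => h; under eq_fun do rewrite E; exact: h.
apply/cvgrPdist_le => e e0.
have /cvgrPdist_le /(_ _ e0) := lim; move=> lime; near=> n.
have n0 : (0 < n)%N by near: n; exact: nbhs_infty_gt.
have : `|0 - n%:R * (`|al n - ps n| + `|be n|)| <= e by near: n; exact: lime.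
rewrite sub0r normrN => /(le_trans (ler_norm _)).
apply: le_trans; rewrite distrC -(psn _ n0).
have := Ex_cos_sum_close (mvn n) n phi (ps1 n).
by under [in X in X -> _]eq_fun do rewrite -mulr_sumr.
Unshelve. all: by end_near. Qed.

End central_limit.

(** * Suprema over compact sets and Taylor expansions *)

Section continuity_on_compacts.
Context {R : realType} {p : nat}.
Implicit Types (K : set 'rV[R]_p) (g : 'rV[R]_p -> R).

(** Continuity relative to [K]: densities and likelihoods are controlled at parameters of [K]
    only. *)
Definition cont_on K g := forall t, K t -> forall e : R, 0 < e ->
  exists2 dl, 0 < dl & forall s, K s -> `|t - s| < dl -> `|g t - g s| <= e.

Lemma cont_on_nearP K g : cont_on K g -> forall t, K t -> forall e : R, 0 < e ->
  \forall s \near t, K s -> `|g t - g s| <= e.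
Proof.
move=> cg t Kt e e0; have [dl dl0 h] := cg t Kt e e0.
apply/nbhs_ballP; exists dl => // s ts Ks; apply: h => //.
by move: ts; rewrite -ball_normE.
Qed.

Lemma continuous_cont_on K g : (forall t, K t -> {for t, continuous g}) -> cont_on K g.
Proof.
move=> cg t Kt e e0; have /cvgrPdist_le /(_ _ e0) /nbhs_ballP[dl /= dl0 h] := cg t Kt.
by exists dl => // s _ ts; apply: h; rewrite -ball_normE.
Qed.

Lemma compact_cont_on_bounded K g : compact K -> cont_on K g ->
  exists M, forall t, K t -> `|g t| <= M.
Proof.
move=> /compact_near_coveringP/near_covering_withinP cK cg.
have : \forall M \near +oo%R, K `<=` (fun t => `|g t| <= M).
  apply: cK => t Kt.
  exists ([set s | K s -> `|g t - g s| <= 1], [set M : R | `|g t| + 1 <= M]).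
    by split; [exact: cont_on_nearP|exact: nbhs_pinfty_ge].
  move=> [s M] [/= h1 h2] Ks; apply: le_trans h2.
  by rewrite (_ : g s = g t - (g t - g s)); [rewrite (le_trans (ler_normB _ _))// lerD2l h1|ring].
move=> h; near (+oo%R : set_system R) => M; exists M; near: M; exact: h.
Unshelve. all: by end_near. Qed.

(** Rational points need not lie in [K], so for each rational centre and radius 1/(m+1) a point of
    [K] that close to the centre is chosen whenever there is one. *)
Lemma dense_sequence K : K !=set0 ->
  exists D : nat -> 'rV[R]_p, (forall k, K (D k)) /\
    forall x, K x -> forall e : R, 0 < e -> exists k, `|x - D k| < e.
Proof.
move=> K0; have [x0 Kx0] := K0.
pose A (qm : 'rV[rat]_p * nat) := [set y | K y /\ `|map_mx ratr qm.1 - y| < qm.2.+1%:R^-1].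
pose D k := if unpickle k is Some qm then xget x0 (A qm) else x0.
exists D; split=> [k|x Kx e e0].
  rewrite /D; case: unpickle => // qm; case: xgetP => // y _.
  by case.
have [m me] : exists m : nat, m.+1%:R^-1 <= e / 2.
  exists (Num.bound (2 / e)); have e20 : 0 <= 2 / e by rewrite divr_ge0// ltW.
  rewrite -[leRHS]invrK lef_pV2 ?posrE ?invr_gt0 ?divr_gt0 ?ltr0n// invf_div.
  by rewrite (le_trans (ltW (archi_boundP e20)))// ler_nat.
have m0 : 0 < m.+1%:R^-1 :> R by rewrite invr_gt0.
have /choice[q qP] : forall j, exists q : rat, `|ratr q - x 0 j| < m.+1%:R^-1.
  move=> j; have [|q] := @rat_in_itvoo R (x 0 j - m.+1%:R^-1) (x 0 j + m.+1%:R^-1).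
    by rewrite ltrD2l gtrN.
  by rewrite in_itv /= => qI; exists q; rewrite ltr_distl.
pose qm : 'rV[rat]_p * nat := (\row_j q j, m).
have Ax : A qm x.
  split=> //=; apply: mx_norm_lt => // i j; rewrite !mxE ord1; exact: qP.
exists (pickle qm); rewrite /D pickleK; case: xgetP => [y _ [Ky yq]|]; last by move/(_ x).
rewrite (_ : x - y = (map_mx ratr qm.1 - y) - (map_mx ratr qm.1 - x)); last first.
  by rewrite opprB [RHS]addrC addrA subrK.
apply: le_lt_trans (ler_normB _ _) _; apply: lt_le_trans (ltrD yq Ax.2) _.
by rewrite [leRHS]splitr lerD.
Qed.

Context {d : measure_display} {T : measurableType d}.
Variables (K : set 'rV[R]_p) (G : T -> 'rV[R]_p -> R).
Hypotheses (cK : compact K) (K0 : K !=set0).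
Hypothesis cG : forall x, cont_on K (G x).
Hypothesis mG : forall t, K t -> measurable_fun setT (G^~ t).

Definition sup_on x := sup [set G x t | t in K].

Let has_ub x : has_ubound [set G x t | t in K].
Proof.
have [M MP] := compact_cont_on_bounded cK (@cG x).
by exists M => _ [t Kt <-]; rewrite (le_trans (ler_norm _))// MP.
Qed.

Lemma sup_on_ge x t : K t -> G x t <= sup_on x.
Proof. by move=> Kt; apply: ub_le_sup => //; exists t. Qed.

Lemma sup_on_le x M : (forall t, K t -> G x t <= M) -> sup_on x <= M.
Proof.
move=> GM; apply: ge_sup; last by move=> _ [t Kt <-]; exact: GM.
by have [t Kt] := K0; exists (G x t); exists t.
Qed.

(** By continuity the supremum over [K] is already reached along a countable dense subset of [K]. *)
Lemma measurable_sup_on : measurable_fun setT sup_on.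
Proof.
have [D [KD Dd]] := dense_sequence K0.
have -> : sup_on = fun x => sups (fun k => G x (D k)) 0%N.
  apply/funext => x; apply/eqP; rewrite eq_le; apply/andP; split.
    apply: sup_on_le => t Kt; apply/ler_addgt0Pl => e e0.
    have [dl dl0 h] := cG x Kt e0.
    have [k tk] := Dd t Kt _ dl0.
    have := h _ (KD k) tk; rewrite ler_distlC => /andP[h1 _].
    have : G x (D k) <= sups (fun k => G x (D k)) 0%N.
      apply: ub_le_sup; last by exists k.
      have [M Mub] := has_ub x; exists M => _ [j _ <-]; apply: Mub.
      by exists (D j).
    lra.
  apply: ge_sup; first by exists (G x (D 0%N)), 0%N.
  by move=> _ [k _ <-]; exact: sup_on_ge.
apply: measurable_fun_sups => [x _|k]; last exact: mG.
have [M Mub] := has_ub x; exists M => _ [j _ <-]; apply: Mub.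
by exists (D j).
Qed.

End continuity_on_compacts.

Section lower_integral.
Context {R : realType} {d : measure_display} {T : measurableType d}.
Variable mu : {measure set T -> \bar R}.

(* Needed because the dominating suprema over the neighbourhood in hypothesis (b) are
   not known to be measurable: the integral of a nonnegative function is the supremum
   over the simple functions below it, hence monotone in any case. *)
Lemma ge0_le_integral_lower (D : set T) (f g : T -> \bar R) :
  (forall x, D x -> (0 <= f x)%E) -> (forall x, D x -> (f x <= g x)%E) ->
  (\int[mu]_(x in D) f x <= \int[mu]_(x in D) g x)%E.
Proof.
move=> f0 fg; have g0 x : D x -> (0 <= g x)%E.
  by move=> Dx; exact: le_trans (f0 _ Dx) (fg _ Dx).
rewrite !ge0_integralE//; apply: le_ereal_sup => _ [h hf <-]; exists h => //= x.
by apply: (le_trans (hf x)); rewrite !patchE; case: ifP => // /set_mem /fg.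
Qed.

End lower_integral.

(** * Taylor expansions along segments *)

Section segment_taylor.
Context {R : realType} {p : nat}.
Implicit Types (g : 'rV[R]_p -> R) (t D : 'rV[R]_p).

Lemma mvt_unit (f f' : R -> R) (B : R) :
  (forall y : R, 0 <= y <= 1 -> is_derive y (1 : R) f (f' y)) ->
  (forall y : R, 0 <= y <= 1 -> `|f' y| <= B) ->
  forall y : R, 0 <= y <= 1 -> `|f y - f 0| <= B.
Proof.
move=> df bf y /andP[y0 y1].
have B0 : 0 <= B by apply: le_trans (bf 0 _) => //; rewrite lexx ler01.
move: y0; rewrite le_eqVlt => /orP[/eqP <-|y0]; first by rewrite subrr normr0.
have sub c : c \in `]0, y[ -> 0 <= c <= 1.
  by rewrite in_itv /= => /andP[c0 cy]; rewrite (ltW c0) (le_trans (ltW cy)).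
have cf : {within `[0, y], continuous f}.
  apply: derivable_within_continuous => c; rewrite in_itv /= => /andP[c0 cy].
  by have dfc := df c _; apply: ex_derive; apply: dfc; rewrite c0 (le_trans cy).
have [c cI ->] := MVT y0 (fun c cI => df c (sub c cI)) cf.
rewrite subr0 normrM (ger0_norm (ltW y0)) -[leRHS]mulr1.
by rewrite ler_pM// ?bf ?sub// ltW.
Qed.

Lemma derive_row g t D : differentiable g t ->
  'D_D g t = \sum_j D 0 j * partial g j t.
Proof.
move=> dg; rewrite deriveE//.
have -> : D = \sum_j D 0 j *: delta_mx 0 j by exact: row_sum_delta.
rewrite linear_sum; apply: eq_bigr => j _.
rewrite linearZ /= /partial deriveE//; congr (_ * _).
rewrite summxE (bigD1 j)//= big1 ?addr0; last first.
  by move=> k kj; rewrite !mxE eqxx eq_sym (negbTE kj) mulr0.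
by rewrite !mxE !eqxx mulr1.
Qed.

Lemma is_derive_segment g t D (y : R) : differentiable g (t + y *: D) ->
  is_derive y (1 : R) (fun y => g (t + y *: D)) (\sum_j D 0 j * partial g j (t + y *: D)).
Proof.
move=> dg; rewrite -derive_row//.
have dD : derivable g (t + y *: D) D by exact: diff_derivable.
have E : (fun h : R => h^-1 *: (g (t + (h *: (1 : R) + y) *: D) - g (t + y *: D))) =
    (fun h : R => h^-1 *: (g (h *: D + (t + y *: D)) - g (t + y *: D))).
  apply/funext => h; have -> : h *: (1 : R) = h by exact: mulr1.
  by rewrite scalerDl (addrCA t).
by apply: DeriveDef; rewrite /derivable /derive /= E.
Qed.

Lemma norm_sum_pM (D : 'rV[R]_p) (a : 'I_p -> R) B : (forall j, `|a j| <= B) ->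
  `|\sum_j D 0 j * a j| <= p%:R * `|D| * B.
Proof.
move=> aB; rewrite -mulrA; apply: norm_sum_ord_le => j.
by rewrite normrM ler_pM// le_coord_mx_norm.
Qed.

Lemma seg_ball t D (y r : R) : 0 <= y <= 1 -> `|D| < r -> `|(t + y *: D) - t| < r.
Proof.
move=> /andP[y0 y1] Dr; rewrite addrAC subrr add0r normrZ ger0_norm//.
by apply: le_lt_trans Dr; rewrite ler_piMl.
Qed.

Lemma segment_lipschitz g t D B :
  (forall y : R, 0 <= y <= 1 -> differentiable g (t + y *: D)) ->
  (forall y j, 0 <= y <= 1 -> `|partial g j (t + y *: D)| <= B) ->
  `|g (t + D) - g t| <= p%:R * `|D| * B.
Proof.
move=> dg gB.
have := @mvt_unit (fun y => g (t + y *: D)) _ (p%:R * `|D| * B)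
  (fun y y01 => is_derive_segment (dg y y01)).
move=> /(_ (fun y y01 => norm_sum_pM D (fun j => gB y j y01)) 1).
by rewrite ler01 lexx scale1r scale0r addr0; apply.
Qed.

(** [A] is free: A = 0 gives a remainder governed by the size of the Hessian, and A = the Hessian at
    [t] one governed by its oscillation. Two mean value inequalities on the unit interval replace
    the integral remainder, losing only a factor 1/2. *)
Lemma segment_taylor2 g t D (A : 'M[R]_p) om :
  (forall y : R, 0 <= y <= 1 -> differentiable g (t + y *: D)) ->
  (forall (y : R) i, 0 <= y <= 1 -> differentiable (partial g i) (t + y *: D)) ->
  (forall y : R, 0 <= y <= 1 -> `|hess g (t + y *: D) - A| <= om) ->
  `|g (t + D) - g t - \sum_j D 0 j * partial g j t - (D *m A *m D^T) 0 0 / 2| <=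
    p%:R ^+ 2 * `|D| ^+ 2 * om.
Proof.
move=> dg ddg hA.
pose a (y : R) := \sum_j D 0 j * partial g j (t + y *: D).
pose b (y : R) := \sum_i D 0 i * \sum_j D 0 j * partial (partial g i) j (t + y *: D).
pose Q := \sum_i D 0 i * \sum_j D 0 j * A i j.
have QE : (D *m A *m D^T) 0 0 = Q.
  rewrite -mulmxA mxE; apply: eq_bigr => i _; congr (_ * _); rewrite mxE.
  by apply: eq_bigr => j _; rewrite !mxE mulrC.
have da (y : R) : 0 <= y <= 1 -> is_derive y (1 : R) a (b y).
  move=> y01; have -> : a = \sum_i (D 0 i *: (fun y : R => partial g i (t + y *: D))).
    by apply/funext => u; rewrite fct_sumE.
  apply: is_derive_sum => i.
  by apply: is_deriveZ; exact: is_derive_segment (ddg y i y01).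
pose B := p%:R ^+ 2 * `|D| ^+ 2 * om.
have bQ (y : R) : 0 <= y <= 1 -> `|b y - Q| <= B.
  move=> y01; rewrite /b /Q -sumrB.
  have -> : B = p%:R * `|D| * (p%:R * `|D| * om) by rewrite /B; ring.
  under eq_bigr do rewrite -mulrBr -sumrB.
  apply: norm_sum_pM => i0; under eq_bigr do rewrite -mulrBr.
  apply: norm_sum_pM => j; apply: le_trans (hA y y01).
  by have := le_coord_mx_norm (hess g (t + y *: D) - A) i0 j; rewrite !mxE.
have d1 (y : R) : 0 <= y <= 1 -> is_derive y (1 : R) (fun y : R => a y - a 0 - y * Q) (b y - Q).
  move=> y01; have day := da y y01.
  by apply: is_derive_eq; rewrite /GRing.scale /=; ring.
have h1 (y : R) : 0 <= y <= 1 -> `|a y - a 0 - y * Q| <= B.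
  move=> y01; have := mvt_unit d1 bQ y01.
  by rewrite subrr mul0r subr0 subr0.
have d2 (y : R) : 0 <= y <= 1 -> is_derive y (1 : R)
    (fun y : R => g (t + y *: D) - g t - y * a 0 - y ^+ 2 / 2 * Q) (a y - a 0 - y * Q).
  move=> y01; have dgy := is_derive_segment (dg y y01).
  by apply: is_derive_eq; rewrite /GRing.scale /= -/(a y); field.
have := mvt_unit d2 h1 (y := 1); rewrite ler01 lexx => /(_ isT).
rewrite scale1r scale0r addr0 subrr !mul0r expr0n /= !mul0r !subr0 !mul1r expr1n.
rewrite mul1r QE (mulrC 2^-1).
suff -> : a 0 = \sum_j D 0 j * partial g j t by [].
by rewrite /a; under eq_bigr do rewrite scale0r addr0.
Qed.

End segment_taylor.

Section partial_measurable.
Context {R : realType} {p : nat} {d : measure_display} {T : measurableType d}.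
Variables (f : T -> 'rV[R]_p -> R) (th0 : 'rV[R]_p) (r : R).

Lemma measurable_partial (t : 'rV[R]_p) (j : 'I_p) : `|t - th0| < r ->
  (forall s, `|s - th0| < r -> measurable_fun setT (f^~ s)) ->
  (forall x, differentiable (f x) t) ->
  measurable_fun setT (fun x => partial (f x) j t).
Proof.
move=> tr mf df; pose rho := r - `|t - th0|; have rho0 : 0 < rho by rewrite subr_gt0.
(* Increments below [rho], so that every difference quotient is taken inside the ball where
   measurability is assumed. *)
pose h n : R := rho / 2 * harmonic n.
have hn0 n : 0 < h n by rewrite mulr_gt0 ?divr_gt0// /harmonic /= invr_gt0.
have hr n : h n < rho.
  apply: (@le_lt_trans _ _ (rho / 2)); last by lra.
  by rewrite ler_piMr ?divr_ge0 ?(ltW rho0)// /harmonic /= invf_le1 ?ler1n.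
have hcvg : h n @[n --> \oo] --> (0 : R).
  by rewrite -[X in _ --> X](mulr0 (rho / 2)); apply: cvgM; [exact: cvg_cst|exact: cvg_harmonic].
pose e : 'rV[R]_p := delta_mx 0 j.
have e1 : `|e| <= 1.
  apply/mx_norm_leP => // i k; rewrite mxE; case: (_ && _) => /=.
    by rewrite normr1.
  by rewrite normr0.
apply: (@measurable_fun_cvg _ _ _ _ (fun n x => (h n)^-1 * (f x (h n *: e + t) - f x t))).
  move=> n; apply: measurable_funM => //; apply: measurable_funB; last exact: mf.
  apply: mf; rewrite -addrA (le_lt_trans (ler_normD _ _))//.
  rewrite normrZ gtr0_norm// -ltrBrDr (le_lt_trans _ (hr n))//.
  by rewrite ler_piMr// ltW.
move=> x _; have /cvg_ex[l /= hl] : derivable (f x) t e by exact: diff_derivable.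
have -> : partial (f x) j t = l by apply/cvg_lim => //; exact: hl.
apply: (cvg_comp h (fun a : R => a^-1 *: (f x (a *: e + t) - f x t)) _ hl).
move=> A [ep /= ep0 hA].
have := hcvg => /cvgrPdist_lt /(_ _ ep0); apply: filterS => n hn.
apply: hA => //=.
by rewrite gt_eqF ?hn0.
Qed.

End partial_measurable.

(** * Linear and quadratic forms, coercivity *)

Section row_forms.
Context {R : realType} {p : nat}.
Implicit Types (D v : 'rV[R]_p) (A B : 'M[R]_p).

Definition dot D v : R := (D *m v^T) 0 0.
Definition qform A D : R := (D *m A *m D^T) 0 0.

Lemma dotE D v : dot D v = \sum_j D 0 j * v 0 j.
Proof. by rewrite /dot mxE; apply: eq_bigr => j _; rewrite !mxE. Qed.

Lemma qformE A D : qform A D = \sum_i D 0 i * \sum_j D 0 j * A i j.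
Proof.
rewrite /qform -mulmxA mxE; apply: eq_bigr => i _; congr (_ * _); rewrite mxE.
by apply: eq_bigr => j _; rewrite !mxE mulrC.
Qed.

Lemma dot_le D v : `|dot D v| <= p%:R * `|D| * `|v|.
Proof. by rewrite dotE; apply: norm_sum_pM => j; exact: le_coord_mx_norm. Qed.

Lemma qform_le A D e : (forall i j, `|A i j| <= e) -> `|qform A D| <= p%:R ^+ 2 * `|D| ^+ 2 * e.
Proof.
move=> Ae; rewrite qformE (_ : _ * e = p%:R * `|D| * (p%:R * `|D| * e)); last by ring.
by apply: norm_sum_pM => i; apply: norm_sum_pM => j.
Qed.

Lemma qformB A B D : qform (A - B) D = qform A D - qform B D.
Proof. by rewrite /qform mulmxBr mulmxBl mxE [in X in _ + X]mxE. Qed.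

Lemma qform_close A B D e : (forall i j, `|A i j - B i j| <= e) ->
  `|qform A D - qform B D| <= p%:R ^+ 2 * `|D| ^+ 2 * e.
Proof. by move=> AB; rewrite -qformB; apply: qform_le => i j; rewrite !mxE. Qed.

(** If v^T A v = 0, moving from v along u = A v changes the form by 2 t b + t^2 c with b = |u|^2;
    nonnegativity for all t forces u = 0, hence v = 0 by invertibility. *)
Lemma psd_unit_pd A : A^T = A -> (forall v : 'cV[R]_p, 0 <= (v^T *m A *m v) 0 0) ->
  A \in unitmx -> forall v : 'cV[R]_p, v != 0 -> 0 < (v^T *m A *m v) 0 0.
Proof.
move=> Asym Apos Aunit v v0; rewrite lt_neqAle Apos andbT eq_sym; apply/eqP => vAv.
pose u := A *m v; pose b := (u^T *m u) 0 0; pose c := (u^T *m A *m u) 0 0.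
have c0 : 0 <= c by exact: Apos.
have c1 : 0 < c + 1 by rewrite ltr_wpDl.
have E (t : R) : ((v + t *: u)^T *m A *m (v + t *: u)) 0 0 = 2 * t * b + t ^+ 2 * c.
  have uAv : u^T *m A *m v = u^T *m u by rewrite -mulmxA.
  have vAu : v^T *m A *m u = u^T *m u by rewrite /u trmx_mul Asym.
  rewrite (_ : (v + t *: u)^T = v^T + t *: u^T); last by rewrite linearD linearZ.
  rewrite !mulmxDl !mulmxDr -!scalemxAl -!scalemxAr uAv vAu scalerA.
  have aM (X Y : 'M[R]_1) : (X + Y) 0 0 = X 0 0 + Y 0 0 by rewrite mxE.
  have sM k (X : 'M[R]_1) : (k *: X) 0 0 = k * X 0 0 by rewrite mxE.
  rewrite !(aM, sM) -/b -/c; transitivity ((v^T *m A *m v) 0 0 + (2 * t * b + t ^+ 2 * c)).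
    by ring.
  by rewrite [X in X + _ = _]vAv add0r.
have b0 : b = 0.
  apply/eqP; rewrite eq_le; apply/andP; split; last first.
    by rewrite /b sum_sqr_mulmx; apply: sumr_ge0 => j _; exact: sqr_ge0.
  rewrite leNgt; apply/negP => b_gt0.
  (* The minimiser would be - b / c; dividing by c + 1 covers c = 0 and still gives a negative
     value. *)
  have := Apos (v + (- b / (c + 1)) *: u); rewrite E leNgt => /negP; apply.
  rewrite (_ : _ + _ = - (b ^+ 2 * (c + 2) / (c + 1) ^+ 2)); last first.
    by field; rewrite gt_eqF.
  by rewrite oppr_lt0 divr_gt0 ?exprn_gt0// mulr_gt0 ?exprn_gt0//; lra.
have u0 : u = 0.
  apply/matrixP => j k; rewrite ord1 [RHS]mxE; apply/eqP; rewrite -sqrf_eq0.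
  move: b0; rewrite /b sum_sqr_mulmx => /eqP; rewrite psumr_eq0 => [/allP /(_ j)|i _].
    by rewrite mem_index_enum => /(_ isT).
  exact: sqr_ge0.
by move/eqP: v0; apply; rewrite -[v](mulKmx Aunit) -/u u0 mulmx0.
Qed.

(** Writing A = L^T L, the form is the squared Euclidean length of D L^T, and D is recovered from it
    by a bounded inverse. The norm is the maximum norm, hence the factor p in [C]; the added 1 keeps
    [C] positive. *)
Lemma pd_coercive A : A^T = A -> A \in unitmx ->
  (forall v : 'cV[R]_p, v != 0 -> 0 < (v^T *m A *m v) 0 0) ->
  exists2 la, 0 < la & forall D, la * `|D| ^+ 2 <= qform A D.
Proof.
move=> Asym Aunit Apos; have [L AL] := cholesky Asym Apos.
have Lunit : L^T \in unitmx.
  rewrite unitmx_tr; apply: contraT => nL; move: Aunit; rewrite AL !unitmxE det_mulmx det_tr.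
  by rewrite unitfE mulf_eq0 orbb; rewrite unitmxE unitfE negbK in nL; rewrite nL.
pose C := p%:R * `|invmx L^T| + 1.
have C0 : 0 < C by rewrite ltr_wpDl// mulr_ge0.
exists (C ^- 2); first by rewrite invr_gt0 exprn_gt0.
move=> D; pose y := D *m L^T.
have -> : qform A D = \sum_j y 0 j ^+ 2.
  rewrite /qform AL -mulmxA -mulmxA mulmxA (_ : L *m D^T = y^T); last by rewrite /y trmx_mul trmxK.
  by rewrite -/y mxE; apply: eq_bigr => j _; rewrite !mxE expr2.
have yD : `|D| <= C * `|y|.
  rewrite -[D](mulmxK Lunit) -/y; apply/mx_norm_leP; first by rewrite mulr_ge0// ltW.
  move=> i j; rewrite ord1 mxE; apply: le_trans (norm_sum_pM _ (B := `|invmx L^T|) _) _.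
    by move=> k; exact: le_coord_mx_norm.
  by rewrite mulrAC ler_wpM2r// /C lerDl.
have y2 : `|y| ^+ 2 <= \sum_j y 0 j ^+ 2.
  have S0 : 0 <= \sum_j y 0 j ^+ 2 by apply: sumr_ge0 => j _; exact: sqr_ge0.
  rewrite -(sqr_sqrtr S0) lerXn2r ?nnegrE ?sqrtr_ge0//.
  apply/mx_norm_leP; first exact: sqrtr_ge0.
  move=> i j; rewrite ord1 -sqrtr_sqr ler_wsqrtr// (bigD1 j)//= lerDl.
  by apply: sumr_ge0 => k _; exact: sqr_ge0.
rewrite mulrC ler_pdivrMr ?exprn_gt0// (le_trans (y := (C * `|y|) ^+ 2))//.
  by rewrite lerXn2r ?nnegrE// mulr_ge0// ltW.
by rewrite exprMn mulrC ler_wpM2r// exprn_ge0// ltW.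
Qed.

End row_forms.

(** * Inequalities for ln (1 + e) *)

Section log_bounds.
Context {R : realType}.
Implicit Types e : R.

(** With y = sqrt (1 + e), ln (1 + e) = 2 ln y <= 2 (y - 1) = e - (y - 1)^2. For e <= 1, (y - 1)^2 =
    e^2 / (y + 1)^2 and (1 + sqrt 2)^2 < 6; for e > 1, (sqrt 2 - 1)^2 > 1/6. The decimals 1.42 and
    1.41 below are rational bounds for sqrt 2. *)
Lemma ln1D_le_quad e : -1 < e -> ln (1 + e) <= e - 6^-1 * Num.min (e ^+ 2) 1.
Proof.
move=> e1; have e10 : 0 < 1 + e by lra.
pose y := Num.sqrt (1 + e); have y0 : 0 < y by rewrite sqrtr_gt0.
have y2 : y ^+ 2 = 1 + e by rewrite sqr_sqrtr// ltW.
have h1 : ln (1 + e) <= 2 * (y - 1).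
  have y1 : - 1 < y - 1 by lra.
  have := le_ln1Dx y1; rewrite (_ : 1 + (y - 1) = y); last by ring.
  by rewrite -y2 lnXn// mulr2n; lra.
apply: le_trans h1 _.
have eE : e = y ^+ 2 - 1 by lra.
suff : 6^-1 * Num.min (e ^+ 2) 1 <= (y - 1) ^+ 2 by rewrite {2}eE; lra.
have [ele|elt] := leP e 1.
  apply: (@le_trans _ _ (6^-1 * e ^+ 2)); first by rewrite ler_wpM2l ?invr_ge0// ge_min lexx.
  have -> : e ^+ 2 = (y - 1) ^+ 2 * (y + 1) ^+ 2 by rewrite eE; ring.
  rewrite mulrCA ler_piMr ?sqr_ge0// mulrC ler_pdivrMr// mul1r.
  have : y <= 7 / 5 + 1 / 50 by nra.
  by nra.
apply: (@le_trans _ _ (6^-1 * 1)); first by rewrite ler_wpM2l ?invr_ge0// ge_min lexx orbT.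
have : 141 / 100 <= y by nra.
by nra.
Qed.

Lemma ln1D_taylor e : `|e| <= 1 / 2 -> `|ln (1 + e) - e + e ^+ 2 / 2| <= 2 * `|e| ^+ 3.
Proof.
move=> e12.
have e1 y : 0 <= y <= 1 -> `|y * e| <= `|e|.
  by move=> /andP[y0 y1]; rewrite normrM ger0_norm// ler_piMl.
pose F (y : R) := ln (1 + y * e) - y * e + (y * e) ^+ 2 / 2.
have dF (y : R) : 0 <= y <= 1 -> is_derive y (1 : R) F ((y * e) ^+ 2 / (1 + y * e) * e).
  move=> y01; have ye : 0 < 1 + y * e.
    by have := e1 y y01; rewrite ler_norml => /andP[? _]; lra.
  have dl := is_derive1_ln ye.
  have d1 : is_derive y (1 : R) (fun y => 1 + y * e) e.
    by apply: is_derive_eq; rewrite /GRing.scale /=; ring.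
  have d2 := is_derive1_comp (f := @ln R) (g := fun y => 1 + y * e) (x := y).
  have d3 : is_derive y (1 : R) (fun y => ln (1 + y * e)) ((1 + y * e)^-1 * e) by exact: d2.
  rewrite /F; apply: is_derive_eq; rewrite /GRing.scale /=; field.
  by rewrite gt_eqF.
have bF (y : R) : 0 <= y <= 1 -> `|(y * e) ^+ 2 / (1 + y * e) * e| <= 2 * `|e| ^+ 3.
  move=> y01; have h := e1 y y01.
  have ye : 1 / 2 <= 1 + y * e by move: h; rewrite ler_norml => /andP[? _]; lra.
  have ye0 : 0 < 1 + y * e by lra.
  rewrite 2!normrM normrX normfV (gtr0_norm ye0) (_ : 2 * _ = `|e| ^+ 2 * 2 * `|e|); last by ring.
  rewrite ler_wpM2r// ler_pM ?exprn_ge0 ?invr_ge0 ?(ltW ye0)//.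
    by rewrite lerXn2r ?nnegrE.
  by rewrite invf_ple ?posrE//; lra.
have := mvt_unit dF bF (y := 1); rewrite ler01 lexx => /(_ isT).
by rewrite /F mul0r addr0 ln1 expr0n /= mul0r !subr0 addr0 subr0 mul1r.
Qed.

(** Used with a = D.s the linear part of the increment e. Replacing e^2 by a^2 leaves a quadratic
    term with integrable coefficients, and [u] enters the remainder linearly. *)
Lemma ln1D_close (a e u t : R) : `|a| <= t -> `|e| <= t -> t <= 1 / 2 -> `|e - a| <= u ->
  `|ln (1 + e) - e + a ^+ 2 / 2| <= t * (2 * a ^+ 2 + 3 * u).
Proof.
move=> ta te t12 eu; have u0 : 0 <= u by apply: le_trans eu.
have t0 : 0 <= t by apply: le_trans ta.
have h1 := ln1D_taylor (le_trans te t12).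
have h2 : `|e ^+ 2 - a ^+ 2| <= u * (2 * t).
  rewrite subr_sqr normrM ler_pM// (le_trans (ler_normD _ _))//.
  by rewrite mulr_natl mulr2n lerD.
have h3 : `|e| ^+ 3 <= t * e ^+ 2.
  by rewrite exprS real_normK ?num_real// ler_wpM2r ?sqr_ge0.
have h4 : t * e ^+ 2 <= t * (a ^+ 2 + u * (2 * t)).
  by rewrite ler_wpM2l//; move: h2; rewrite ler_norml => /andP[_]; lra.
have h5 : t * (u * (2 * t)) <= t * u.
  by rewrite ler_wpM2l// -[leRHS]mulr1 ler_wpM2l//; lra.
rewrite (_ : _ + a ^+ 2 / 2 = (ln (1 + e) - e + e ^+ 2 / 2) - (e ^+ 2 - a ^+ 2) / 2); last by field.
apply: le_trans (ler_normB _ _) _.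
rewrite [X in _ + X]normrM (ger0_norm (x := 2^-1)) ?invr_ge0//.
by rewrite !mulrDr in h4 *; lra.
Qed.

End log_bounds.

(** * Local expansion of the log-likelihood ratio *)

Section row_form_sums.
Context {R : realType} {p : nat}.
Implicit Types (D u : 'rV[R]_p).

Lemma dotB D D' u : dot (D - D') u = dot D u - dot D' u.
Proof. by rewrite /dot mulmxBl mxE [in X in _ + X]mxE. Qed.

Lemma dotC D u : dot D u = dot u D.
Proof. by rewrite !dotE; apply: eq_bigr => j _; rewrite mulrC. Qed.

Lemma dotZl D u k : dot (k *: D) u = k * dot D u.
Proof. by rewrite /dot -scalemxAl mxE. Qed.

Lemma dotZr D u k : dot D (k *: u) = k * dot D u.
Proof. by rewrite !dotE mulr_sumr; apply: eq_bigr => j _; rewrite mxE mulrCA. Qed.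

Lemma dot_sum I (r : seq I) (u : I -> 'rV[R]_p) D :
  dot D (\sum_(i <- r) u i) = \sum_(i <- r) dot D (u i).
Proof.
rewrite dotE; under [RHS]eq_bigr do rewrite dotE.
rewrite [RHS]exchange_big/=; apply: eq_bigr => j _.
by rewrite summxE mulr_sumr.
Qed.

Lemma qformZ (A : 'M[R]_p) D k : qform A (k *: D) = k ^+ 2 * qform A D.
Proof.
rewrite /qform (_ : (k *: D)^T = k *: D^T); last by rewrite linearZ.
by rewrite -!scalemxAl -scalemxAr scalerA mxE expr2.
Qed.

Lemma qform_sum I (r : seq I) (A : I -> 'M[R]_p) D :
  qform (\sum_(i <- r) A i) D = \sum_(i <- r) qform (A i) D.
Proof. by rewrite /qform mulmx_sumr mulmx_suml summxE. Qed.

Lemma qformZl (A : 'M[R]_p) D k : qform (k *: A) D = k * qform A D.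
Proof. by rewrite /qform -scalemxAr -scalemxAl mxE. Qed.

Lemma qform_outer D u : qform (\matrix_(i, j) (u 0 i * u 0 j)) D = dot D u ^+ 2.
Proof.
rewrite qformE expr2 {1}dotE mulr_suml; apply: eq_bigr => i _.
rewrite -mulrA; congr (_ * _); rewrite dotE mulr_sumr; apply: eq_bigr => j _.
by rewrite mxE; ring.
Qed.

End row_form_sums.

Lemma le_sqrt_scaled_cvg0 {R : realType} (eps : nat -> R) (a : R) : (forall n, 0 <= eps n) ->
  Num.sqrt n%:R * eps n @[n --> \oo] --> (0 : R) -> 0 < a -> \forall n \near \oo, eps n <= a.
Proof.
move=> eps_ge0 eps0 a0; move/cvgr0_norm_le : eps0 => /(_ _ a0) h; near=> n.
have : `|Num.sqrt n%:R * eps n| <= a by near: n.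
apply: le_trans; apply: le_trans (ler_norm _); rewrite ler_peMl//.
by rewrite -[leLHS]sqrtr1 ler_wsqrtr// ler1n; near: n; exact: nbhs_infty_gt.
Unshelve. all: by end_near. Qed.

(** * Rate of convergence and linearization of the maximiser *)

Section local_expansion.
Context {R : realType} {p : nat} {d d' : measure_display} {Om : measurableType d}
  {T : measurableType d'}.
Variables (P : probability Om R) (nu : probability T R) (z : nat -> Om -> T).
Hypothesis mz : forall i, measurable_fun setT (z i).
Hypothesis indep : mutually_independent P z.
Hypothesis zP : forall i A, measurable A -> P (z i @^-1` A) = nu A.

Lemma whp_sum g eta : L1 nu g -> 0 < eta ->
  \forall nw \near whp P, `|\sum_(i < nw.1) g (z i nw.2) - nw.1%:R * Ex nu g| <= nw.1%:R * eta.
Proof.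
move=> lg eta0; apply: (filterS _ (weak_lln mz indep zP lg eta0)) => -[n w] /= h.
have [->|n0] := eqVneq n 0%N; first by rewrite big_ord0 !mul0r subr0 normr0.
have nR0 : 0 < n%:R :> R by rewrite ltr0n lt0n.
rewrite (_ : _ - _ = n%:R * (mean z n g w - Ex nu g)).
  by rewrite normrM (gtr0_norm nR0) ler_wpM2l// ltW.
by rewrite /mean mulrBr mulrA divff ?mul1r// gt_eqF.
Qed.

Lemma whp_sum_le g m : L1 nu g -> Ex nu g < m ->
  \forall nw \near whp P, \sum_(i < nw.1) g (z i nw.2) <= nw.1%:R * m.
Proof.
move=> lg gm; have eta0 : 0 < m - Ex nu g by rewrite subr_gt0.
apply: (filterS _ (whp_sum lg eta0)) => -[n w] /=.
rewrite ler_norml => /andP[_]; rewrite lerBlDr -mulrDr; suff -> : m - Ex nu g + Ex nu g = m by [].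
by rewrite subrK.
Qed.

(** Uniformity in [D] is free: a quadratic form depends on finitely many entries, each obeying the
    law of large numbers. *)
Lemma whp_qform (G : T -> 'M[R]_p) eta : (forall i j, L1 nu (fun x => G x i j)) -> 0 < eta ->
  \forall nw \near whp P, forall D, `|\sum_(i < nw.1) qform (G (z i nw.2)) D -
    nw.1%:R * qform (\matrix_(i, j) Ex nu (fun x => G x i j)) D| <= nw.1%:R * `|D| ^+ 2 * eta.
Proof.
move=> lG eta0; pose eta' := eta / (p%:R ^+ 2 + 1).
have c0 : 0 < p%:R ^+ 2 + 1 :> R by rewrite ltr_wpDl ?sqr_ge0.
have eta'0 : 0 < eta' by rewrite divr_gt0.
have h0 : \forall nw \near whp P, forall ij : 'I_p * 'I_p,
    `|\sum_(i < nw.1) G (z i nw.2) ij.1 ij.2 - nw.1%:R * Ex nu (fun x => G x ij.1 ij.2)|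
    <= nw.1%:R * eta'.
  by apply: filter_forall => ij; exact: (whp_sum (lG ij.1 ij.2) eta'0).
apply: (filterS _ h0) => -[n w] /= h D; rewrite -qform_sum -qformZl.
apply: le_trans (qform_close (e := n%:R * eta') _ _) _.
  by move=> i j; have := h (i, j); rewrite /= summxE !mxE.
rewrite (_ : _ * _ = n%:R * `|D| ^+ 2 * (p%:R ^+ 2 * eta')); last by ring.
rewrite ler_wpM2l ?mulr_ge0 ?exprn_ge0// /eta' mulrA ler_pdivrMr// mulrC.
by rewrite ler_wpM2l ?(ltW eta0)// lerDl.
Qed.

Variables (s : T -> 'rV[R]_p) (M : T -> 'M[R]_p) (W : T -> R).
Hypotheses (ls : forall j, L1 nu (fun x => s x 0 j))
  (lss : forall i j, L1 nu (fun x => s x 0 i * s x 0 j))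
  (s0 : forall j, Ex nu (fun x => s x 0 j) = 0).
Hypotheses (lM : forall i j, L1 nu (fun x => M x i j))
  (M0 : forall D, qform (\matrix_(i, j) Ex nu (fun x => M x i j)) D = 0).
Hypotheses (lW : L1 nu W) (W0 : forall x, 0 <= W x).

(** One integrable function dominating both |s| and [W]; being at least 1, it also absorbs the
    constants of the relative approximation error. *)
Definition envelope x := 1 + `|s x| + W x.
Let V := envelope.

Definition score_sum n w : 'rV[R]_p := (Num.sqrt n%:R)^-1 *: \sum_(i < n) s (z i w).

Definition information : 'M[R]_p := \matrix_(i, j) Ex nu (fun x => s x 0 i * s x 0 j).

Let vs : vmeas s. Proof. by move=> j; exact: L1_meas (ls j). Qed.

Let lns : L1 nu (fun x => `|s x|).
Proof.
apply: (@L1_le _ _ _ _ _ (fun x => \sum_j `|s x 0 j|)).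
- exact: measurable_norm_vec.
- move=> x; rewrite normr_id; apply/mx_norm_leP; first by apply: sumr_ge0.
  by move=> i j; rewrite ord1 (bigD1 j)//= lerDl sumr_ge0.
- by apply: L1_sum => j; exact: L1_norm.
Qed.

Lemma L1_envelope : L1 nu V.
Proof. by apply: L1D => //; apply: L1D => //; exact: L1_cst. Qed.

Lemma envelope_ge1 x : 1 <= V x.
Proof. by rewrite /V /envelope -addrA lerDl addr_ge0. Qed.

Lemma dot_score_sum D n w :
  Num.sqrt n%:R * dot D (score_sum n w) = \sum_(i < n) dot D (s (z i w)).
Proof.
rewrite dotZr dot_sum mulrA; have [->|n0] := eqVneq n 0%N.
  by rewrite big_ord0 mulr0.
by rewrite divff ?mul1r// gt_eqF// sqrtr_gt0 ltr0n lt0n.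
Qed.

Lemma tight_score_sum : tight P (fun n w => `|score_sum n w|).
Proof.
pose Y n w := \sum_(j < p) `|(Num.sqrt n%:R)^-1 * \sum_(i < n) s (z i w) 0 j|.
have lj n j : L1 P (fun w => (Num.sqrt n%:R)^-1 * \sum_(i < n) s (z i w) 0 j).
  by apply/L1Z/L1_sum => i; exact: (L1_z mz zP i (ls j)).
have tY : tight P Y.
  apply: (@tight_Ex _ _ _ _ _ (\sum_(j < p) (Ex nu (fun x => s x 0 j ^+ 2) + 3))).
    by move=> n; apply: L1_sum => j; exact: L1_norm.
  apply: nearW => n.
  rewrite (_ : (fun w => `|Y n w|) = Y n); last first.
    by apply/funext => w; rewrite ger0_norm// sumr_ge0.
  rewrite /Y Ex_sum; last by move=> j; exact: L1_norm.
  apply: ler_sum => j _.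
  have lsj : L1 nu (fun x => s x 0 j ^+ 2) by exact: lss.
  exact: (Ex_norm_sum mz indep zP n (ls j) lsj (s0 j) (lexx _)).
apply: tight_le tY _; apply: nearW => -[n w] /=; rewrite normr_id.
apply: le_trans (ler_norm _); apply/mx_norm_leP; first by apply: sumr_ge0.
move=> i j; rewrite ord1 /Y (bigD1 j)//= /score_sum mxE summxE lerDl.
by apply: sumr_ge0.
Qed.

Variables (e : nat -> T -> 'rV[R]_p -> R) (eps : nat -> R) (dl0 : R).
Hypotheses (dl0_gt0 : 0 < dl0) (eps_ge0 : forall n, 0 <= eps n)
  (eps0 : Num.sqrt n%:R * eps n @[n --> \oo] --> (0 : R)).
(** [e_first] is a crude expansion on a fixed ball; [e_second] isolates the quadratic term, with a
    remainder of arbitrarily small mean on a smaller ball. The approximation error [eps] comes with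
    a factor |D| in both. *)
Hypothesis e_first : \forall n \near \oo, forall x D, `|D| <= dl0 ->
  `|e n x D - dot D (s x)| <= `|D| ^+ 2 * W x + eps n * `|D| * V x.
Hypothesis e_second : forall eta, 0 < eta -> exists dl o,
  [/\ 0 < dl, L1 nu o, Ex nu o <= eta & \forall n \near \oo, forall x D, `|D| <= dl ->
  `|e n x D - dot D (s x) - qform (M x) D / 2| <= `|D| ^+ 2 * o x + eps n * `|D| * V x].

(** The summed Hessian term is negligible by the law of large numbers and [M0]; the approximation
    error n eps |D| is read as (sqrt n |D|) times (sqrt n eps). *)
Lemma linear_term eta : 0 < eta -> exists2 dl, 0 < dl &
  \forall nw \near whp P, forall D, `|D| <= dl ->
    `|\sum_(i < nw.1) e nw.1 (z i nw.2) D - Num.sqrt nw.1%:R * dot D (score_sum nw.1 nw.2)| <=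
    eta * (nw.1%:R * `|D| ^+ 2 + Num.sqrt nw.1%:R * `|D|).
Proof.
move=> eta0; have eta4 : 0 < eta / 4 by rewrite divr_gt0.
have [dl [om [dl_gt0 lom ometa he]]] := e_second eta4; exists dl => //.
pose v := Ex nu V + 1.
have v0 : 0 < v.
  by rewrite ltr_wpDl// Ex_ge0// => x; apply: le_trans (envelope_ge1 x).
have omlt : Ex nu om < eta / 2 by apply: le_lt_trans ometa _; lra.
have Vlt : Ex nu V < v by rewrite ltrDl.
have eps1 : \forall n \near \oo, Num.sqrt n%:R * eps n * v <= eta.
  have ev0 : 0 < eta / v by rewrite divr_gt0.
  move/cvgr0_norm_le : eps0 => /(_ _ ev0); apply: filterS => n.
  by rewrite -ler_pdivlMr// => h; apply: le_trans (ler_norm _) h.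
near=> nw.
have h1 : forall x D, `|D| <= dl ->
  `|e nw.1 x D - dot D (s x) - qform (M x) D / 2| <= `|D| ^+ 2 * om x + eps nw.1 * `|D| * V x.
  by near: nw; exact: (whp_near P he).
have h2 : Num.sqrt nw.1%:R * eps nw.1 * v <= eta by near: nw; exact: (whp_near P eps1).
have h3 : \sum_(i < nw.1) om (z i nw.2) <= nw.1%:R * (eta / 2).
  by near: nw; exact: whp_sum_le.
have h4 : \sum_(i < nw.1) V (z i nw.2) <= nw.1%:R * v.
  by near: nw; exact: (whp_sum_le L1_envelope).
have h5 : forall D, `|\sum_(i < nw.1) qform (M (z i nw.2)) D -
    nw.1%:R * qform (\matrix_(i, j) Ex nu (fun x => M x i j)) D| <= nw.1%:R * `|D| ^+ 2 * eta.
  by near: nw; exact: whp_qform.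
move: nw.1 nw.2 h1 h2 h3 h4 h5 => n w h1 h2 h3 h4 h5 D Ddl.
have := h5 D; rewrite M0 mulr0 subr0 => h6.
rewrite dot_score_sum -sumrB.
rewrite (_ : \sum_(i < n) _ = \sum_(i < n) (e n (z i w) D - dot D (s (z i w)) - qform (M (z i w)) D / 2)
   + (\sum_(i < n) qform (M (z i w)) D) / 2); last first.
  by rewrite mulr_suml -big_split/=; apply: eq_bigr => i _; ring.
have r0 : 0 <= Num.sqrt n%:R :> R by exact: sqrtr_ge0.
have rr : Num.sqrt n%:R * Num.sqrt n%:R = n%:R :> R by rewrite -expr2 sqr_sqrtr.
have h7 : `|\sum_(i < n) (e n (z i w) D - dot D (s (z i w)) - qform (M (z i w)) D / 2)| <=
    `|D| ^+ 2 * (n%:R * (eta / 2)) + eps n * `|D| * (n%:R * v).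
  apply: le_trans (ler_norm_sum _ _ _) _.
  apply: (@le_trans _ _ (\sum_(i < n) (`|D| ^+ 2 * om (z i w) + eps n * `|D| * V (z i w)))).
    by apply: ler_sum => i _; exact: h1.
  by rewrite big_split/= -!mulr_sumr lerD// ler_wpM2l// ?exprn_ge0// mulr_ge0.
have h8 : eps n * `|D| * (n%:R * v) <= Num.sqrt n%:R * `|D| * eta.
  have -> : eps n * `|D| * (n%:R * v) = (Num.sqrt n%:R * `|D|) * (Num.sqrt n%:R * eps n * v).
    by rewrite -{1}rr; ring.
  by rewrite ler_wpM2l// mulr_ge0.
have h9 : `|(\sum_(i < n) qform (M (z i w)) D) / 2| <= n%:R * `|D| ^+ 2 * eta / 2.
  by rewrite normrM (ger0_norm (x := 2^-1)) ?invr_ge0// ler_wpM2r// invr_ge0.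
apply: le_trans (ler_normD _ _) _; apply: le_trans (lerD h7 h9) _.
rewrite [leRHS](_ : _ = `|D| ^+ 2 * (n%:R * (eta / 2)) + Num.sqrt n%:R * `|D| * eta
  + n%:R * `|D| ^+ 2 * eta / 2); last by field.
by rewrite lerD2r lerD2l.
Unshelve. all: by end_near. Qed.

Variable la : R.
Hypotheses (la_gt0 : 0 < la) (coercive : forall D, la * `|D| ^+ 2 <= qform information D).

Let eps_small a : 0 < a -> \forall n \near \oo, eps n <= a := le_sqrt_scaled_cvg0 eps_ge0 eps0.

(** Where V <= B the increments are uniformly small for small D, so that min (e^2, 1) is e^2 there;
    dominated convergence shows that little information lies elsewhere. *)
Lemma truncated_information eta : 0 < eta -> exists B : nat, forall D,
  `|qform (\matrix_(i, j) Ex nu (fun x => s x 0 i * s x 0 j * \1_(~` [set x | B%:R < V x]) x)) D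
    - qform information D| <= `|D| ^+ 2 * eta.
Proof.
move=> eta0; pose eta' := eta / (p%:R ^+ 2 + 1).
have c0 : 0 < p%:R ^+ 2 + 1 :> R by rewrite ltr_wpDl ?sqr_ge0.
have eta'0 : 0 < eta' by rewrite divr_gt0.
have : \forall n \near \oo, forall ij : 'I_p * 'I_p,
    `|Ex nu (fun x => s x 0 ij.1 * s x 0 ij.2 * \1_(~` [set x | n%:R < V x]) x) -
      Ex nu (fun x => s x 0 ij.1 * s x 0 ij.2)| <= eta'.
  apply: filter_forall => -[i j] /=.
  have : Ex nu (fun x => s x 0 i * s x 0 j * \1_(~` [set x | n%:R < V x]) x) @[n --> \oo] -->
      Ex nu (fun x => s x 0 i * s x 0 j).
    apply: (Ex_dominated_cvg (Y := fun x => `|s x 0 i * s x 0 j|)).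
    - move=> n; apply: measurable_funM; first exact: L1_meas (lss i j).
      by apply: measurable_indic; apply: measurableC; apply: measurable_gtset; exact: L1_meas L1_envelope.
    - exact: L1_norm.
    - move=> n x; rewrite normrM indicE; case: (_ \in _) => /=.
        by rewrite normr1 mulr1.
      by rewrite normr0 mulr0.
    - move=> x; apply: cvg_near_cst; near=> n.
      rewrite indicE mem_set ?mulr1//=; apply/negP; rewrite -leNgt.
      near: n; exact: nbhs_infty_ger.
  by move/cvgrPdist_le => /(_ _ eta'0); apply: filterS => n; rewrite distrC.
move=> [B _ hB]; exists B => D.
apply: le_trans (qform_close (e := eta') _ _) _.
  by move=> i j; rewrite !mxE; exact: (hB B (leqnn B) (i, j)).
rewrite mulrAC mulrC ler_wpM2l ?exprn_ge0// /eta' mulrA ler_pdivrMr// mulrC.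
by rewrite ler_wpM2l ?(ltW eta0)// lerDl.
Unshelve. all: by end_near. Qed.

(** On the truncation set, e^2 >= (D.s)^2 / 2 - (e - D.s)^2; elsewhere the minimum is only known to
    be nonnegative. *)
Lemma quadratic_growth : exists c0 dl, [/\ 0 < c0, 0 < dl & \forall nw \near whp P,
  forall D, `|D| <= dl -> c0 * (nw.1%:R * `|D| ^+ 2) <=
    \sum_(i < nw.1) Num.min (e nw.1 (z i nw.2) D ^+ 2) 1].
Proof.
have la40 : 0 < la / 4 by rewrite divr_gt0.
have [B hB] := truncated_information la40.
pose b : R := B%:R + 1; have b0 : 0 < b by rewrite ltr_wpDl.
pose A := ~` [set x | B%:R < V x].
have mA : measurable A by apply/measurableC/measurable_gtset; exact: L1_meas L1_envelope.
pose G x : 'M[R]_p := \matrix_(i, j) (s x 0 i * s x 0 j * \1_A x).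
have lG i j : L1 nu (fun x => G x i j).
  apply: (@L1_le _ _ _ _ _ (fun x => `|s x 0 i * s x 0 j|)).
  - apply: (eq_measurable_fun (fun x => s x 0 i * s x 0 j * \1_A x)).
      by move=> x _; rewrite mxE.
    by apply: measurable_funM; [exact: L1_meas (lss i j)|exact: measurable_indic].
  - move=> x; rewrite mxE normrM indicE; case: (_ \in _) => /=.
      by rewrite normr1 mulr1.
    by rewrite normr0 mulr0.
  - exact: L1_norm.
(* [ka] bounds |e - D.s| / |D| on the truncation set. Both entries together give ka^2 <= la / 16,
   and ka <= 1/2 with |D| <= 1 and |D.s| <= 1/2 keeps |e| <= 1. *)
pose ka := Num.min (1 / 2) (la / 8).
have ka0 : 0 < ka by rewrite lt_min divr_gt0//= divr_gt0.
have ka12 : ka <= 1 / 2 by rewrite ge_min lexx.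
have ka2 : ka ^+ 2 <= la / 16.
  have kal : ka <= la / 8 by rewrite ge_min lexx orbT.
  by rewrite expr2; nra.
pose dl := Num.min dl0 (Num.min 1 (Num.min (ka / 2 / b) (1 / 2 / (p%:R + 1) / b))).
have p1 : 0 < p%:R + 1 :> R by rewrite ltr_wpDl.
have dl_gt0 : 0 < dl by rewrite !lt_min dl0_gt0 ltr01 !divr_gt0.
have kb0 : 0 < ka / 2 / b by rewrite !divr_gt0.
exists (la / 8), dl; split=> //; first by rewrite divr_gt0.
near=> nw.
have h1 : forall x D, `|D| <= dl0 ->
  `|e nw.1 x D - dot D (s x)| <= `|D| ^+ 2 * W x + eps nw.1 * `|D| * V x.
  by near: nw; exact: (whp_near P e_first).
have h2 : eps nw.1 <= ka / 2 / b by near: nw; exact: (whp_near P (eps_small kb0)).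
have h3 : forall D, `|\sum_(i < nw.1) qform (G (z i nw.2)) D -
    nw.1%:R * qform (\matrix_(i, j) Ex nu (fun x => G x i j)) D| <= nw.1%:R * `|D| ^+ 2 * (la / 4).
  by near: nw; exact: whp_qform.
move: nw.1 nw.2 h1 h2 h3 => n w h1 h2 h3 D; rewrite !le_min => /and4P[D1 D2 D3 D4].
have D0 : 0 <= `|D| by [].
have pt x : qform (G x) D / 2 - `|D| ^+ 2 * (la / 16) <= Num.min (e n x D ^+ 2) 1.
  have -> : qform (G x) D = dot D (s x) ^+ 2 * \1_A x.
    rewrite mulrC -qform_outer -qformZl; congr (qform _ D).
    by apply/matrixP => i j; rewrite !mxE mulrC.
  rewrite indicE; case: (boolP (x \in A)) => xA; last first.
    rewrite mulr0 mul0r sub0r; apply: (@le_trans _ _ 0).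
      by rewrite oppr_le0 mulr_ge0// ?exprn_ge0// divr_ge0// ltW.
    by rewrite le_min sqr_ge0 ler01.
  rewrite mulr1; have VB : V x <= b.
    have : ~ (B%:R < V x) by move: xA; rewrite inE.
    by move/negP; rewrite -leNgt => h; rewrite (le_trans h)// lerDl.
  have V1 := envelope_ge1 x; rewrite -/V in V1.
  have V0 : 0 <= V x by apply: le_trans V1.
  have WV : W x <= V x by rewrite /V /envelope lerDr addr_ge0.
  have sV : `|s x| <= V x by rewrite /V /envelope addrAC lerDr addr_ge0.
  have dotb : `|dot D (s x)| <= 1 / 2.
    apply: le_trans (dot_le _ _) _; apply: (@le_trans _ _ ((p%:R + 1) * `|D| * b)).
      by apply: ler_pM => //; [rewrite ler_wpM2r// lerDl|exact: le_trans sV VB].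
    by move: D4; rewrite !ler_pdivlMr// => h; rewrite (_ : _ * b = `|D| * b * (p%:R + 1)) //; ring.
  have diff : `|e n x D - dot D (s x)| <= `|D| * ka.
    apply: le_trans (h1 x D D1) _.
    rewrite (_ : _ + _ = `|D| * (`|D| * W x + eps n * V x)); last by ring.
    rewrite ler_wpM2l// [leRHS]splitr lerD//.
      by move: D3; rewrite ler_pdivlMr//; apply: le_trans; rewrite ler_wpM2l// (le_trans WV).
    apply: (@le_trans _ _ (eps n * b)); first by rewrite ler_wpM2l.
    by rewrite -ler_pdivlMr.
  have e1 : `|e n x D| <= 1.
    rewrite (_ : e n x D = (e n x D - dot D (s x)) + dot D (s x)); last by ring.
    apply: le_trans (ler_normD _ _) _; apply: le_trans (lerD diff dotb) _.
    have : `|D| * ka <= 1 * (1 / 2) by apply: ler_pM => //; exact: ltW.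
    lra.
  have e2 : e n x D ^+ 2 <= 1 by rewrite -real_normK ?num_real// exprn_ile1.
  rewrite (min_idPl e2).
  have d2 : (e n x D - dot D (s x)) ^+ 2 <= `|D| ^+ 2 * (la / 16).
    rewrite -real_normK ?num_real// (le_trans (y := (`|D| * ka) ^+ 2))//.
      by rewrite lerXn2r ?nnegrE ?mulr_ge0// ltW.
    by rewrite exprMn ler_wpM2l// exprn_ge0.
  apply: le_trans (lerB (lexx _) d2) _.
  move: (e n x D) (dot D (s x)) => u v; rewrite -subr_ge0.
  by have -> : u ^+ 2 - (v ^+ 2 / 2 - (u - v) ^+ 2) = (2 * u - v) ^+ 2 / 2 by [field]; rewrite divr_ge0// sqr_ge0.
have S1 : (\sum_(i < n) qform (G (z i w)) D) / 2 - n%:R * (`|D| ^+ 2 * (la / 16)) <=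
    \sum_(i < n) Num.min (e n (z i w) D ^+ 2) 1.
  by rewrite mulr_suml -sum_ord_cst -sumrB; apply: ler_sum => i _; exact: pt.
(* In units of la n |D|^2: half of 3/4 - 1/4, the two quarters lost to truncation and to sampling,
   minus 1/16 for the error is 3/16, above the claimed 1/8. *)
apply: le_trans S1.
have S2 := h3 D; have S3 := hB D; have S4 := coercive D.
have GE : \matrix_(i, j) Ex nu (fun x => G x i j) =
    \matrix_(i, j) Ex nu (fun x => s x 0 i * s x 0 j * \1_A x).
  by apply/matrixP => i j; rewrite !mxE; congr (Ex _ _); apply/funext => x; rewrite mxE.
rewrite GE in S2; move: S2 S3; rewrite !ler_norml => /andP[S2 _] /andP[S3 _].
have n0 : 0 <= n%:R :> R by [].
have S5 : n%:R * (`|D| ^+ 2 * (la - la / 4)) <=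
    n%:R * qform (\matrix_(i, j) Ex nu (fun x => s x 0 i * s x 0 j * \1_A x)) D.
  by rewrite ler_wpM2l//; move: S3 S4; rewrite -/A; nra.
have N0 : 0 <= n%:R * (`|D| ^+ 2 * la) by rewrite !mulr_ge0// ?exprn_ge0// ltW.
rewrite -/A in S2; move: S2 S5 N0.
move: (\sum_(i < n) _) (n%:R * qform _ D) => X Y.
rewrite (_ : n%:R * `|D| ^+ 2 * (la / 4) = n%:R * (`|D| ^+ 2 * la) / 4); last by field.
rewrite (_ : n%:R * (`|D| ^+ 2 * (la - la / 4)) = n%:R * (`|D| ^+ 2 * la) * (3 / 4)); last by field.
rewrite (_ : la / 8 * _ = n%:R * (`|D| ^+ 2 * la) / 8); last by field.
rewrite (_ : n%:R * (`|D| ^+ 2 * (la / 16)) = n%:R * (`|D| ^+ 2 * la) / 16); last by field.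
by move: (n%:R * _) => N; lra.
Unshelve. all: by end_near. Qed.

(** [Dhat] stands for the centred estimator, and [good] for an event on which its maximality can be
    used. *)
Variables (Dhat : nat -> Om -> 'rV[R]_p) (good : set Om).
Hypothesis whp_good : \forall nw \near whp P, good nw.2.
Hypothesis e_gtN1 : \forall n \near \oo, forall x D, `|D| <= dl0 -> -1 < e n x D.
Hypothesis Dhat_small : forall dl, 0 < dl -> \forall nw \near whp P, `|Dhat nw.1 nw.2| <= dl.
Hypothesis Dhat_max : \forall n \near \oo, forall w D, good w ->
  `|D| <= dl0 -> `|Dhat n w| <= dl0 ->
  \sum_(i < n) ln (1 + e n (z i w) D) <= \sum_(i < n) ln (1 + e n (z i w) (Dhat n w)).

(** Comparison with D = 0: at the maximiser 0 <= sum of e - (1/6) sum of min (e^2, 1). With x = sqrt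
    n |Dhat| this bounds a multiple of x^2 by x (p |S_n| + 1). *)
Lemma root_n_rate : exists2 C, 0 < C & \forall nw \near whp P,
  Num.sqrt nw.1%:R * `|Dhat nw.1 nw.2| <= C * (`|score_sum nw.1 nw.2| + 1).
Proof.
have [c0 [dl2 [c0_gt0 dl2_gt0 h2]]] := quadratic_growth.
(* Half of the gain c0 / 6 absorbs the quadratic error of the linear term; eta <= 1 bounds its part
   linear in x. *)
pose eta := Num.min 1 (c0 / 12).
have eta0 : 0 < eta by rewrite lt_min ltr01 divr_gt0.
have eta1 : eta <= 1 by rewrite ge_min lexx.
have etac : eta <= c0 / 12 by rewrite ge_min lexx orbT.
have [dl1 dl1_gt0 h1] := linear_term eta0.
have p1 : 0 < p%:R + 1 :> R by rewrite ltr_wpDl.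
exists (12 / c0 * (p%:R + 1)); first by rewrite mulr_gt0// divr_gt0.
near=> nw.
have k1 : forall D, `|D| <= dl1 ->
    `|\sum_(i < nw.1) e nw.1 (z i nw.2) D - Num.sqrt nw.1%:R * dot D (score_sum nw.1 nw.2)| <=
    eta * (nw.1%:R * `|D| ^+ 2 + Num.sqrt nw.1%:R * `|D|) by near: nw.
have k2 : forall D, `|D| <= dl2 -> c0 * (nw.1%:R * `|D| ^+ 2) <=
    \sum_(i < nw.1) Num.min (e nw.1 (z i nw.2) D ^+ 2) 1 by near: nw.
have k3 : forall x D, `|D| <= dl0 -> -1 < e nw.1 x D by near: nw; exact: (whp_near P e_gtN1).
have k4 : forall w D, good w -> `|D| <= dl0 -> `|Dhat nw.1 w| <= dl0 ->
  \sum_(i < nw.1) ln (1 + e nw.1 (z i w) D) <= \sum_(i < nw.1) ln (1 + e nw.1 (z i w) (Dhat nw.1 w)).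
  by near: nw; exact: (whp_near P Dhat_max).
have kg : good nw.2 by near: nw.
have k5 : `|Dhat nw.1 nw.2| <= dl0 by near: nw; exact: Dhat_small.
have k6 : `|Dhat nw.1 nw.2| <= dl1 by near: nw; exact: Dhat_small.
have k7 : `|Dhat nw.1 nw.2| <= dl2 by near: nw; exact: Dhat_small.
have k8 : forall x D, `|D| <= dl0 ->
  `|e nw.1 x D - dot D (s x)| <= `|D| ^+ 2 * W x + eps nw.1 * `|D| * V x.
  by near: nw; exact: (whp_near P e_first).
move: nw.1 nw.2 k1 k2 k3 k4 kg k5 k6 k7 k8 => n w k1 k2 k3 k4 kg k5 k6 k7 k8.
(* Forced by [e_first] at D = 0, where its right-hand side vanishes. *)
have e00 x : e n x 0 = 0.
  have z0 : `|0 : 'rV[R]_p| <= dl0 by rewrite normr0 ltW.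
  have := k8 x 0 z0; rewrite normr0 expr0n /= mul0r mulr0 mul0r addr0 normr_le0.
  by rewrite /dot mul0mx mxE subr0 => /eqP.
pose D := Dhat n w.
have m0 : 0 <= \sum_(i < n) ln (1 + e n (z i w) D).
  have z0 : `|0 : 'rV[R]_p| <= dl0 by rewrite normr0 ltW.
  apply: le_trans (k4 w 0 kg z0 k5); rewrite big1// => i _.
  by rewrite e00 addr0 ln1.
have m1 : \sum_(i < n) ln (1 + e n (z i w) D) <=
    \sum_(i < n) e n (z i w) D - 6^-1 * \sum_(i < n) Num.min (e n (z i w) D ^+ 2) 1.
  by rewrite mulr_sumr -sumrB; apply: ler_sum => i _; apply/ln1D_le_quad/k3.
have m2 := k2 D k7; have := k1 D k6; rewrite ler_norml => /andP[_ m3].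
pose r : R := Num.sqrt n%:R; have r0 : 0 <= r by exact: sqrtr_ge0.
have rr : r ^+ 2 = n%:R by rewrite sqr_sqrtr.
have m4 : dot D (score_sum n w) <= p%:R * `|D| * `|score_sum n w|.
  by apply: le_trans (ler_norm _) _; exact: dot_le.
set S := `|score_sum n w| in m4 *.
have S0 : 0 <= S by exact: normr_ge0.
pose x := r * `|D|; have x0 : 0 <= x by rewrite mulr_ge0.
have nx : n%:R * `|D| ^+ 2 = x ^+ 2 by rewrite exprMn rr.
rewrite nx -/r -/x in m2 m3.
have m5 : r * dot D (score_sum n w) <= x * (p%:R * S).
  by rewrite /x (_ : _ * (p%:R * S) = r * (p%:R * `|D| * S)); [rewrite ler_wpM2l|ring].
have m6 : c0 / 12 * x ^+ 2 <= x * (p%:R * S + 1).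
  have q1 : eta * (x ^+ 2 + x) <= c0 / 12 * x ^+ 2 + x.
    rewrite mulrDr lerD//; first by rewrite ler_wpM2r// exprn_ge0.
    by rewrite -[leRHS]mul1r ler_wpM2r.
  move: m0 m1 m2 m3 m5 q1; move: (\sum_(i < n) ln _) (\sum_(i < n) e _ _ _) (\sum_(i < n) Num.min _ _).
  move=> a1 a2 a3; move: (r * dot _ _) => a4; rewrite [x * (_ + 1)]mulrDr mulr1.
  move: (x * (p%:R * S)) => a5 g1 g2 g3 g4 g5 g6.
  have : c0 / 12 * x ^+ 2 = c0 * x ^+ 2 / 12 by field.
  move: g3 g4 g6; move: (eta * _) (c0 * _) => a6 a7;
  lra.
rewrite -/D -/r -/x.
have m7 : c0 / 12 * x <= p%:R * S + 1.
  move: x0; rewrite le_eqVlt => /orP[/eqP <-|x_gt0]; first by rewrite mulr0 addr_ge0// mulr_ge0.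
  by rewrite -(ler_pM2l x_gt0) (le_trans _ m6)// expr2 mulrCA.
have m8 : x <= 12 / c0 * (p%:R * S + 1).
  by rewrite -ler_pdivrMl ?divr_gt0// invf_div.
apply: le_trans m8 _; rewrite -[leRHS]mulrA ler_wpM2l ?divr_ge0// ?(ltW c0_gt0)//.
have : 0 <= p%:R :> R by [].
by nra.
Unshelve. all: by end_near. Qed.

(** For D = h / sqrt n the increments are small for all observations at once, because the largest V
    and the largest |s|^2 among n observations are o(n) by [whp_max]. The scalar expansion therefore
    applies termwise, and the law of large numbers for s s^T gives the quadratic term uniformly in
    h. *)
Lemma quadratic_expansion K eta : 0 < K -> 0 < eta -> \forall nw \near whp P, forall h, `|h| <= K ->
  `|\sum_(i < nw.1) ln (1 + e nw.1 (z i nw.2) ((Num.sqrt nw.1%:R)^-1 *: h))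
    - dot h (score_sum nw.1 nw.2) + qform information h / 2| <= eta.
Proof.
move=> K0 eta0.
pose v := Ex nu V + 1.
have v0 : 0 < v by rewrite ltr_wpDl// Ex_ge0// => x; apply: le_trans (envelope_ge1 x).
have Vlt : Ex nu V < v by rewrite ltrDl.
pose CK := K ^+ 2 + K; have CK0 : 0 < CK by rewrite addr_gt0// exprn_gt0.
pose A := p%:R * K + CK.
have A0 : 0 < A by rewrite ltr_wpDl// mulr_ge0// ltW.
pose Q := p%:R ^+ 2 * K ^+ 2 * `|information|.
have Q0 : 0 <= Q by apply: mulr_ge0 => //; apply: mulr_ge0; apply: exprn_ge0 => //; exact: ltW.
(* The total error divided by [t]: linear term, logarithmic remainder, and fluctuation of the
   empirical information. *)
pose c := CK + A * (2 * (Q + K ^+ 2) + 3 * (CK * v)) + K ^+ 2 / 2.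
have K20 : 0 <= K ^+ 2 by rewrite exprn_ge0// ltW.
have c0 : 0 < c.
  rewrite /c ltr_wpDr ?divr_ge0// ltr_wpDr// mulr_ge0 ?(ltW A0)//.
  have CKv : 0 <= CK * v by apply: mulr_ge0; exact: ltW.
  by rewrite addr_ge0// mulr_ge0// addr_ge0.
(* The common small parameter: A t <= 1/2 is the range of the scalar expansion, and c t <= eta the
   final accuracy. *)
pose t := Num.min 1 (Num.min (1 / 2 / A) (eta / c)).
have t0 : 0 < t by rewrite !lt_min ltr01 !divr_gt0.
have : t <= t by []; rewrite {2}/t !le_min => /and3P[t1 tA tc].
have [dl dl_gt0 h1] := linear_term t0.
pose s2 x := \sum_(j < p) s x 0 j ^+ 2.
have ls2 : L1 nu s2 by apply: L1_sum => j; exact: lss.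
have s20 x : 0 <= s2 x by apply: sumr_ge0 => j _; exact: sqr_ge0.
have t20 : 0 < t ^+ 2 by rewrite exprn_gt0.
have mdl : 0 < Num.min dl dl0 by rewrite lt_min dl_gt0.
have V0 x : 0 <= V x by apply: le_trans (envelope_ge1 x).
have lo i j : L1 nu (fun x => (\matrix_(i, j) (s x 0 i * s x 0 j) : 'M[R]_p) i j).
  by under eq_fun do rewrite mxE.
have reps : \forall n \near \oo, Num.sqrt n%:R * eps n <= 1.
  move/cvgr0_norm_le : eps0 => /(_ _ ltr01); apply: filterS => n.
  exact: le_trans (ler_norm _).
have rbig : \forall n \near \oo, K / Num.min dl dl0 <= Num.sqrt (n%:R : R).
  have Kd0 : 0 <= K / Num.min dl dl0 by rewrite divr_ge0// ltW.
  near=> n; rewrite -[leLHS](ger0_norm Kd0) -sqrtr_sqr ler_wsqrtr//.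
  by near: n; exact: nbhs_infty_ger.
near=> nw.
have k0 : (0 < nw.1)%N by near: nw; exact: (whp_near P (nbhs_infty_gt 0)).
have k1 : forall D, `|D| <= dl ->
    `|\sum_(i < nw.1) e nw.1 (z i nw.2) D - Num.sqrt nw.1%:R * dot D (score_sum nw.1 nw.2)| <=
    t * (nw.1%:R * `|D| ^+ 2 + Num.sqrt nw.1%:R * `|D|) by near: nw.
have k2 : forall x D, `|D| <= dl0 ->
  `|e nw.1 x D - dot D (s x)| <= `|D| ^+ 2 * W x + eps nw.1 * `|D| * V x.
  by near: nw; exact: (whp_near P e_first).
have k3 : Num.sqrt nw.1%:R * eps nw.1 <= 1 by near: nw; exact: (whp_near P reps).
have k4 : K / Num.min dl dl0 <= Num.sqrt (nw.1%:R : R) by near: nw; exact: (whp_near P rbig).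
have k5 : forall i, (i < nw.1)%N -> V (z i nw.2) <= t * nw.1%:R.
  by near: nw; exact: (whp_max mz zP L1_envelope V0 t0).
have k6 : forall i, (i < nw.1)%N -> s2 (z i nw.2) <= t ^+ 2 * nw.1%:R.
  by near: nw; exact: (whp_max mz zP ls2 s20 t20).
have k7 : \sum_(i < nw.1) V (z i nw.2) <= nw.1%:R * v.
  by near: nw; exact: (whp_sum_le L1_envelope Vlt).
have k8 : forall D, `|\sum_(i < nw.1) qform (\matrix_(k, l) (s (z i nw.2) 0 k * s (z i nw.2) 0 l)) D -
    nw.1%:R * qform (\matrix_(k, l) Ex nu (fun x => (\matrix_(i, j) (s x 0 i * s x 0 j) : 'M[R]_p) k l)) D|
    <= nw.1%:R * `|D| ^+ 2 * t by near: nw; exact: (whp_qform lo t0).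
move: nw.1 nw.2 k0 k1 k2 k3 k4 k5 k6 k7 k8 => n w k0 k1 k2 k3 k4 k5 k6 k7 k8 h hK.
pose r : R := Num.sqrt n%:R; have nR0 : 0 < n%:R :> R by rewrite ltr0n.
have r0 : 0 < r by rewrite sqrtr_gt0.
have rr : r ^+ 2 = n%:R by rewrite sqr_sqrtr.
rewrite -/r in k3 k4 *; pose D := r^-1 *: h; rewrite -/D.
have Dh : `|D| = `|h| / r by rewrite normrZ gtr0_norm ?invr_gt0// mulrC.
have rD : r * `|D| <= K by rewrite Dh mulrC divfK// gt_eqF.
have Ddl : `|D| <= Num.min dl dl0.
  by rewrite Dh ler_pdivrMr// (le_trans hK)// -ler_pdivrMl// mulrC.
move: Ddl; rewrite le_min => /andP[Ddl Ddl0].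
have nD : n%:R * `|D| ^+ 2 <= K ^+ 2.
  by rewrite -rr -exprMn lerXn2r ?nnegrE ?mulr_ge0// ltW.
pose a i := dot D (s (z i w)); pose E i := e n (z i w) D; pose u i := CK / n%:R * V (z i w).
have diff i : `|E i - a i| <= u i.
  apply: le_trans (k2 (z i w) D Ddl0) _; rewrite /u /CK !mulrDl lerD//.
    apply: (@le_trans _ _ (`|D| ^+ 2 * V (z i w))).
      by rewrite ler_wpM2l ?exprn_ge0// /V /envelope lerDr addr_ge0.
    by rewrite ler_wpM2r// ler_pdivlMr// mulrC.
  rewrite ler_wpM2r// ler_pdivlMr// -rr.
  have -> (x y k : R) : x * y * k ^+ 2 = (k * x) * (k * y) by ring.
  by rewrite -[leRHS]mul1r ler_pM// mulr_ge0// ltW.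
have ab i : (i < n)%N -> `|a i| <= p%:R * K * t.
  move=> i_n; apply: le_trans (dot_le _ _) _.
  have st : `|s (z i w)| <= t * r.
    have T0 : 0 <= t * r by apply: mulr_ge0; exact: ltW.
    apply/mx_norm_leP => // k j; rewrite ord1 -sqrtr_sqr -(ger0_norm T0) -sqrtr_sqr.
    rewrite ler_wsqrtr// exprMn rr; apply: le_trans (k6 i i_n).
    by rewrite /s2 (bigD1 j)//= lerDl sumr_ge0// => l _; exact: sqr_ge0.
  rewrite -!mulrA ler_wpM2l// Dh -mulrA (mulrC r^-1).
  by apply: ler_pM => //; rewrite ?ler_pdivrMr// mulr_ge0// invr_ge0 ltW.
have uA i : (i < n)%N -> u i <= CK * t.
  by move=> i_n; rewrite /u -mulrA ler_wpM2l ?(ltW CK0)// ler_pdivrMl// mulrC k5.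
have aA i : (i < n)%N -> `|a i| <= A * t.
  by move=> /ab h'; apply: le_trans h' _; rewrite ler_wpM2r ?(ltW t0)// lerDl ltW.
have EA i : (i < n)%N -> `|E i| <= A * t.
  move=> i_n; rewrite (_ : E i = a i + (E i - a i)); last by ring.
  apply: le_trans (ler_normD _ _) _; rewrite /A mulrDl lerD ?ab//.
  exact: le_trans (diff i) (uA i i_n).
have At : A * t <= 1 / 2 by rewrite mulrC -ler_pdivlMr.
have pt (i : 'I_n) : `|ln (1 + E i) - E i + a i ^+ 2 / 2| <= A * t * (2 * a i ^+ 2 + 3 * u i).
  by apply: ln1D_close => //; [exact: aA|exact: EA].
pose Sa := \sum_(i < n) a i ^+ 2.
have Su : \sum_(i < n) u i <= CK * v.
  rewrite /u -mulr_sumr -mulrA ler_wpM2l ?(ltW CK0)// ler_pdivrMl//.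
have qh : n%:R * qform information D = qform information h.
  by rewrite qformZ -rr exprVn mulrA mulfV ?mul1r// gt_eqF// exprn_gt0.
have Sah : `|Sa - qform information h| <= K ^+ 2 * t.
  have := k8 D; under eq_bigr do rewrite qform_outer.
  rewrite (_ : \matrix_(k, l) _ = information); last first.
    by apply/matrixP => i j; rewrite !mxE; congr (Ex _ _); apply/funext => x; rewrite mxE.
  by rewrite qh => /le_trans; apply; rewrite ler_wpM2r ?(ltW t0).
have qQ : `|qform information h| <= Q.
  apply: le_trans (qform_le (e := `|information|) _ _) _.
    by move=> i j; exact: le_coord_mx_norm.
  by rewrite /Q ler_wpM2r// ler_wpM2l ?exprn_ge0// lerXn2r ?nnegrE// ltW.
have SaQ : Sa <= Q + K ^+ 2.
  have : K ^+ 2 * t <= K ^+ 2 by rewrite -[leRHS]mulr1 ler_wpM2l.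
  move: Sah qQ; rewrite !ler_norml => /andP[_ q1] /andP[_ q2] q3.
  by rewrite lerBlDr in q1; apply: le_trans q1 _; rewrite addrC lerD.
have z1 : `|\sum_(i < n) ln (1 + E i) - \sum_(i < n) E i + Sa / 2| <=
    A * t * (2 * (Q + K ^+ 2) + 3 * (CK * v)).
  rewrite -sumrB mulr_suml -big_split/=; apply: le_trans (ler_norm_sum _ _ _) _.
  apply: le_trans (ler_sum _ (fun i _ => pt i)) _.
  rewrite -mulr_sumr ler_wpM2l ?mulr_ge0 ?(ltW A0) ?(ltW t0)//.
  have -> : \sum_(i < n) (2 * a i ^+ 2 + 3 * u i) = 2 * Sa + 3 * \sum_(i < n) u i.
    by rewrite big_split/= !mulr_sumr.
  by apply: lerD; rewrite ler_wpM2l.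
have z2 : `|\sum_(i < n) E i - dot h (score_sum n w)| <= t * CK.
  have := k1 D Ddl; rewrite -/r -dotZl scalerA mulfV ?gt_eqF// scale1r => /le_trans; apply.
  by rewrite ler_wpM2l ?(ltW t0)// lerD.
rewrite (_ : _ + _ = (\sum_(i < n) ln (1 + E i) - \sum_(i < n) E i + Sa / 2)
   + (\sum_(i < n) E i - dot h (score_sum n w)) - (Sa - qform information h) / 2); last by field.
apply: le_trans (ler_normB _ _) _; rewrite [X in _ + X]normrM (ger0_norm (x := 2^-1)) ?invr_ge0//.
have z4 : `|Sa - qform information h| / 2 <= K ^+ 2 * t / 2 by rewrite ler_wpM2r ?invr_ge0.
apply: le_trans (lerD (le_trans (ler_normD _ _) (lerD z1 z2)) z4) _.
move: tc; rewrite ler_pdivlMr// => /(le_trans _); apply.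
have aux (k b x1 x2 x3 : R) :
  b * k * x1 + k * x2 + x3 * k / 2 = k * (x2 + b * x1 + x3 / 2) by field.
by rewrite aux.
Unshelve. all: by end_near. Qed.

Hypothesis information_unit : information \in unitmx.

Lemma information_sym : information^T = information.
Proof. by apply/matrixP => i j; rewrite !mxE; congr (Ex _ _); apply/funext => x; rewrite mulrC. Qed.

Let complete_square D u : u *m information = score_sum D.1 D.2 -> forall v,
  qform information (v - u) = qform information v - 2 * dot v (score_sum D.1 D.2)
    + dot u (score_sum D.1 D.2).
Proof.
move=> uS v; have uI : information *m u^T = (score_sum D.1 D.2)^T.
  by rewrite -uS trmx_mul information_sym.
have h1 : (u *m information *m v^T) 0 0 = dot v (score_sum D.1 D.2).
  by rewrite uS /dot !mxE; apply: eq_bigr => j _; rewrite !mxE mulrC.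
rewrite /qform [(v - u)^T]linearB/= mulmxBl mulmxBr !mulmxBl.
have aM (X Y : 'M[R]_1) : (X - Y) 0 0 = X 0 0 - Y 0 0 by rewrite mxE [in X in _ + X]mxE.
have h2 x : (x *m information *m u^T) 0 0 = dot x (score_sum D.1 D.2).
  by rewrite -mulmxA uI.
by rewrite !aM h1 !h2 opprB; ring.
Qed.

(* With [h = sqrt n Dhat] and [u = S I^-1] the maximality of [Dhat] gives
   [qform I (h - u) / 2 <= 2 eta], since [I] is the Hessian of the quadratic expansion. *)
Lemma maximizer_linearization eta : 0 < eta -> \forall nw \near whp P,
  `|Num.sqrt nw.1%:R *: Dhat nw.1 nw.2 - score_sum nw.1 nw.2 *m invmx information| <= eta.
Proof.
move=> eta0; have [C C0 hC] := root_n_rate.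
(* Once |S_n| <= m, both sqrt n Dhat, by the rate, and S_n I^-1 lie in one ball of radius [K], where
   the quadratic expansion is uniform. *)
apply: (tight_whp tight_score_sum) => m m0.
pose K := C * (m + 1) + p%:R * m * `|invmx information| + 1.
have K1 : 0 <= C * (m + 1) by apply: mulr_ge0; [exact: ltW|rewrite addr_ge0// ltW].
have K2 : 0 <= p%:R * m * `|invmx information|.
  by apply: mulr_ge0 => //; apply: mulr_ge0 => //; exact: ltW.
have K0 : 0 < K by rewrite ltr_wpDl// addr_ge0.
(* Chosen so that coercivity turns the bound 4 et on the form into |h - u| <= eta. *)
pose et := la * eta ^+ 2 / 4; have et0 : 0 < et by rewrite divr_gt0// mulr_gt0// exprn_gt0.
have rbig : \forall n \near \oo, K / dl0 <= Num.sqrt (n%:R : R).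
  have Kd0 : 0 <= K / dl0 by rewrite divr_ge0// ltW.
  near=> n; rewrite -[leLHS](ger0_norm Kd0) -sqrtr_sqr ler_wsqrtr//.
  by near: n; exact: nbhs_infty_ger.
near=> nw.
have k0 : (0 < nw.1)%N by near: nw; exact: (whp_near P (nbhs_infty_gt 0)).
have k1 : Num.sqrt nw.1%:R * `|Dhat nw.1 nw.2| <= C * (`|score_sum nw.1 nw.2| + 1) by near: nw.
have k2 : K / dl0 <= Num.sqrt (nw.1%:R : R) by near: nw; exact: (whp_near P rbig).
have k3 : forall h, `|h| <= K ->
  `|\sum_(i < nw.1) ln (1 + e nw.1 (z i nw.2) ((Num.sqrt nw.1%:R)^-1 *: h))
    - dot h (score_sum nw.1 nw.2) + qform information h / 2| <= et.
  by near: nw; exact: quadratic_expansion.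
have k4 : forall w D, good w -> `|D| <= dl0 -> `|Dhat nw.1 w| <= dl0 ->
  \sum_(i < nw.1) ln (1 + e nw.1 (z i w) D) <= \sum_(i < nw.1) ln (1 + e nw.1 (z i w) (Dhat nw.1 w)).
  by near: nw; exact: (whp_near P Dhat_max).
have kg : good nw.2 by near: nw.
have k5 : `|Dhat nw.1 nw.2| <= dl0 by near: nw; exact: Dhat_small.
move: nw.1 nw.2 k0 k1 k2 k3 k4 kg k5 => n w k0 k1 k2 k3 k4 kg k5; rewrite normr_id => Sm.
set S := score_sum n w in Sm k1 k3 *; pose u := S *m invmx information.
pose r : R := Num.sqrt n%:R; have r0 : 0 < r by rewrite sqrtr_gt0 ltr0n.
rewrite -/r in k1 k2 k3 *; rewrite -/u; pose v := r *: Dhat n w; rewrite -/v.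
have uK : `|u| <= K.
  apply: (@le_trans _ _ (p%:R * m * `|invmx information|)); last by rewrite /K -addrA addrCA lerDl addr_ge0.
  apply/mx_norm_leP => // i j; rewrite ord1 mxE.
  apply: le_trans (norm_sum_pM S (B := `|invmx information|) _) _.
    by move=> k; exact: le_coord_mx_norm.
  by rewrite ler_wpM2r// ler_wpM2l.
have vK : `|v| <= K.
  rewrite normrZ gtr0_norm//; apply: le_trans k1 _; rewrite /K -addrA ler_wpDr ?addr_ge0//.
  by rewrite ler_wpM2l ?(ltW C0)// lerD2r.
have uD : `|r^-1 *: u| <= dl0.
  rewrite normrZ gtr0_norm ?invr_gt0// ler_pdivrMl// (le_trans uK)//.
  by rewrite -ler_pdivrMr.
have rv : r^-1 *: v = Dhat n w by rewrite scalerA mulVf ?scale1r// gt_eqF.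
have q1 := k4 w _ kg uD k5; have q2 := k3 _ uK; have q3 := k3 _ vK; rewrite rv in q3.
have uS : u *m information = score_sum (n, w).1 (n, w).2 by rewrite mulmxKV.
have q4 := complete_square uS v; rewrite /= -/S in q4.
have q5 : qform information u = dot u S by rewrite /qform uS dotC.
have q6 := coercive (v - u).
have q7 : la * `|v - u| ^+ 2 <= la * eta ^+ 2.
  apply: le_trans q6 _; rewrite q4 -q5 (_ : la * _ = 4 * et); last by rewrite /et; field.
  move: q1 q2 q3; rewrite q5 !ler_norml; move: (\sum_(i < n) _) (\sum_(i < n) _) => a2 a1.
  move: (dot u S) (dot v S) (qform _ v) => a3 a4 a5 q1 /andP[q2 _] /andP[_ q3].
  have aux (b : R) : - b <= a1 - a3 + a3 / 2 -> a2 - a4 + a5 / 2 <= b -> a5 - 2 * a4 + a3 <= 4 * b.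
    by lra.
  exact: aux q2 q3.
by move: q7; rewrite ler_pM2l// ler_pXn2r// ?nnegrE// ltW.
Unshelve. all: by end_near. Qed.

End local_expansion.

(** * Consistency *)

Section strict_expectation.
Context {R : realType} {d : measure_display} {T : measurableType d}.
Variable nu : probability T R.

Lemma Ex_gt0 X : L1 nu X -> (forall x, 0 <= X x) -> (0 < nu [set x | X x != 0%R])%E -> 0 < Ex nu X.
Proof.
move=> lX X0 nuX; rewrite lt_neqAle Ex_ge0// andbT; apply/eqP => EX.
have : (\int[nu]_x `|(X x)%:E|)%E = 0%E.
  rewrite -[RHS]/(0 : R)%:E EX (EFin_Ex lX); apply: eq_integral => x _.
  by rewrite /= ger0_norm.
have mX : measurable_fun setT (EFin \o X) by apply/measurable_EFinP; exact: L1_meas lX.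
move/(ae_eq_integral_abs nu measurableT mX) => [N [mN N0 hN]].
suff : (nu [set x | X x != 0%R] <= nu N)%E by rewrite N0 leNgt nuX.
have mS : measurable [set x | X x != 0].
  rewrite (_ : [set _ | _] = [set x | 0 < X x]); first exact: measurable_gtset (L1_meas lX).
  by apply/seteqP; split=> x /=; rewrite lt_neqAle X0 andbT eq_sym.
apply: le_measure; rewrite ?inE//.
apply: subset_trans hN => x /= Xx; apply/existsNP; exists Logic.I => /= -[Xx0].
by move: Xx; rewrite Xx0 eqxx.
Qed.

(** Strict Jensen inequality: u - 1 - ln u is at least min ((u - 1)^2, 1) / 6, positive wherever u
    differs from 1, and u - 1 has mean 0. *)
Lemma Ex_ln_lt0 u : L1 nu u -> L1 nu (fun x => ln (u x)) -> (forall x, 0 < u x) -> Ex nu u = 1 ->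
  (0 < nu [set x | u x != 1%R])%E -> Ex nu (fun x => ln (u x)) < 0.
Proof.
move=> lu llu u0 u1 nuu; have lX := L1B (L1B lu (L1_cst nu 1)) llu.
have h x : 6^-1 * Num.min ((u x - 1) ^+ 2) 1 <= u x - 1 - ln (u x).
  have := @ln1D_le_quad R (u x - 1); rewrite [1 + _]addrC subrK => h; rewrite lerBrDl -lerBrDr.
  by apply: h; rewrite ltrBrDr addNr.
have m0 x : 0 <= 6^-1 * Num.min ((u x - 1) ^+ 2) 1.
  by rewrite mulr_ge0 ?invr_ge0// le_min sqr_ge0 ler01.
have : 0 < Ex nu (fun x => u x - 1 - ln (u x)).
  apply: Ex_gt0 => //; first by move=> x; exact: le_trans (m0 x) (h x).
  rewrite (_ : [set _ | _] = [set x | u x != 1])//; apply/seteqP; split=> x /=.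
    by apply: contra => /eqP ->; rewrite ln1 subrr subr0.
  move=> ux; rewrite gt_eqF// (lt_le_trans _ (h x))// mulr_gt0 ?invr_gt0//.
  by rewrite lt_min ltr01 andbT exprn_even_gt0//= subr_eq0.
rewrite (ExB (L1B lu (L1_cst nu 1)) llu) (ExB lu (L1_cst nu 1)) Ex_cst u1 subrr sub0r.
by rewrite oppr_gt0.
Qed.

End strict_expectation.

Section balls.
Context {R : realType} {p : nat}.
Implicit Types (K : set 'rV[R]_p) (t : 'rV[R]_p).

Lemma continuous_dist t : continuous (fun s : 'rV[R]_p => `|t - s|).
Proof.
move=> s; apply/(@cvgrPdist_le _ _ _ _ (nbhs_filter s)) => e e0; apply/nbhs_ballP; exists e => // s'.
rewrite -ball_normE /= => ss'; apply: le_trans (ler_dist_dist _ _) _.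
by rewrite opprB addrC addrA subrK distrC ltW.
Qed.

Lemma closed_cball t r : closed [set s | `|t - s| <= r].
Proof.
have h := @preimage_closed _ _ (fun s : 'rV[R]_p => `|t - s|) [set y : R | y <= r].
by apply: h; [move=> s _; exact: continuous_dist|exact: closed_le].
Qed.

Lemma closed_outside t r : closed [set s | r <= `|t - s|].
Proof.
have h := @preimage_closed _ _ (fun s : 'rV[R]_p => `|t - s|) [set y : R | r <= y].
by apply: h; [move=> s _; exact: continuous_dist|exact: closed_ge].
Qed.

Lemma cont_on_sub K K' g : K' `<=` K -> cont_on K g -> cont_on K' g.
Proof.
move=> KK' cg t Kt e e0; have [dl dl0 h] := cg t (KK' _ Kt) e e0.
by exists dl => // s /KK'; exact: h.
Qed.

End balls.

(** * Wald's consistency argument *)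

Section wald.
Context {R : realType} {p : nat} {d d' : measure_display} {Om : measurableType d}
  {T : measurableType d'}.
Variables (P : probability Om R) (nu : probability T R) (z : nat -> Om -> T).
Hypothesis mz : forall i, measurable_fun setT (z i).
Hypothesis indep : mutually_independent P z.
Hypothesis zP : forall i A, measurable A -> P (z i @^-1` A) = nu A.
Variables (Th : set 'rV[R]_p) (th0 : 'rV[R]_p) (ell : T -> 'rV[R]_p -> R) (F : T -> R).
Hypotheses (cTh : compact Th) (Th0 : Th th0).
Hypotheses (c_ell : forall x, cont_on Th (ell x))
  (m_ell : forall t, Th t -> measurable_fun setT (ell^~ t))
  (lF : L1 nu F) (ell_F : forall x t, Th t -> `|ell x t| <= F x).
Hypothesis th0_max : forall t, Th t -> t != th0 -> Ex nu (ell^~ t) < Ex nu (ell^~ th0).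

Let l_ell t : Th t -> L1 nu (ell^~ t).
Proof. by move=> Tht; apply: L1_le lF; [exact: m_ell|move=> x; exact: ell_F]. Qed.

(** Suprema over closed balls shrinking to [t] converge to [ell] at [t] by continuity, and their
    means follow by domination by [F]. *)
Lemma local_sup t eta : Th t -> 0 < eta -> exists r G, [/\ 0 < r, L1 nu G,
  Ex nu G < Ex nu (ell^~ t) + eta & forall x s, Th s -> `|t - s| <= r -> ell x s <= G x].
Proof.
move=> Tht eta0; pose K k := Th `&` [set s | `|t - s| <= harmonic k].
have h0 k : 0 < harmonic k :> R by rewrite /harmonic /= invr_gt0.
have Kt k : K k t by split => //=; rewrite subrr normr0 ltW.
have cK k : compact (K k) by apply: compact_closedI => //; exact: closed_cball.
have K0 k : K k !=set0 by exists t.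
have c_ellK k x : cont_on (K k) (ell x) by apply: cont_on_sub (c_ell x); exact: subIsetl.
have m_ellK k s : K k s -> measurable_fun setT (ell^~ s) by move=> [Ths _]; exact: m_ell.
pose G k := sup_on (K k) ell.
have mG k : measurable_fun setT (G k).
  exact: (measurable_sup_on (cK k) (K0 k) (c_ellK k) (m_ellK k)).
have GF k x : `|G k x| <= F x.
  rewrite ler_norml; apply/andP; split.
    have := ell_F x Tht; rewrite ler_norml => /andP[h _]; apply: le_trans h _.
    exact: (sup_on_ge (cK k) (c_ellK k)).
  apply: (sup_on_le (K0 k)) => s [Ths _]; exact: le_trans (ler_norm _) (ell_F x Ths).
have : Ex nu (G n) @[n --> \oo] --> Ex nu (ell^~ t).
  apply: (Ex_dominated_cvg (Y := F)) => // x; apply/cvgrPdist_le => e e0.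
  have [dl dl0 h] := c_ell x Tht e0; near=> k.
  rewrite distrC ger0_norm; last by rewrite subr_ge0; exact: (sup_on_ge (cK k) (c_ellK k)).
  rewrite lerBlDr; apply: (sup_on_le (K0 k)) => s [Ths /= ts].
  have kdl : harmonic k < dl by near: k; exact: (cvgr_lt _ cvg_harmonic).
  have := h s Ths (le_lt_trans ts kdl); rewrite ler_distlC => /andP[_]; lra.
move/cvgrPdist_lt => /(_ _ eta0) [k _ hk].
exists (harmonic k), (G k); split=> //.
- exact: L1_le lF.
- have := hk k (leqnn k); rewrite ltr_distlC => /andP[_]; exact.
- by move=> x s Ths ts; exact: (sup_on_ge (cK k) (c_ellK k)).
Unshelve. all: by end_near. Qed.

Variables (Lt : nat -> Om -> 'rV[R]_p -> R) (That : nat -> Om -> 'rV[R]_p)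
  (good : set Om).
Hypothesis whp_good : \forall nw \near whp P, good nw.2.
Hypothesis Lt_close : forall eta, 0 < eta -> \forall n \near \oo, forall w t, Th t ->
  `|Lt n w t - mean z n (ell^~ t) w| <= eta.
Hypothesis That_max : forall n w, good w -> Th (That n w) /\ forall t, Th t -> Lt n w t <= Lt n w (That n w).

Lemma wald_consistency dl : 0 < dl -> \forall nw \near whp P, `|That nw.1 nw.2 - th0| <= dl.
Proof.
move=> dl0; pose K := Th `&` [set s | dl <= `|th0 - s|].
have cK : compact K by apply: compact_closedI => //; exact: closed_outside.
have : \forall nw \near whp P, K `<=` (fun s => Th s -> Lt nw.1 nw.2 s < Lt nw.1 nw.2 th0).
  (* The covering form of compactness is used along the filter [whp]: only a neighbourhood of each
     [t] has to be treated. *)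
  apply: (iffLR (compact_near_coveringP K) cK) => t [Tht /= tdl].
  have tth0 : t != th0.
    by apply/eqP => E; move: tdl; rewrite E subrr normr0 leNgt dl0.
  (* The gap is spent in five parts: local supremum, law of large numbers at [t] and at [th0], and
     closeness of [Lt] at both parameters. *)
  pose eta := (Ex nu (ell^~ th0) - Ex nu (ell^~ t)) / 5.
  have eta0 : 0 < eta by rewrite divr_gt0// subr_gt0 th0_max.
  have [r [G [r0 lG EG hG]]] := local_sup Tht eta0.
  have w : \forall nw \near whp P, [/\ mean z nw.1 G nw.2 <= Ex nu G + eta,
      Ex nu (ell^~ th0) - eta <= mean z nw.1 (ell^~ th0) nw.2 &
      forall t, Th t -> `|Lt nw.1 nw.2 t - mean z nw.1 (ell^~ t) nw.2| <= eta].
    near=> nw; split.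
    - have : `|mean z nw.1 G nw.2 - Ex nu G| <= eta by near: nw; exact: weak_lln.
      by rewrite ler_distl => /andP[].
    - have : `|mean z nw.1 (ell^~ th0) nw.2 - Ex nu (ell^~ th0)| <= eta.
        by near: nw; exact: weak_lln (l_ell Th0) eta0.
      by rewrite ler_distl => /andP[].
    - have h : forall w t, Th t -> `|Lt nw.1 w t - mean z nw.1 (ell^~ t) w| <= eta.
        by near: nw; exact: (whp_near P (Lt_close eta0)).
      exact: h.
  exists ([set s | `|t - s| <= r], [set nw | [/\ mean z nw.1 G nw.2 <= Ex nu G + eta,
      Ex nu (ell^~ th0) - eta <= mean z nw.1 (ell^~ th0) nw.2 &
      forall t, Th t -> `|Lt nw.1 nw.2 t - mean z nw.1 (ell^~ t) nw.2| <= eta]]).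
    split=> //=; apply/nbhs_ballP; exists r => // s; rewrite -ball_normE /=; exact: ltW.
  move=> [s nw] [/= ts [h1 h2 h3]] Ths.
  have := h3 _ Ths; have := h3 _ Th0; rewrite !ler_distl => /andP[h4 _] /andP[_ h5].
  have h6 : mean z nw.1 (ell^~ s) nw.2 <= mean z nw.1 G nw.2.
    by rewrite ler_wpM2l ?invr_ge0//; apply: ler_sum => i _; exact: hG.
  have : 5 * eta = Ex nu (ell^~ th0) - Ex nu (ell^~ t) by rewrite /eta; field.
  move: eta0 EG h1 h2 h4 h5 h6; rewrite /eta; move: (_ / 5) => e; lra.
move=> h; near=> nw; have gw : good nw.2 by near: nw.
have hK : K `<=` (fun s => Th s -> Lt nw.1 nw.2 s < Lt nw.1 nw.2 th0) by near: nw.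
have [Tha mx] := That_max nw.1 gw; rewrite leNgt; apply/negP => far.
have Ka : K (That nw.1 nw.2) by split=> //=; rewrite distrC ltW.
by have := hK _ Ka Tha; rewrite ltNge mx.
Unshelve. all: by end_near. Qed.

End wald.

(** * Smooth densities *)

Section derivative_of_log.
Context {R : realType} {p : nat}.
Implicit Types (g : 'rV[R]_p -> R) (t : 'rV[R]_p).

(** Reduces a directional derivative to a one-variable one, to which the chain rule for ln
    applies. *)
Lemma derive_lineE g t v : derive g t v = derive (fun y : R => g (t + y *: v)) 0 1.
Proof.
have E : (fun h : R => h^-1 *: (g (h *: v + t) - g t)) =
    (fun h : R => h^-1 *: (g (t + (h *: (1 : R) + 0) *: v) - g (t + (0 : R) *: v))).
  apply/funext => h; have -> : h *: (1 : R) = h by exact: mulr1.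
  by rewrite addr0 scale0r addr0 (addrC t).
by rewrite /derive /= E.
Qed.

Lemma partial_ln g t j : differentiable g t -> 0 < g t ->
  partial (fun s => ln (g s)) j t = (g t)^-1 * partial g j t.
Proof.
move=> dg g0; rewrite /partial derive_lineE.
have dg0 : differentiable g (t + (0 : R) *: delta_mx 0 j) by rewrite scale0r addr0.
have h1 := is_derive_segment dg0.
have h2 : is_derive (g (t + (0 : R) *: delta_mx 0 j)) 1 (@ln R) (g t)^-1.
  by rewrite scale0r addr0; exact: is_derive1_ln.
have h3 := is_derive1_comp (f := @ln R) (g := fun y : R => g (t + y *: delta_mx 0 j)) (x := 0) h2 h1.
rewrite (@derive_val _ _ _ _ _ _ _ h3); congr (_ * _).
rewrite scale0r addr0 (bigD1 j)//= big1 ?addr0 => [|i ij].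
  by rewrite mxE !eqxx mul1r.
by rewrite mxE (negPf ij) andbF mul0r.
Qed.

Lemma grad_ln g t : differentiable g t -> 0 < g t ->
  grad (fun s => ln (g s)) t = (g t)^-1 *: grad g t.
Proof. by move=> dg g0; apply/rowP => j; rewrite !mxE partial_ln. Qed.

End derivative_of_log.

Section sup_entries.
Context {R : realType}.

Lemma le_sum2 m n (a : 'I_m -> 'I_n -> R) i j : (forall i j, 0 <= a i j) ->
  a i j <= \sum_i \sum_j a i j.
Proof.
move=> a0; rewrite (bigD1 i)//= (bigD1 j)//= -addrA lerDl addr_ge0// sumr_ge0// => k _.
by rewrite sumr_ge0.
Qed.

End sup_entries.

Lemma measurable_inv_pos {R : realType} {d : measure_display} {T : measurableType d} (h : T -> R) :
  (forall x, 0 < h x) -> measurable_fun setT h -> measurable_fun setT (fun x => (h x)^-1).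
Proof.
move=> h0 mh; have -> : (fun x => (h x)^-1) = (fun x => expR (- ln (h x))).
  by apply/funext => x; rewrite expRN lnK// posrE.
by apply/measurableT_comp => //; apply: measurable_funN; apply/measurableT_comp.
Qed.

(** * Likelihood ratios of a smooth family *)

Section smooth_density.
Context {R : realType} {p : nat} {d : measure_display} {T : measurableType d}.
Variables (nu : probability T R) (f : T -> 'rV[R]_p -> R) (th0 : 'rV[R]_p) (r0 rho dl : R).
Hypotheses (rho0 : 0 < rho) (rho_r0 : rho < r0) (dl0 : 0 < dl).
Let cball r : set 'rV[R]_p := [set t | `|th0 - t| <= r].
Hypothesis cB : compact (cball rho).
Hypothesis f_diff : forall x t, `|t - th0| < r0 -> [/\ differentiable (f x) t,
  (forall i, differentiable (partial (f x) i) t) &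
  (forall i j, {for t, continuous (partial (partial (f x) i) j)})].
Hypothesis mf : forall t, `|t - th0| < r0 -> measurable_fun setT (f^~ t).
Hypothesis f_ge : forall x t, `|t - th0| < r0 -> dl <= f x t.
Hypothesis f_ratio : forall t, `|t - th0| < r0 ->
  L1 nu (fun x => f x t / f x th0) /\ Ex nu (fun x => f x t / f x th0) = 1.
(** Integrability of the Hessian supremum over the open ball, phrased through measurable functions
    below it because the supremum itself may fail to be measurable; it is applied to suprema over
    smaller closed balls. *)
Hypothesis hess_L1 : forall G : T -> R, measurable_fun setT G -> (forall x, 0 <= G x) ->
  (forall x B, (forall t, `|t - th0| < r0 -> `|hess (f x) t| <= B) -> G x <= B) ->
  L1 nu (fun x => G x / f x th0).

Definition score x : 'rV[R]_p := grad (fun t => ln (f x t)) th0.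

Hypothesis score_L2 : forall i j, L1 nu (fun x => score x 0 i * score x 0 j).

Let f0 x := f x th0.
Let r0_gt0 : 0 < r0 := lt_trans rho0 rho_r0.
Let th0_in : `|th0 - th0| < r0. Proof. by rewrite subrr normr0. Qed.
Let f0_gt0 x : 0 < f0 x. Proof. by apply: lt_le_trans dl0 (f_ge x th0_in). Qed.
Let mf0 : measurable_fun setT f0. Proof. exact: mf. Qed.
Let mf0V : measurable_fun setT (fun x => (f0 x)^-1).
Proof. exact: measurable_inv_pos. Qed.

Let sball r t : r <= rho -> cball r t -> `|t - th0| < r0.
Proof. by move=> rr; rewrite /cball/= distrC => /le_lt_trans; apply; exact: le_lt_trans rho_r0. Qed.

Let D2 i j x t := partial (partial (f x) i) j t.

Let m_partial i t : `|t - th0| < r0 -> measurable_fun setT (fun x => partial (f x) i t).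
Proof.
by move=> tr; apply: (measurable_partial i tr mf) => x; have [] := f_diff x tr.
Qed.

Let m_D2 i j t : `|t - th0| < r0 -> measurable_fun setT (fun x => D2 i j x t).
Proof.
move=> tr; apply: (measurable_partial (f := fun x => partial (f x) i) j tr) => [s|x].
  exact: m_partial.
by have [_ + _] := f_diff x tr; apply.
Qed.

Let cball_compact r : r <= rho -> compact (cball r).
Proof.
move=> rr; rewrite (_ : cball r = cball rho `&` cball r).
  by apply: compact_closedI => //; exact: closed_cball.
by apply/seteqP; split=> t; [move=> h; split=> //; exact: le_trans rr|case].
Qed.

Let cball0 r : 0 <= r -> cball r !=set0.
Proof. by move=> r_ge0; exists th0; rewrite /cball/= subrr normr0. Qed.

Let osc i j x t := `|D2 i j x t - D2 i j x th0|.

Let c_D2 r i j x : r <= rho -> cont_on (cball r) (fun t => `|D2 i j x t|).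
Proof.
move=> rr t tr e e0.
have [_ _ /(_ i j) /cvgrPdist_le /(_ _ e0) /nbhs_ballP[dlt /= dlt0 h]] := f_diff x (sball rr tr).
exists dlt => // s _ ts; apply: le_trans (ler_dist_dist _ _) _.
by apply: h; rewrite -ball_normE.
Qed.

Let c_osc r i j x : r <= rho -> cont_on (cball r) (osc i j x).
Proof.
move=> rr t tr e e0.
have [_ _ /(_ i j) /cvgrPdist_le /(_ _ e0) /nbhs_ballP[dlt /= dlt0 h]] := f_diff x (sball rr tr).
exists dlt => // s _ ts; apply: le_trans (ler_dist_dist _ _) _.
rewrite /D2 opprB addrA subrK.
by apply: h; rewrite -ball_normE.
Qed.

(** [S] dominates the second derivatives, and [O r], their oscillation on the ball of radius r,
    tends to 0 with r by continuity, dominated by 2 S. *)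
Let S i j := sup_on (cball rho) (fun x t => `|D2 i j x t|).
Let O r i j := sup_on (cball r) (osc i j).

Let rr := lexx rho.
Let S_ge i j x t : cball rho t -> `|D2 i j x t| <= S i j x.
Proof. exact: (sup_on_ge (G := fun x t => `|D2 i j x t|) cB (fun x => c_D2 i j x rr)). Qed.

Let S_ge0 i j x : 0 <= S i j x.
Proof. by apply: le_trans (S_ge i j x (t := th0) _) => //=; rewrite /cball/= subrr normr0 ltW. Qed.

Let mS i j : measurable_fun setT (S i j).
Proof.
apply: (measurable_sup_on cB (cball0 (ltW rho0))) => [x|t tr]; first exact: c_D2.
by apply/measurableT_comp => //; exact: m_D2 (sball rr tr).
Qed.

Let LS i j : L1 nu (fun x => S i j x / f0 x).
Proof.
apply: hess_L1 => // x B hB; apply: (sup_on_le (cball0 (ltW rho0))) => t tr.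
apply: le_trans (hB t (sball rr tr)).
by have := le_coord_mx_norm (hess (f x) t) i j; rewrite mxE.
Qed.

Let O_ge r i j x t : r <= rho -> cball r t -> osc i j x t <= O r i j x.
Proof.
by move=> rr' h; exact: (sup_on_ge (G := osc i j) (cball_compact rr') (fun x => c_osc i j x rr')).
Qed.

Let O_ge0 r i j x : 0 <= r -> r <= rho -> 0 <= O r i j x.
Proof.
move=> r_ge0 rr'; apply: (@le_trans _ _ (osc i j x th0)); first exact: normr_ge0.
by apply: O_ge => //; rewrite /cball/= subrr normr0.
Qed.

Let O_le r i j x : 0 <= r -> r <= rho -> O r i j x <= 2 * S i j x.
Proof.
move=> r_ge0 rr'; apply: (sup_on_le (cball0 r_ge0)) => t tr.
rewrite mulr_natl mulr2n (le_trans (ler_normB _ _))// lerD ?S_ge//.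
  exact: le_trans rr'.
by rewrite /cball/= subrr normr0 ltW.
Qed.

Let mO r i j : 0 <= r -> r <= rho -> measurable_fun setT (O r i j).
Proof.
move=> r_ge0 rr'; apply: (measurable_sup_on (cball_compact rr') (cball0 r_ge0)) => [x|t tr].
  exact: c_osc.
apply/measurableT_comp => //; apply: measurable_funB; first exact: m_D2 (sball rr' tr).
exact: m_D2.
Qed.

Let LO r i j : 0 <= r -> r <= rho -> L1 nu (fun x => O r i j x / f0 x).
Proof.
move=> r_ge0 rr'; apply: (L1_le (Y := fun x => 2 * (S i j x / f0 x))).
- by apply: measurable_funM => //; exact: mO.
- move=> x; rewrite ger0_norm; last by rewrite divr_ge0 ?O_ge0// ltW.
  by rewrite mulrA ler_wpM2r ?O_le// invr_ge0 ltW.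
- exact: L1Z.
Qed.

Definition hess_envelope x := p%:R ^+ 2 * \sum_i \sum_j S i j x / f0 x.
Let W := hess_envelope.
Let om r x := p%:R ^+ 2 * \sum_i \sum_j O r i j x / f0 x.

Lemma L1_hess_envelope : L1 nu hess_envelope.
Proof. by apply: L1Z; apply: L1_sum => i; apply: L1_sum => j; exact: LS. Qed.

Lemma hess_envelope_ge0 x : 0 <= hess_envelope x.
Proof.
rewrite mulr_ge0 ?exprn_ge0// sumr_ge0// => i _; rewrite sumr_ge0// => j _.
by rewrite divr_ge0// ltW.
Qed.

Definition rel_hess x : 'M[R]_p := (f x th0)^-1 *: hess (f x) th0.

Let scoreE x j : score x 0 j = partial (f x) j th0 / f0 x.
Proof.
have [df _ _] := f_diff x th0_in.
by rewrite /score (grad_ln df (f0_gt0 x)) !mxE mulrC.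
Qed.

Let seg_in D y : `|D| <= rho -> 0 <= y <= 1 -> `|th0 + y *: D - th0| < r0.
Proof. by move=> Dr y01; apply: seg_ball => //; exact: le_lt_trans rho_r0. Qed.

Let seg_cball r D y : `|D| <= r -> 0 <= y <= 1 -> cball r (th0 + y *: D).
Proof.
move=> Dr /andP[y0 y1]; rewrite /cball/= opprD addrA subrr sub0r normrN normrZ ger0_norm//.
by apply: le_trans Dr; rewrite ler_piMl.
Qed.

Let dotsE x D : dot D (score x) = (\sum_j D 0 j * partial (f x) j th0) / f0 x.
Proof. by rewrite dotE mulr_suml; apply: eq_bigr => j _; rewrite scoreE mulrA. Qed.

(** Comparison of the Hessian with the zero matrix; division by f at [th0] turns the gradient into
    the score. *)
Lemma ratio_first x D : `|D| <= rho ->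
  `|f x (th0 + D) / f x th0 - 1 - dot D (score x)| <= `|D| ^+ 2 * hess_envelope x.
Proof.
move=> Dr; pose B := \sum_i \sum_j S i j x.
have h : forall y : R, 0 <= y <= 1 -> `|hess (f x) (th0 + y *: D) - 0| <= B.
  move=> y y01; rewrite subr0; apply/mx_norm_leP.
    by apply: sumr_ge0 => i _; apply: sumr_ge0.
  move=> i j; rewrite mxE; apply: le_trans (le_sum2 i j (fun i j => S_ge0 i j x)).
  by apply: S_ge; exact: seg_cball.
have := @segment_taylor2 R p (f x) th0 D 0 B
  (fun y y01 => let: And3 a _ _ := f_diff x (seg_in Dr y01) in a)
  (fun y i y01 => let: And3 _ a _ := f_diff x (seg_in Dr y01) in a i) h.
rewrite mulmx0 mul0mx mxE mul0r subr0 => h1.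
rewrite dotsE (_ : _ - _ = (f x (th0 + D) - f x th0 - \sum_j D 0 j * partial (f x) j th0) / f0 x); last first.
  by rewrite /f0; field; rewrite gt_eqF//; exact: f0_gt0.
rewrite normrM (gtr0_norm (x := (f0 x)^-1)) ?invr_gt0// ler_pdivrMr//.
apply: le_trans h1 _; rewrite le_eqVlt; apply/orP; left; apply/eqP.
have hE : \sum_i \sum_j S i j x / f0 x = B / f0 x.
  by rewrite /B mulr_suml; apply: eq_bigr => i _; rewrite mulr_suml.
by rewrite /hess_envelope hE; field; rewrite gt_eqF.
Qed.

Let ratio_second r x D : 0 <= r -> r <= rho -> `|D| <= r ->
  `|f x (th0 + D) / f x th0 - 1 - dot D (score x) - qform (rel_hess x) D / 2| <= `|D| ^+ 2 * om r x.
Proof.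
move=> r_ge0 rr' Dr; pose B := \sum_i \sum_j O r i j x.
have Drho := le_trans Dr rr'.
have h : forall y : R, 0 <= y <= 1 -> `|hess (f x) (th0 + y *: D) - hess (f x) th0| <= B.
  move=> y y01; apply/mx_norm_leP.
    by apply: sumr_ge0 => i _; apply: sumr_ge0 => j _; exact: O_ge0.
  move=> i j; rewrite !mxE; apply: le_trans (le_sum2 i j (fun i j => O_ge0 i j x r_ge0 rr')).
  by apply: O_ge => //; exact: seg_cball.
have := @segment_taylor2 R p (f x) th0 D (hess (f x) th0) B
  (fun y y01 => let: And3 a _ _ := f_diff x (seg_in Drho y01) in a)
  (fun y i y01 => let: And3 _ a _ := f_diff x (seg_in Drho y01) in a i) h => h1.
rewrite dotsE qformZl -/(f0 x) (_ : _ - _ = (f x (th0 + D) - f x th0 -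
  \sum_j D 0 j * partial (f x) j th0 - qform (hess (f x) th0) D / 2) / f0 x); last first.
  by rewrite /f0; field; rewrite gt_eqF//; exact: f0_gt0.
rewrite normrM (gtr0_norm (x := (f0 x)^-1)) ?invr_gt0// ler_pdivrMr//.
apply: le_trans h1 _; rewrite le_eqVlt; apply/orP; left; apply/eqP.
have hE : \sum_i \sum_j O r i j x / f0 x = B / f0 x.
  by rewrite /B mulr_suml; apply: eq_bigr => i _; rewrite mulr_suml.
by rewrite /om hE; field; rewrite gt_eqF.
Qed.

Lemma measurable_score j : measurable_fun setT (fun x => score x 0 j).
Proof. by under eq_fun do rewrite scoreE; apply: measurable_funM => //; exact: m_partial. Qed.

Lemma L1_score j : L1 nu (fun x => score x 0 j).
Proof.
apply: (L1_le (Y := fun x => 1 + score x 0 j * score x 0 j)) => //.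
- exact: measurable_score.
- move=> x; move: (score x 0 j) => y; rewrite -expr2 -(real_normK (num_real y)).
  move: `|y| => u; have : 0 <= (u - 1 / 2) ^+ 2 by exact: sqr_ge0.
  by rewrite sqrrB; lra.
- by apply: L1D => //; exact: L1_cst.
Qed.

Lemma L1_rel_hess i j : L1 nu (fun x => rel_hess x i j).
Proof.
apply: (L1_le (Y := fun x => S i j x / f0 x)) => //.
  under eq_fun do rewrite !mxE mulrC; apply: measurable_funM => //; exact: m_D2.
move=> x; rewrite !mxE normrM mulrC (gtr0_norm (x := (f x th0)^-1)) ?invr_gt0//; last exact: f0_gt0.
by rewrite ler_wpM2r ?invr_ge0 ?(ltW (f0_gt0 x))// S_ge//= /cball/= subrr normr0 ltW.
Qed.

(** Only continuity of the Hessian is known, without a modulus uniform in x: the oscillation is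
    small in mean on a small ball, by dominated convergence. *)
Lemma hess_modulus eta : 0 < eta -> exists r om,
  [/\ 0 < r, L1 nu om, Ex nu om <= eta & forall x D, `|D| <= r ->
  `|f x (th0 + D) / f x th0 - 1 - dot D (score x) - qform (rel_hess x) D / 2| <=
  `|D| ^+ 2 * om x].
Proof.
move=> eta0; pose q : R := p%:R ^+ 2 * (p%:R * p%:R) + 1.
have q0 : 0 < q by rewrite ltr_wpDl// !mulr_ge0.
pose rk k : R := rho * harmonic k.
have rk0 k : 0 < rk k by rewrite mulr_gt0// /harmonic /= invr_gt0.
have rk1 k : rk k <= rho by rewrite ler_piMr ?(ltW rho0)// /harmonic /= invf_le1 ?ler1n.
have rkcvg : rk k @[k --> \oo] --> (0 : R).
  by rewrite -[X in _ --> X](mulr0 rho); apply: cvgM; [exact: cvg_cst|exact: cvg_harmonic].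
have etaq : 0 < eta / q by rewrite divr_gt0.
have : \forall k \near \oo, forall ij : 'I_p * 'I_p,
    Ex nu (fun x => O (rk k) ij.1 ij.2 x / f0 x) <= eta / q.
  apply: filter_forall => -[i j] /=.
  have : Ex nu (fun x => O (rk k) i j x / f0 x) @[k --> \oo] --> Ex nu (fun=> 0).
    apply: (Ex_dominated_cvg (Y := fun x => 2 * (S i j x / f0 x))).
    - by move=> k; exact: L1_meas (LO i j (ltW (rk0 k)) (rk1 k)).
    - exact: L1Z.
    - move=> k x; rewrite ger0_norm; last by rewrite divr_ge0 ?O_ge0 ?(ltW (rk0 k))// ltW.
      by rewrite mulrA ler_wpM2r ?O_le ?(ltW (rk0 k))// invr_ge0 ltW.
    - move=> x; apply/cvgr0Pnorm_le => e e0.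
      have ef0 : 0 < e * f0 x by rewrite mulr_gt0.
      have [_ _ /(_ i j) /cvgrPdist_le /(_ _ ef0) /nbhs_ballP[dlt /= dlt0 h]] := f_diff x th0_in.
      near=> k; rewrite ger0_norm; last by rewrite divr_ge0 ?O_ge0 ?(ltW (rk0 k))// ltW.
      rewrite ler_pdivrMr//; apply: (sup_on_le (cball0 (ltW (rk0 k)))) => t tr.
      rewrite /osc distrC; apply: h; rewrite -ball_normE /=; apply: le_lt_trans tr _.
      by near: k; exact: (cvgr_lt _ rkcvg).
  rewrite Ex_cst => /cvgrPdist_le /(_ _ etaq); apply: filterS => k.
  by rewrite sub0r normrN; exact: le_trans (ler_norm _).
move=> [k _ /(_ k (leqnn k)) hk]; exists (rk k), (om (rk k)); split=> //.
- apply: L1Z; apply: L1_sum => i; apply: L1_sum => j; exact: LO (ltW (rk0 k)) (rk1 k).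
- have lO i j := LO i j (ltW (rk0 k)) (rk1 k).
  rewrite /om ExZ; last by apply: L1_sum => i; exact: L1_sum.
  rewrite Ex_sum; last by move=> i; exact: L1_sum.
  have -> : \sum_i Ex nu (fun x => \sum_j O (rk k) i j x / f0 x) =
      \sum_(i < p) \sum_(j < p) Ex nu (fun x => O (rk k) i j x / f0 x).
    by apply: eq_bigr => i _; rewrite Ex_sum.
  apply: (@le_trans _ _ (p%:R ^+ 2 * \sum_(i < p) \sum_(j < p) eta / q)).
    rewrite ler_wpM2l ?exprn_ge0//; apply: ler_sum => i _; apply: ler_sum => j _.
    exact: (hk (i, j)).
  rewrite !sum_ord_cst [X in X <= _](_ : _ = (q - 1) / q * eta); last first.
    by rewrite /q; field; rewrite gt_eqF.
  rewrite ler_piMl ?(ltW eta0)// ler_pdivrMr// mul1r; lra.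
- by move=> x D Dr; apply: ratio_second => //; exact: ltW.
Unshelve. all: by end_near. Qed.

Let Ex_dot_score D : Ex nu (fun x => dot D (score x)) = dot D (\row_j Ex nu (fun x => score x 0 j)).
Proof.
rewrite dotE; under [in RHS]eq_bigr do rewrite mxE.
under eq_fun do rewrite dotE.
rewrite Ex_sum => [|j]; last by apply: L1Z; exact: L1_score.
by apply: eq_bigr => j _; rewrite ExZ//; exact: L1_score.
Qed.

Let L1_dot_score D : L1 nu (fun x => dot D (score x)).
Proof.
by under eq_fun do rewrite dotE; apply: L1_sum => j; apply: L1Z; exact: L1_score.
Qed.

Let L1_qform_hess D : L1 nu (fun x => qform (rel_hess x) D).
Proof.
under eq_fun do rewrite qformE.
by apply: L1_sum => i; apply: L1Z; apply: L1_sum => j; apply: L1Z; exact: L1_rel_hess.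
Qed.

Let Ex_qform_hess D : Ex nu (fun x => qform (rel_hess x) D) =
  qform (\matrix_(i, j) Ex nu (fun x => rel_hess x i j)) D.
Proof.
rewrite qformE; under eq_fun do rewrite qformE.
have l1 i : L1 nu (fun x => \sum_j D 0 j * rel_hess x i j).
  by apply: L1_sum => j; apply: L1Z; exact: L1_rel_hess.
rewrite Ex_sum => [|i]; last exact: L1Z.
apply: eq_bigr => i _; rewrite ExZ// Ex_sum => [|j]; last by apply: L1Z; exact: L1_rel_hess.
congr (_ * _); apply: eq_bigr => j _; rewrite mxE ExZ//; exact: L1_rel_hess.
Qed.

Let dist_in D : `|D| <= rho -> `|th0 + D - th0| < r0.
Proof. by move=> Dr; rewrite addrAC subrr add0r (le_lt_trans Dr). Qed.

Let L1_ratio D : `|D| <= rho -> L1 nu (fun x => f x (th0 + D) / f x th0 - 1).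
Proof. by move=> Dr; apply: L1B (L1_cst _ _); exact: (f_ratio (dist_in Dr)).1. Qed.

Let Ex_ratio D : `|D| <= rho -> Ex nu (fun x => f x (th0 + D) / f x th0 - 1) = 0.
Proof.
move=> Dr; have [l E] := f_ratio (dist_in Dr).
by rewrite (ExB l (L1_cst nu 1)) Ex_cst E subrr.
Qed.

(** The ratio minus 1 has mean 0 for every small D. Its expansion along y times a basis vector gives
    y |E s_j| <= m y^2, and y can be taken arbitrarily small; this stands for differentiating the
    total mass under the integral. *)
Lemma Ex_score j : Ex nu (fun x => score x 0 j) = 0.
Proof.
pose m := Ex nu hess_envelope + 1.
have m0 : 0 < m by rewrite ltr_wpDl// Ex_ge0// => x; exact: hess_envelope_ge0.
apply/eqP; rewrite -normr_le0; apply/ler_addgt0Pl => e e0; rewrite addr0.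
pose y := Num.min rho (e / m).
have y0 : 0 < y by rewrite lt_min rho0 divr_gt0.
pose D : 'rV[R]_p := y *: delta_mx 0 j.
have D1 : `|delta_mx 0 j : 'rV[R]_p| <= 1.
  apply/mx_norm_leP => // i k; rewrite mxE; case: (_ && _) => /=.
    by rewrite normr1.
  by rewrite normr0.
have Dy : `|D| <= y by rewrite normrZ (gtr0_norm y0) ler_piMr// ltW.
have Dr : `|D| <= rho by apply: le_trans Dy _; rewrite ge_min lexx.
have h : `|Ex nu (fun x => f x (th0 + D) / f x th0 - 1 - dot D (score x))| <=
    Ex nu (fun x => `|D| ^+ 2 * hess_envelope x).
  apply: le_trans (Ex_norm (L1B (L1_ratio Dr) (L1_dot_score D))) _.
  apply: Ex_le.
  - by apply: L1_norm; exact: L1B (L1_ratio Dr) (L1_dot_score D).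
  - exact: L1Z L1_hess_envelope.
  - by move=> x; exact: ratio_first.
rewrite (ExB (L1_ratio Dr) (L1_dot_score D)) Ex_ratio// sub0r normrN in h.
rewrite (ExZ _ L1_hess_envelope) Ex_dot_score dotZl dotE (bigD1 j)//= big1 in h; last first.
  by move=> i ij; rewrite [X in X * _]mxE (negPf ij) andbF mul0r.
rewrite !mxE !eqxx mul1r addr0 normrM (gtr0_norm y0) in h.
have h2 : y * `|Ex nu (fun x => score x 0 j)| <= y * (y * m).
  apply: le_trans h _; rewrite mulrA -expr2 ler_pM ?exprn_ge0 ?Ex_ge0//.
  - by move=> x; exact: hess_envelope_ge0.
  - by rewrite lerXn2r ?nnegrE// ltW.
  - by rewrite lerDl.
move: h2; rewrite ler_pM2l// => /le_trans; apply.
by rewrite -ler_pdivlMr// ge_min lexx orbT.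
Qed.

(** The same argument at second order, the linear term now having mean 0; scaling D by y and
    dividing by y^2 leaves the mean remainder, which is arbitrarily small. *)
Lemma Ex_rel_hess D : qform (\matrix_(i, j) Ex nu (fun x => rel_hess x i j)) D = 0.
Proof.
apply/eqP; rewrite -normr_le0; apply/ler_addgt0Pl => e e0; rewrite addr0.
pose c := 2 * (`|D| ^+ 2 + 1); have c0 : 0 < c by rewrite mulr_gt0// ltr_wpDl// exprn_ge0.
have ec : 0 < e / c by rewrite divr_gt0.
have [r [om' [r_gt0 lo oe ho]]] := hess_modulus ec.
pose y := Num.min rho r / (`|D| + 1).
have D1 : 0 < `|D| + 1 by rewrite ltr_wpDl.
have rr0 : 0 < Num.min rho r by rewrite lt_min rho0.
have y0 : 0 < y by rewrite divr_gt0.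
have Dy : `|y *: D| <= Num.min rho r.
  rewrite normrZ (gtr0_norm y0) /y mulrAC ler_pdivrMr// ler_wpM2l ?(ltW rr0)//.
  by rewrite lerDl.
move: Dy; rewrite le_min => /andP[Drho Dr].
pose X x := f x (th0 + y *: D) / f x th0 - 1 - dot (y *: D) (score x).
have lX : L1 nu X by exact: L1B (L1_ratio Drho) (L1_dot_score _).
have lq : L1 nu (fun x => qform (rel_hess x) (y *: D) / 2).
  by under eq_fun do rewrite mulrC; exact: L1Z.
have h : `|Ex nu (fun x => X x - qform (rel_hess x) (y *: D) / 2)| <=
    Ex nu (fun x => `|y *: D| ^+ 2 * om' x).
  apply: le_trans (Ex_norm (L1B lX lq)) _.
  apply: Ex_le.
  - exact: L1_norm (L1B lX lq).
  - exact: L1Z lo.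
  - by move=> x; exact: ho.
have EX : Ex nu X = 0.
  rewrite (ExB (L1_ratio Drho) (L1_dot_score _)) Ex_ratio// Ex_dot_score dotE big1 ?subrr// => j _.
  by rewrite [X in _ * X]mxE Ex_score mulr0.
rewrite (ExB lX lq) EX sub0r normrN (ExZ _ lo) in h.
have Eq : Ex nu (fun x => qform (rel_hess x) (y *: D) / 2) =
    y ^+ 2 * (qform (\matrix_(i, j) Ex nu (fun x => rel_hess x i j)) D / 2).
  have -> : (fun x => qform (rel_hess x) (y *: D) / 2) = (fun x => 2^-1 * qform (rel_hess x) (y *: D)).
    by apply/funext => x; rewrite mulrC.
  by rewrite ExZ// Ex_qform_hess qformZ; field.
have yD2 : `|y *: D| ^+ 2 = y ^+ 2 * `|D| ^+ 2 by rewrite normrZ exprMn (gtr0_norm y0).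
have y20 : 0 < y ^+ 2 by rewrite exprn_gt0.
move: h; rewrite Eq yD2 normrM (gtr0_norm y20) -[leRHS]mulrA ler_pM2l//.
rewrite normrM (ger0_norm (x := 2^-1)) ?invr_ge0// ler_pdivrMr// => /le_trans; apply.
apply: (@le_trans _ _ (`|D| ^+ 2 * (e / c) * 2)).
  by rewrite ler_wpM2r// ler_wpM2l ?exprn_ge0.
rewrite (_ : _ * 2 = e * (2 * `|D| ^+ 2) / c); last by rewrite /c; field; rewrite gt_eqF.
rewrite ler_pdivrMr// ler_wpM2l ?(ltW e0)// /c mulrDr lerDl mulr1//.
Qed.

End smooth_density.

(** * Asymptotic normality *)

Section gaussian_limit.
Context {R : realType}.

Lemma norm_cosB_le (a b : R) : `|cos a - cos b| <= `|a - b|.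
Proof.
have d (y : R) : is_derive y (1 : R) (fun y => cos (b + y)) (- sin (b + y)).
  have db : is_derive y (1 : R) (fun y : R => b + y) 1.
    by rewrite -[X in is_derive _ _ _ X]add0r; apply: is_deriveD.
  have h := is_derive1_comp (f := @cos R) (g := fun y : R => b + y) (x := y) (is_derive_cos (b + y)) db.
  by rewrite mulr1 in h.
have := mvt_bound (x := a - b) (B := 1) d; rewrite addr0 (addrC b) subrK mul1r; apply => y _.
by rewrite normrN ler_norml sin_geN1 sin_le1.
Qed.

Context {p : nat} {d d' : measure_display} {Om : measurableType d}
  {T : measurableType d'}.

Lemma tight_affine (P : probability Om R) (X : nat -> Om -> R) (a b : R) : 0 <= a -> 0 <= b ->
  tight P X -> tight P (fun n w => a * `|X n w| + b).
Proof.
move=> a0 b0 tX e e0; have [M M0 h] := tX e e0; exists (a * M + b + 1).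
  by rewrite ltr_wpDl// addr_ge0// mulr_ge0// ltW.
apply: filterS h => n [B [mB PB BX]]; exists B; split=> // w nB.
rewrite ger0_norm; last by rewrite addr_ge0// mulr_ge0.
by rewrite ler_wpDr// lerD2r ler_wpM2l// BX.
Qed.

Variables (P : probability Om R) (nu : probability T R) (z : nat -> Om -> T).
Hypothesis mz : forall i, measurable_fun setT (z i).
Hypothesis indep : mutually_independent P z.
Hypothesis zP : forall i A, measurable A -> P (z i @^-1` A) = nu A.
Variable s : T -> 'rV[R]_p.
Hypotheses (ls : forall j, L1 nu (fun x => s x 0 j))
  (lss : forall i j, L1 nu (fun x => s x 0 i * s x 0 j))
  (s0 : forall j, Ex nu (fun x => s x 0 j) = 0).
Hypothesis info_unit : information nu s \in unitmx.
Let I := information nu s.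

Let dotM (D : 'rV[R]_p) : L1 nu (fun x => dot D (s x)).
Proof. by under eq_fun do rewrite dotE; apply: L1_sum => j; exact: L1Z. Qed.

Lemma L1_dot_sqr D : L1 nu (fun x => dot D (s x) ^+ 2).
Proof.
under eq_fun do rewrite -qform_outer qformE.
apply: L1_sum => i; apply: L1Z; apply: L1_sum => j; apply: L1Z.
by under eq_fun do rewrite mxE.
Qed.

Lemma Ex_dot_sqr D : Ex nu (fun x => dot D (s x) ^+ 2) = qform I D.
Proof.
under eq_fun do rewrite -qform_outer qformE.
have lm i j : L1 nu (fun x => (\matrix_(i, j) (s x 0 i * s x 0 j) : 'M[R]_p) i j).
  by under eq_fun do rewrite mxE.
have l1 i : L1 nu (fun x => \sum_j D 0 j * (\matrix_(i, j) (s x 0 i * s x 0 j) : 'M[R]_p) i j).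
  by apply: L1_sum => j; apply: L1Z.
rewrite qformE Ex_sum => [|i]; last exact: L1Z.
apply: eq_bigr => i _; rewrite ExZ// Ex_sum => [|j]; last exact: L1Z.
congr (_ * _); apply: eq_bigr => j _; rewrite ExZ// mxE; congr (_ * Ex _ _).
by apply/funext => x; rewrite mxE.
Qed.

Lemma information_psd (v : 'cV[R]_p) : 0 <= (v^T *m I *m v) 0 0.
Proof.
have := Ex_dot_sqr v^T; rewrite /qform trmxK => <-.
by apply: Ex_ge0 => x; exact: sqr_ge0.
Qed.

Let information_pd := psd_unit_pd (information_sym nu s) information_psd info_unit.

Lemma information_coercive : exists2 la, 0 < la & forall D, la * `|D| ^+ 2 <= qform I D.
Proof. exact: pd_coercive (information_sym nu s) info_unit information_pd. Qed.

Let invI_sym : (invmx I)^T = invmx I.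
Proof. by rewrite trmx_inv (information_sym nu s). Qed.

Let invI_form (v : 'cV[R]_p) : v^T *m invmx I *m v = (invmx I *m v)^T *m I *m (invmx I *m v).
Proof. by rewrite trmx_mul invI_sym -!mulmxA (mulmxA I) mulmxV// mul1mx. Qed.

Let invI_pd (v : 'cV[R]_p) : v != 0 -> 0 < (v^T *m invmx I *m v) 0 0.
Proof.
move=> v0; rewrite invI_form information_pd//; apply: contra v0 => /eqP v0.
by rewrite -[v](mulKVmx info_unit) -/I v0 mulmx0.
Qed.

Variable X : nat -> Om -> 'rV[R]_p.
Hypothesis mX : forall n, vmeas (X n).
Hypothesis X_lin : forall eta, 0 < eta -> \forall nw \near whp P,
  `|X nw.1 nw.2 - score_sum z s nw.1 nw.2 *m invmx I| <= eta.

Let L n w := score_sum z s n w *m invmx I.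

Let norm_mulmx_row (u : 'rV[R]_p) (A : 'M[R]_p) : `|u *m A| <= p%:R * `|A| * `|u|.
Proof.
apply/mx_norm_leP; first by rewrite !mulr_ge0.
move=> i j; rewrite ord1 mxE mulrAC; apply: norm_sum_pM => k; exact: le_coord_mx_norm.
Qed.

Let tight_X : tight P (fun n w => `|X n w|).
Proof.
have c0 : 0 <= p%:R * `|invmx I| by rewrite mulr_ge0.
have tS := tight_affine c0 ler01 (tight_score_sum mz indep zP ls lss s0).
apply: (tight_le tS); near=> nw; rewrite normr_id.
have h : `|X nw.1 nw.2 - L nw.1 nw.2| <= 1 by near: nw; exact: X_lin.
apply: le_trans (ler_norm _); rewrite normr_id.
rewrite (_ : X _ _ = L nw.1 nw.2 + (X nw.1 nw.2 - L nw.1 nw.2)); last by rewrite addrC subrK.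
by apply: le_trans (ler_normD _ _) _; rewrite lerD// norm_mulmx_row.
Unshelve. all: by end_near. Qed.

Let mS n : vmeas (L n).
Proof.
move=> j; under eq_fun do rewrite mxE; apply: measurable_sum => k.
apply: measurable_funM => //; under eq_fun do rewrite mxE summxE.
apply: measurable_funM => //; apply: measurable_sum => i.
exact: measurableT_comp (L1_meas (ls k)) (mz i).
Qed.

(** Cramer-Wold reduction: X_n may be replaced by its linearization because cos is 1-Lipschitz, and
    a projection of the latter is a normalised scalar sum. *)
Let cos_limit phi (t : 'cV[R]_p) :
  Ex P (fun w => cos (phi + (X n w *m t) 0 0)) @[n --> \oo] -->
    expR (- ((t^T *m invmx I *m t) 0 0 / 2)) * cos phi.
Proof.
have bcos (Y : nat -> Om -> 'rV[R]_p) n w : `|cos (phi + (Y n w *m t) 0 0)| <= 1.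
  by rewrite ler_norml cos_geN1 cos_le1.
have close : Ex P (fun w => cos (phi + (X n w *m t) 0 0)) -
    Ex P (fun w => cos (phi + (L n w *m t) 0 0)) @[n --> \oo] --> 0.
  apply: (Ex_close_whp (B := 1)).
  - by move=> n; exact: L1_meas (L1_cos P phi t (mX n)).
  - by move=> n; exact: L1_meas (L1_cos P phi t (@mS n)).
  - exact: bcos.
  - exact: bcos.
  move=> e e0; pose c := p%:R * `|t^T| + 1; have c0 : 0 < c by rewrite ltr_wpDl// mulr_ge0.
  have ec : 0 < e / c by rewrite divr_gt0.
  near=> nw; have h : `|X nw.1 nw.2 - L nw.1 nw.2| <= e / c by near: nw; exact: X_lin.
  apply: le_trans (norm_cosB_le _ _) _.
  rewrite (_ : _ - _ = dot (X nw.1 nw.2 - L nw.1 nw.2) t^T); last first.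
    by rewrite dotB /dot trmxK opprD addrACA subrr add0r.
  apply: le_trans (dot_le _ _) _; apply: (@le_trans _ _ (c * (e / c))); last by rewrite mulrC divfK// gt_eqF.
  by rewrite mulrAC ler_pM ?mulr_ge0// /c lerDl.
(* The projection of S_n I^-1 on t is D.S_n, of variance D I D^T = t^T I^-1 t. *)
pose D := (invmx I *m t)^T.
have LE n w : (L n w *m t) 0 0 = (Num.sqrt n%:R)^-1 * \sum_(i < n) dot D (s (z i w)).
  rewrite /L -mulmxA -[invmx I *m t]trmxK -/D -/(dot _ D) dotC dotZr dot_sum.
  by [].
have lim := @central_limit_cos _ _ _ _ _ P nu z mz indep zP _ phi (dotM D) (L1_dot_sqr D).
have Es : Ex nu (fun x => dot D (s x)) = 0.
  under eq_fun do rewrite dotE; rewrite Ex_sum => [|j]; last exact: L1Z.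
  by rewrite big1// => j _; rewrite ExZ// s0 mulr0.
have {}lim := lim Es.
rewrite Ex_dot_sqr /qform {2}/D trmxK -invI_form in lim.
rewrite (_ : (fun n => Ex P (fun w => cos (phi + (X n w *m t) 0 0))) =
  (fun n => (Ex P (fun w => cos (phi + (X n w *m t) 0 0)) - Ex P (fun w => cos (phi + (L n w *m t) 0 0)))
    + Ex P (fun w => cos (phi + (Num.sqrt n%:R)^-1 * \sum_(i < n) dot D (s (z i w)))))).
  by rewrite -[X in _ --> X]add0r; apply: cvgD.
apply/funext => n; have -> : Ex P (fun w => cos (phi + (L n w *m t) 0 0)) =
    Ex P (fun w => cos (phi + (Num.sqrt n%:R)^-1 * \sum_(i < n) dot D (s (z i w)))).
  by under eq_fun do rewrite LE.
by rewrite subrK.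
Unshelve. all: by end_near. Qed.

Lemma gaussian_limit : exists (dQ : measure_display) (OmQ : measurableType dQ)
  (Q : probability OmQ R) (Y : OmQ -> 'rV[R]_p), [/\ vmeas Y, is_gaussian_vec Q Y (invmx I) &
  forall h B, continuous h -> (forall x, `|h x| <= B) ->
    Ex P (fun w => h (X n w)) @[n --> \oo] --> Ex Q (fun w => h (Y w))].
Proof.
have [dQ [OmQ [Q [Y [mY gY cY]]]]] := gaussian_vec_exists invI_sym invI_pd.
exists dQ, OmQ, Q, Y; split=> // h B ch hB.
apply: (levy_continuity mX mY tight_X _ ch hB) => phi t.
by rewrite cY; exact: cos_limit.
Qed.

End gaussian_limit.

Section log_lipschitz.
Context {R : realType}.

Lemma ln_lipschitz (m a b : R) : 0 < m -> m <= a -> m <= b -> `|ln a - ln b| <= `|a - b| / m.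
Proof.
move=> m0; have one (u v : R) : m <= u -> m <= v -> ln u - ln v <= `|u - v| / m.
  move=> mu mv; have u0 := lt_le_trans m0 mu; have v0 := lt_le_trans m0 mv.
  have uv : -1 < u / v - 1 by rewrite ltrBrDr addNr divr_gt0.
  have := le_ln1Dx uv; rewrite addrC subrK ln_div ?posrE// => h; apply: le_trans h _.
  rewrite (_ : u / v - 1 = (u - v) / v); last by field; rewrite gt_eqF.
  apply: (@le_trans _ _ (`|u - v| / v)); first by rewrite ler_wpM2r ?ler_norm// invr_ge0 ltW.
  by rewrite ler_wpM2l// lef_pV2.
move=> ma mb; rewrite ler_norml one// andbT.
by rewrite -lerN2 opprK opprB distrC one.
Qed.

End log_lipschitz.

(** * The maximum approximate likelihood estimator *)

Section approximate_likelihood.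
Context {R : realType} {p : nat} {d d' : measure_display} {Om : measurableType d}
  {T : measurableType d'}.
Variables (P : probability Om R) (nu : probability T R) (z : nat -> Om -> T).
Hypothesis mz : forall i, measurable_fun setT (z i).
Hypothesis indep : mutually_independent P z.
Hypothesis zP : forall i A, measurable A -> P (z i @^-1` A) = nu A.
Variables (Th : set 'rV[R]_p) (th0 : 'rV[R]_p) (f : T -> 'rV[R]_p -> R) (r0 dl : R).
Hypotheses (cTh : compact Th) (r0_gt0 : 0 < r0) (dl0 : 0 < dl)
  (ball_Th : forall t, `|t - th0| < r0 -> Th t).
Hypotheses (mf : forall t, Th t -> measurable_fun setT (f^~ t))
  (f_ge : forall x t, Th t -> dl <= f x t).
Hypothesis f_diff : forall x t, `|t - th0| < r0 -> [/\ differentiable (f x) t,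
  (forall i, differentiable (partial (f x) i) t) &
  (forall i j, {for t, continuous (partial (partial (f x) i) j)})].
Hypothesis f_ratio : forall t, Th t ->
  L1 nu (fun x => f x t / f x th0) /\ Ex nu (fun x => f x t / f x th0) = 1.
Hypothesis f_ident : forall t, Th t -> t != th0 -> (0 < nu [set x | f x t != f x th0])%E.
(** Integrability of the supremum of |ln f| over [Th], in the same domination form as [hess_L1]. *)
Hypothesis ln_L1 : forall G : T -> R, measurable_fun setT G -> (forall x, 0 <= G x) ->
  (forall x B, (forall t, Th t -> `|ln (f x t)| <= B) -> G x <= B) -> L1 nu G.
Hypothesis hess_L1 : forall G : T -> R, measurable_fun setT G -> (forall x, 0 <= G x) ->
  (forall x B, (forall t, `|t - th0| < r0 -> `|hess (f x) t| <= B) -> G x <= B) ->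
  L1 nu (fun x => G x / f x th0).
Let s := score f th0.
Hypothesis score_L2 : forall i j, L1 nu (fun x => s x 0 i * s x 0 j).
Hypothesis info_unit : information nu s \in unitmx.
(** [g n] is the approximate density used with n observations, and [eps n] bounds its error in value
    and gradient. *)
Variables (g : nat -> T -> 'rV[R]_p -> R) (eps : nat -> R).
Hypothesis g_C2 : forall n x, C2_on Th (g n x).
Hypotheses (eps_ge0 : forall n, 0 <= eps n)
  (eps0 : Num.sqrt n%:R * eps n @[n --> \oo] --> (0 : R)).
Hypothesis gf : \forall n \near \oo, forall x t, Th t ->
  `|g n x t - f x t| <= eps n /\ `|grad (g n x) t - grad (f x) t| <= eps n.
Variables (That : nat -> Om -> 'rV[R]_p) (good : set Om).
Hypothesis whp_good : \forall nw \near whp P, good nw.2.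
Hypothesis That_max : forall n w, good w -> Th (That n w) /\ forall t, Th t ->
  n%:R^-1 * \sum_(i < n) ln (g n (z i w) t) <= n%:R^-1 * \sum_(i < n) ln (g n (z i w) (That n w)).

Let th0_in : `|th0 - th0| < r0. Proof. by rewrite subrr normr0. Qed.
Let Th0 : Th th0. Proof. exact: ball_Th. Qed.
Let f_gt0 x t : Th t -> 0 < f x t. Proof. by move=> /(f_ge x); exact: lt_le_trans. Qed.

Let eps_small a : 0 < a -> \forall n \near \oo, eps n <= a := le_sqrt_scaled_cvg0 eps_ge0 eps0.

Let g_cont n x : cont_on Th (g n x).
Proof.
have [V [_ ThV hV]] := g_C2 n x.
apply: continuous_cont_on => t Tht; have [dg _ _] := hV t (ThV _ Tht).
exact: differentiable_continuous.
Qed.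

(** A uniform limit of the smooth [g n]. This gives continuity on all of [Th] for every x, as the
    measurable suprema require. *)
Let f_cont x : cont_on Th (f x).
Proof.
move=> t Tht e e0; have e3 : 0 < e / 3 by rewrite divr_gt0.
have h : \forall n \near \oo, (forall x t, Th t ->
    `|g n x t - f x t| <= eps n /\ `|grad (g n x) t - grad (f x) t| <= eps n) /\ eps n <= e / 3.
  by near=> n; split; near: n; [exact: gf|exact: eps_small].
have [n _ /(_ n (leqnn n)) [h1 h2]] := h.
have [dlt dlt0 h3] := g_cont n x Tht e3; exists dlt => // u Thu tu.
have q1 := le_trans (h1 x t Tht).1 h2; have q2 := le_trans (h1 x u Thu).1 h2; have q3 := h3 u Thu tu.
move: q1 q2 q3; rewrite !ler_norml => /andP[? ?] /andP[? ?] /andP[? ?]; apply/andP; split; lra.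
Unshelve. all: by end_near. Qed.

Let lnf_cont x : cont_on Th (fun t => ln (f x t)).
Proof.
move=> t Tht e e0; have edl : 0 < e * dl by rewrite mulr_gt0.
have [dlt dlt0 h] := f_cont x Tht edl; exists dlt => // u Thu tu.
apply: le_trans (ln_lipschitz dl0 (f_ge x Tht) (f_ge x Thu)) _.
by rewrite ler_pdivrMr//; exact: h.
Qed.

Let m_lnf t : Th t -> measurable_fun setT (fun x => ln (f x t)).
Proof. by move=> Tht; apply/measurableT_comp => //; exact: mf. Qed.

Let F := sup_on Th (fun x t => `|ln (f x t)|).

Let anf_cont x : cont_on Th (fun t => `|ln (f x t)|).
Proof.
move=> t Tht e e0; have [dlt dlt0 h] := lnf_cont x Tht e0; exists dlt => // u Thu tu.
by apply: le_trans (ler_dist_dist _ _) _; exact: h.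
Qed.

Let F_ge x t : Th t -> `|ln (f x t)| <= F x.
Proof. exact: (sup_on_ge (G := fun x t => `|ln (f x t)|) cTh anf_cont). Qed.

Let LF : L1 nu F.
Proof.
have Thn : Th !=set0 by exists th0.
apply: ln_L1.
- apply: (measurable_sup_on cTh Thn) => // t Tht.
  by apply/measurableT_comp => //; exact: m_lnf.
- by move=> x; apply: le_trans (F_ge x Th0).
- by move=> x B hB; apply: (sup_on_le Thn).
Qed.

Let L1_lnf t : Th t -> L1 nu (fun x => ln (f x t)).
Proof. by move=> Tht; apply: L1_le LF; [exact: m_lnf|move=> x; exact: F_ge]. Qed.

Let kullback t : Th t -> t != th0 ->
  Ex nu (fun x => ln (f x t)) < Ex nu (fun x => ln (f x th0)).
Proof.
move=> Tht tth0; have [lu Eu] := f_ratio Tht.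
have lnE : (fun x => ln (f x t / f x th0)) = (fun x => ln (f x t) - ln (f x th0)).
  by apply/funext => x; rewrite ln_div ?posrE ?f_gt0.
have : Ex nu (fun x => ln (f x t / f x th0)) < 0.
  apply: Ex_ln_lt0 => //.
  - by rewrite lnE; exact: L1B (L1_lnf Tht) (L1_lnf Th0).
  - by move=> x; rewrite divr_gt0// f_gt0.
  - rewrite (_ : [set _ | _] = [set x | f x t != f x th0]); first exact: f_ident.
    apply/seteqP; split=> x /=; apply: contra => /eqP h.
      by rewrite h divff// gt_eqF// f_gt0.
    by rewrite -[f x t](divfK (x := f x th0)) ?h ?mul1r// gt_eqF// f_gt0.
by rewrite lnE (ExB (L1_lnf Tht) (L1_lnf Th0)) subr_lt0.
Qed.

Let dl2 : 0 < dl / 2. Proof. by rewrite divr_gt0. Qed.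

Let g_ge : \forall n \near \oo, forall x t, Th t -> dl / 2 <= g n x t.
Proof.
near=> n => x t Tht.
have h1 : forall x t, Th t ->
    `|g n x t - f x t| <= eps n /\ `|grad (g n x) t - grad (f x) t| <= eps n by near: n.
have h2 : eps n <= dl / 2 by near: n; exact: eps_small.
have := (h1 x t Tht).1; have := f_ge x Tht; rewrite ler_norml => h3 /andP[h4 _]; lra.
Unshelve. all: by end_near. Qed.

Lemma mle_consistent e : 0 < e -> \forall nw \near whp P, `|That nw.1 nw.2 - th0| <= e.
Proof.
apply: (@wald_consistency _ _ _ _ _ _ P nu z mz indep zP Th th0 (fun x t => ln (f x t)) F cTh Th0
  lnf_cont m_lnf LF F_ge kullback
  (fun n w t => n%:R^-1 * \sum_(i < n) ln (g n (z i w) t)) That good whp_good _ That_max).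
move=> eta eta0; have ed : 0 < eta * (dl / 2) by rewrite mulr_gt0.
near=> n => w t Tht.
have h1 : forall x t, Th t ->
    `|g n x t - f x t| <= eps n /\ `|grad (g n x) t - grad (f x) t| <= eps n by near: n.
have h2 : eps n <= eta * (dl / 2) by near: n; exact: eps_small.
have h3 : forall x t, Th t -> dl / 2 <= g n x t by near: n.
have n0 : (0 < n)%N by near: n; exact: nbhs_infty_gt.
rewrite /mean -mulrBr -sumrB normrM ger0_norm ?invr_ge0// ler_pdivrMl ?ltr0n//.
apply: norm_sum_ord_le => i; have fdl : dl / 2 <= f (z i w) t.
  by apply: le_trans (f_ge _ Tht); rewrite ler_pdivrMr// ler_peMr ?ler1n// ltW.
apply: le_trans (ln_lipschitz dl2 (h3 (z i w) t Tht) fdl) _.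
by rewrite ler_pdivrMr//; exact: le_trans (h1 (z i w) t Tht).1 h2.
Unshelve. all: by end_near. Qed.

Let rho := r0 / 2.
Let rho0 : 0 < rho. Proof. by rewrite divr_gt0. Qed.
Let rho_r0 : rho < r0. Proof. by rewrite ltr_pdivrMr// ltr_pMr// ltr1n. Qed.

Let cB : compact [set t | `|th0 - t| <= rho].
Proof.
rewrite (_ : [set _ | _] = Th `&` [set t | `|th0 - t| <= rho]).
  by apply: compact_closedI => //; exact: closed_cball.
apply/seteqP; split=> t /= => [h|[]//]; split=> //; apply: ball_Th.
by rewrite distrC; exact: le_lt_trans rho_r0.
Qed.

Let mfr t : `|t - th0| < r0 -> measurable_fun setT (f^~ t). Proof. by move/ball_Th/mf. Qed.
Let f_ger x t : `|t - th0| < r0 -> dl <= f x t. Proof. by move/ball_Th/f_ge; apply. Qed.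
Let f_ratior t : `|t - th0| < r0 ->
  L1 nu (fun x => f x t / f x th0) /\ Ex nu (fun x => f x t / f x th0) = 1.
Proof. by move/ball_Th/f_ratio. Qed.

Let W := hess_envelope f th0 rho.
Let V := envelope s W.
Let e n x D := g n x (th0 + D) / g n x th0 - 1.
(** The cap 1 allows |D|^2 W <= |D| W. In the constant [C] below, 2 / dl bounds 1 / g at [th0], and
    p + 1 collects the factor p of the Lipschitz bound and that of D.s. *)
Let dlt := Num.min rho 1.
Let C := 2 / dl * (p%:R + 1).

Let W0 x : 0 <= W x := hess_envelope_ge0 rho0 rho_r0 dl0 cB f_diff f_ger x.
Let ls j : L1 nu (fun x => s x 0 j) := L1_score rho0 rho_r0 dl0 f_diff mfr f_ger score_L2 j.
Let lW : L1 nu W := L1_hess_envelope rho0 rho_r0 cB f_diff mfr hess_L1.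
Let lM i j : L1 nu (fun x => rel_hess f th0 x i j) :=
  L1_rel_hess rho0 rho_r0 dl0 cB f_diff mfr f_ger hess_L1 i j.
Let s0 j : Ex nu (fun x => s x 0 j) = 0 :=
  Ex_score rho0 rho_r0 dl0 cB f_diff mfr f_ger f_ratior hess_L1 score_L2 j.
Let M0 D : qform (\matrix_(i, j) Ex nu (fun x => rel_hess f th0 x i j)) D = 0 :=
  Ex_rel_hess rho0 rho_r0 dl0 cB f_diff mfr f_ger f_ratior hess_L1 score_L2 D.

Let C0 : 0 < C.
Proof. by rewrite mulr_gt0 ?divr_gt0// ltr_wpDl. Qed.

Let dlt0 : 0 < dlt. Proof. by rewrite lt_min rho0 ltr01. Qed.

Let step_Th D y : `|D| <= dlt -> 0 <= y <= 1 -> `|th0 + y *: D - th0| < r0.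
Proof.
rewrite le_min => /andP[Dr _] y01; apply: seg_ball => //; exact: le_lt_trans rho_r0.
Qed.

Let dist_step D : `|D| <= dlt -> Th (th0 + D).
Proof.
move=> Dd; apply: ball_Th; have y01 : 0 <= (1 : R) <= 1 by rewrite ler01 lexx.
by have := step_Th Dd y01; rewrite scale1r.
Qed.

(** The mean value inequality for g - f, whose gradient is at most [eps n]: this is where the
    approximation error acquires its factor |D|. *)
Let increment_close : \forall n \near \oo, forall x D, `|D| <= dlt ->
  `|(g n x (th0 + D) - g n x th0) - (f x (th0 + D) - f x th0)| <= p%:R * `|D| * eps n.
Proof.
apply: filterS gf => n h x D Dd.
have [U [_ ThU hU]] := g_C2 n x.
have dg t : `|t - th0| < r0 -> differentiable (g n x) t.
  by move=> /ball_Th/ThU/hU[].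
have df t : `|t - th0| < r0 -> differentiable (f x) t by move=> /(f_diff x)[].
rewrite (_ : _ - _ = (g n x \- f x) (th0 + D) - (g n x \- f x) th0); last first.
  by rewrite /=; ring.
apply: segment_lipschitz => [y y01|y j y01].
  by apply: differentiableB; [apply: dg|apply: df]; exact: step_Th.
have tin := step_Th Dd y01.
rewrite /partial [X in `|X|](_ : _ = partial (g n x) j (th0 + y *: D) - partial (f x) j (th0 + y *: D)).
  apply: le_trans (h x _ (ball_Th tin)).2.
  by have := le_coord_mx_norm (grad (g n x) (th0 + y *: D) - grad (f x) (th0 + y *: D)) 0 j; rewrite !mxE.
by apply: deriveB; apply: diff_derivable; [exact: dg|exact: df].
Qed.

Let ratio_close : \forall n \near \oo, forall x D, `|D| <= dlt ->
  `|e n x D - (f x (th0 + D) / f x th0 - 1)| <= C * eps n * `|D| * V x.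
Proof.
near=> n => x D Dd.
have h1 : forall x t, Th t ->
    `|g n x t - f x t| <= eps n /\ `|grad (g n x) t - grad (f x) t| <= eps n by near: n.
have h2 : forall x t, Th t -> dl / 2 <= g n x t by near: n.
have h3 : forall x D, `|D| <= dlt ->
  `|(g n x (th0 + D) - g n x th0) - (f x (th0 + D) - f x th0)| <= p%:R * `|D| * eps n by near: n.
have k1 := h3 x D Dd; have k2 := (h1 x th0 Th0).1; have k3 := h2 x th0 Th0.
have fp := f_gt0 x Th0; have gp : 0 < g n x th0 by apply: lt_le_trans dl2 k3.
have k4 : `|f x (th0 + D) / f x th0 - 1| <= `|D| * (p%:R * `|s x| + W x).
  move: Dd; rewrite le_min => /andP[Dr D1].
  rewrite (_ : _ / _ - 1 = (f x (th0 + D) / f x th0 - 1 - dot D (s x)) + dot D (s x)); last by rewrite subrK.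
  apply: le_trans (ler_normD _ _) _.
  apply: le_trans (lerD (ratio_first rho0 rho_r0 dl0 cB f_diff f_ger x Dr) (dot_le D (s x))) _.
  rewrite -/W mulrDr addrC lerD//; first by rewrite mulrA (mulrC `|D|).
  by rewrite ler_wpM2r// expr2 ler_piMl.
(* Over the denominator g at [th0], the difference of the two ratios splits into the error of the
   increment and the relative increment of f times the error at [th0]; both are of order |D| eps. *)
rewrite /e (_ : _ - _ = (((g n x (th0 + D) - g n x th0) - (f x (th0 + D) - f x th0))
  - (f x (th0 + D) / f x th0 - 1) * (g n x th0 - f x th0)) / g n x th0); last first.
  by field; rewrite !gt_eqF.
rewrite normrM (gtr0_norm (x := (g n x th0)^-1)) ?invr_gt0//.
have k5 : (g n x th0)^-1 <= 2 / dl by rewrite -[2 / dl]invf_div lef_pV2.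
have V0 : 0 <= V x by apply: le_trans (envelope_ge1 s W0 x).
apply: (@le_trans _ _ ((`|D| * eps n * ((p%:R + 1) * V x)) * (2 / dl))); last first.
  by rewrite le_eqVlt; apply/orP; left; apply/eqP; rewrite /C; field; rewrite gt_eqF.
apply: ler_pM => //; first by rewrite invr_ge0 ltW.
apply: le_trans (ler_normB _ _) _; rewrite [X in _ + X]normrM.
have k6 : `|f x (th0 + D) / f x th0 - 1| * `|g n x th0 - f x th0| <=
    `|D| * (p%:R * `|s x| + W x) * eps n by apply: ler_pM.
apply: le_trans (lerD k1 k6) _.
rewrite [leLHS](_ : _ = `|D| * eps n * (p%:R + (p%:R * `|s x| + W x))); last by ring.
rewrite ler_wpM2l ?mulr_ge0// /V /envelope.
have := W0 x; have : 0 <= `|s x| by []; have : 0 <= p%:R :> R by [].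
by move: p%:R `|s x| (W x) => a b c; nra.
Unshelve. all: by end_near. Qed.

Let e_first : \forall n \near \oo, forall x D, `|D| <= dlt ->
  `|e n x D - dot D (s x)| <= `|D| ^+ 2 * W x + C * eps n * `|D| * V x.
Proof.
apply: filterS ratio_close => n h x D Dd.
rewrite (_ : _ - _ = (f x (th0 + D) / f x th0 - 1 - dot D (s x)) +
  (e n x D - (f x (th0 + D) / f x th0 - 1))); last by ring.
apply: le_trans (ler_normD _ _) _; rewrite lerD ?h//.
move: Dd; rewrite le_min => /andP[Dr _].
exact: (ratio_first rho0 rho_r0 dl0 cB f_diff f_ger x Dr).
Qed.

Let e_second eta : 0 < eta -> exists r om,
  [/\ 0 < r, L1 nu om, Ex nu om <= eta & \forall n \near \oo, forall x D, `|D| <= r ->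
  `|e n x D - dot D (s x) - qform (rel_hess f th0 x) D / 2| <=
  `|D| ^+ 2 * om x + C * eps n * `|D| * V x].
Proof.
move=> eta0; have [r [om [r_gt0 lo oe ho]]] :=
  hess_modulus rho0 rho_r0 dl0 cB f_diff mfr f_ger hess_L1 eta0.
exists (Num.min r dlt), om; split=> //; first by rewrite lt_min r_gt0.
apply: filterS ratio_close => n h x D; rewrite le_min => /andP[Dr Dd].
rewrite (_ : _ - _ = (f x (th0 + D) / f x th0 - 1 - dot D (s x) - qform (rel_hess f th0 x) D / 2) +
  (e n x D - (f x (th0 + D) / f x th0 - 1))); last by ring.
by apply: le_trans (ler_normD _ _) _; rewrite lerD ?h// ho.
Qed.

Let Ceps0 : Num.sqrt n%:R * (C * eps n) @[n --> \oo] --> (0 : R).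
Proof.
rewrite -(mulr0 C) (_ : (fun n => _) = (fun n => C * (Num.sqrt n%:R * eps n))).
  by apply: cvgM => //; exact: cvg_cst.
by apply/funext => n; rewrite mulrCA.
Qed.

Let e_gtN1 : \forall n \near \oo, forall x D, `|D| <= dlt -> -1 < e n x D.
Proof.
apply: filterS g_ge => n h x D Dd; rewrite /e ltrBrDr addNr divr_gt0//.
  by apply: lt_le_trans dl2 (h x _ (dist_step Dd)).
exact: lt_le_trans dl2 (h x _ Th0).
Qed.

(** Subtracting the constant log-likelihood at [th0] turns maximality over [Th] into maximality of
    the log-ratio; |D| <= dlt keeps th0 + D in [Th]. *)
Let Dhat_max : \forall n \near \oo, forall w D, good w ->
  `|D| <= dlt -> `|That n w - th0| <= dlt ->
  \sum_(i < n) ln (1 + e n (z i w) D) <= \sum_(i < n) ln (1 + e n (z i w) (That n w - th0)).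
Proof.
near=> n => w D gw Dd Tdd.
have h : forall x t, Th t -> dl / 2 <= g n x t by near: n.
have n0 : (0 < n)%N by near: n; exact: nbhs_infty_gt.
have gp x t : Th t -> 0 < g n x t by move=> /(h x); exact: lt_le_trans.
have lnE D' : `|D'| <= dlt -> \sum_(i < n) ln (1 + e n (z i w) D') =
    \sum_(i < n) ln (g n (z i w) (th0 + D')) - \sum_(i < n) ln (g n (z i w) th0).
  move=> Dd'; rewrite -sumrB; apply: eq_bigr => i _.
  by rewrite /e addrC subrK ln_div// posrE gp//; exact: dist_step.
rewrite !lnE// lerD2r (addrC th0 (_ - _)) subrK.
have [_ mx] := That_max n gw; have := mx _ (dist_step Dd).
by rewrite ler_pM2l// invr_gt0 ltr0n.
Unshelve. all: by end_near. Qed.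

Lemma mle_linearization eta : 0 < eta -> \forall nw \near whp P,
  `|Num.sqrt nw.1%:R *: (That nw.1 nw.2 - th0) -
    score_sum z s nw.1 nw.2 *m invmx (information nu s)| <= eta.
Proof.
have [la la0 coer] := information_coercive score_L2 info_unit.
have Ceps_ge0 n : 0 <= C * eps n by rewrite mulr_ge0// ltW.
exact: (maximizer_linearization mz indep zP ls score_L2 s0 lM M0 lW W0 dlt0 Ceps_ge0 Ceps0
  e_first e_second la0 coer whp_good e_gtN1 (Dhat := fun n w => That n w - th0)
  mle_consistent Dhat_max info_unit).
Qed.

Hypothesis mThat : forall n, vmeas (That n).

Lemma mle_asymptotic_normality : exists (dQ : measure_display) (OmQ : measurableType dQ)
  (Q : probability OmQ R) (Y : OmQ -> 'rV[R]_p),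
  [/\ vmeas Y, is_gaussian_vec Q Y (invmx (information nu s)) &
  forall h B, continuous h -> (forall x, `|h x| <= B) ->
    Ex P (fun w => h (Num.sqrt n%:R *: (That n w - th0))) @[n --> \oo] --> Ex Q (fun w => h (Y w))].
Proof.
have mX n : vmeas (fun w => Num.sqrt n%:R *: (That n w - th0)).
  move=> j; under eq_fun do rewrite !mxE.
  by apply: measurable_funM => //; apply: measurable_funB => //; exact: mThat.
exact: (gaussian_limit mz indep zP ls score_L2 s0 info_unit mX mle_linearization).
Qed.

End approximate_likelihood.

(** * From the sample space to all points, and extended suprema *)

Section patching.
Context {R : realType} {d : measure_display} {T : measurableType d}.
Variables (Z : set T) (x0 : T).
Hypothesis mZ : measurable Z.

(* Composing with this retraction extends bounds and smoothness known for [z] in [Z] to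
   all [z]; the observations lie in [Z] almost surely, so nothing else changes. *)
Definition patch_to x := if x \in Z then x else x0.

Lemma patch_to_id x : Z x -> patch_to x = x.
Proof. by move=> Zx; rewrite /patch_to mem_set. Qed.

Lemma patch_to_in x : Z x0 -> Z (patch_to x).
Proof. by move=> Zx0; rewrite /patch_to; case: (boolP (x \in Z)) => // /set_mem. Qed.

Lemma measurable_patch_to (h : T -> R) : measurable_fun Z h ->
  measurable_fun setT (fun x => h (patch_to x)).
Proof.
move=> mh; have -> : (fun x => h (patch_to x)) = (fun x => (h \_ Z) x + h x0 * \1_(~` Z) x).
  apply/funext => x; rewrite patchE indicE in_setC /patch_to.
  by case: (x \in Z) => /=; rewrite ?mulr0 ?addr0// mulr1 add0r.
apply: measurable_funD; first exact/(measurable_restrictT h mZ).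
by apply: measurable_funM => //; apply: measurable_indic; exact: measurableC.
Qed.

End patching.

Section extended_sup.
Context {R : realType} {T P : Type}.

Lemma supZT_ge (Z : set T) (Th : set P) (F : T -> P -> R) x t : Z x -> Th t ->
  ((F x t)%:E <= supZT Z Th F)%E.
Proof. by move=> Zx Tht; apply: ereal_sup_ubound; exists x => //; exists t. Qed.

Lemma le_ereal_sup_real (K : set P) (F : P -> R) (G : R) t : K t ->
  (forall B, (forall t, K t -> F t <= B) -> G <= B) ->
  (G%:E <= ereal_sup [set (F t)%:E | t in K])%E.
Proof.
move=> Kt GB; have ub s : K s -> ((F s)%:E <= ereal_sup [set (F t)%:E | t in K])%E.
  by move=> Ks; apply: ereal_sup_ubound; exists s.
move: (ub) (ub _ Kt); case: (ereal_sup _) => [r| |] // h _.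
- by rewrite lee_fin; apply: GB => s Ks; rewrite -lee_fin; exact: h.
- by rewrite leey.
Qed.

End extended_sup.

Section whp_null.
Context {R : realType} {d : measure_display} {Om : measurableType d}.
Variable P : probability Om R.

Lemma whp_all_nat (A : nat -> set Om) : (forall i, measurable (A i)) ->
  (forall i, P (~` A i) = 0%E) -> \forall nw \near whp P, forall i, A i nw.2.
Proof.
move=> mA PA e e0; have [B [mB PB0 hB]] : P.-negligible (\bigcup_i ~` A i).
  by apply: negligible_bigcup => i; exists (~` A i); split; [exact: measurableC|exact: PA|by []].
near=> n; exists B; split=> //; first by rewrite PB0 lee_fin ltW.
move=> w nB i; apply: contrapT => nAi; apply: nB; apply: hB; exists i => //.
Unshelve. all: by end_near. Qed.

End whp_null.

Theorem theorem8 (R : realType) (p q : nat)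
  (Th : set 'rV[R]_p) (Z : set (q.-tuple R))
  (mu : {measure set (q.-tuple R) -> \bar R})
  (f : q.-tuple R -> 'rV[R]_p -> R) (th0 : 'rV[R]_p)
  (ft : nat -> q.-tuple R -> 'rV[R]_p -> R) (Rn : nat -> nat)
  (d : measure_display) (Om : measurableType d) (P : probability Om R)
  (z : nat -> Om -> q.-tuple R) (thhat : nat -> Om -> 'rV[R]_p) :
  (* {f(.;th) : th in Th} is a family of pmfs/pdfs on Z (w.r.t. mu) *)
  measurable Z ->
  (forall t, Th t ->
     [/\ measurable_fun Z (fun x => f x t),
         (forall x, Z x -> 0 <= f x t) &
         (\int[mu]_(x in Z) (f x t)%:E = 1)%E]) ->
  (* z_1, z_2, ... i.i.d. from f(.; th0) *)
  (forall i, measurable_fun setT (z i)) ->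
  mutually_independent P z ->
  (forall i A, measurable A ->
     P (z i @^-1` A) = (\int[mu]_(x in A `&` Z) (f x th0)%:E)%E) ->
  (* thhat n = argmax over Th of L~_n (a measurable maximiser) *)
  (forall n w, Th (thhat n w) /\
     forall t, Th t -> Ltilde ft Rn z n w t <= Ltilde ft Rn z n w (thhat n w)) ->
  (forall n (j : 'I_p), measurable_fun setT (fun w => thhat n w 0 j)) ->
  (* (a) *)
  (forall t, Th t -> t != th0 ->
     (0 < mu [set x | Z x /\ f x t != f x th0])%E) ->
  Th th0 -> compact Th ->
  (forall t, Th t -> exists N0 : set (q.-tuple R),
     [/\ measurable N0,
         (\int[mu]_(x in N0 `&` Z) (f x th0)%:E = 0)%E &
         forall x, Z x -> ~ N0 x ->
           (fun s => ln (f x s)) @ within Th (nbhs t) --> ln (f x t)]) ->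
  (Ez mu Z f th0 (fun x => ereal_sup [set (`|ln (f x t)|)%:E | t in Th])
     < +oo)%E ->
  (* (b) *)
  (interior Th) th0 ->
  (exists N : set 'rV[R]_p,
     [/\ open N /\ N th0,
         (forall x, Z x -> C2_on N (f x) /\ forall t, N t -> 0 < f x t),
         (\int[mu]_(x in Z)
            ereal_sup [set (`|grad (f x) t|)%:E | t in N] < +oo)%E,
         (\int[mu]_(x in Z)
            ereal_sup [set (`|hess (f x) t|)%:E | t in N] < +oo)%E &
         (Ez mu Z f th0 (fun x => ereal_sup
            [set (`|grad (fun s => ln (f x s)) th0|)%:E | t in N]) < +oo)%E]) ->
  (forall i j : 'I_p, mu.-integrable Z (fun x =>
     ((grad (fun s => ln (f x s)) th0) 0 i *
      (grad (fun s => ln (f x s)) th0) 0 j * f x th0)%:E)) ->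
  fisher_info mu Z f th0 \in unitmx ->
  (* (c) *)
  (exists dl : R, 0 < dl /\ forall x t, Z x -> Th t -> dl <= f x t) ->
  (fun r => supZT Z Th (fun x t => `|ft r x t - f x t|)) @ \oo --> 0%E ->
  {homo Rn : m n / (m <= n)%N} ->
  (forall M : nat, \forall n \near \oo, (M <= Rn n)%N) ->
  (* (i) *)
  (forall r x, Z x ->
     C2_on Th (ft r x) /\ exists M : R, forall t, Th t -> `|ft r x t| <= M) ->
  (* (ii) *)
  (fun n => ((Num.sqrt n%:R)%:E * approx_err Z Th f ft (Rn n))%E)
     @ \oo --> 0%E ->
  (* (iii) *)
  (fun n => supZT Z Th (fun x t => `|hess (ft (Rn n) x) t - hess (f x) t|))
     @ \oo --> 0%E ->
  (* conclusion *)
  cvg_dist_gaussian P (fun n w => Num.sqrt n%:R *: (thhat n w - th0))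
    (invmx (fisher_info mu Z f th0)).
Proof.
move=> mZ Hf mz indep zlaw Hmax mTh ident Th0 cTh _ EF inTh [N [[oN Nth0] HN _ hessN _]].
move=> sc_int iunit [dl [dl0 f_ge]] _ _ _ HC2 Herr _.
have [mf0 f00 int1] := Hf _ Th0.
have [x0 Zx0] : Z !=set0.
  apply/set0P/eqP => Z0; move: int1; rewrite Z0 integral_set0 => /eqP.
  by rewrite eqe eq_sym oner_eq0.
pose pi := patch_to Z x0.
have piZ x : Z (pi x) by exact: patch_to_in.
have piE x : Z x -> pi x = x by exact: patch_to_id.
(* The common law of the observations; under it the ratio f(.; t) / f(.; th0) has mean equal to the
   total mass of f(.; t), namely 1. *)
pose nu := law P (mz 0%N).
have nuE A : measurable A -> nu A = (\int[mu]_(x in A `&` Z) (f x th0)%:E)%E.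
  by move=> mA; rewrite lawE zlaw.
have zP i A : measurable A -> P (z i @^-1` A) = nu A by move=> mA; rewrite nuE// zlaw.
have [r0 r0_gt0 hr0] : exists2 r, 0 < r & forall t, `|t - th0| < r -> N t /\ Th t.
  have /nbhs_ballP[r /= r_gt0 h] : nbhs th0 (N `&` Th).
    by apply: filterI => //; exact: open_nbhs_nbhs.
  by exists r => // t tr; apply: h; rewrite -ball_normE /= distrC.
pose fp x t := f (pi x) t.
have mfp t : Th t -> measurable_fun setT (fp^~ t).
  by move=> Tht; have [m _ _] := Hf _ Tht; exact: (measurable_patch_to x0 mZ m).
have fp_ge x t : Th t -> dl <= fp x t by exact: f_ge.
have fp_gt0 x t : Th t -> 0 < fp x t by move=> /(fp_ge x); exact: lt_le_trans.
have fpE x t : Z x -> fp x t = f x t by move=> Zx; rewrite /fp piE.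
have ball_Th t : `|t - th0| < r0 -> Th t by case/hr0.
have fp_diff x t : `|t - th0| < r0 -> [/\ differentiable (fp x) t,
    (forall i, differentiable (partial (fp x) i) t) &
    (forall i j, {for t, continuous (partial (partial (fp x) i) j)})].
  move=> /hr0[Nt _]; have [[U [_ NU hU]] _] := HN (pi x) (piZ x).
  exact: hU (NU _ Nt).
have intf t : Th t -> mu.-integrable Z (EFin \o f^~ t).
  move=> Tht; have [m f_pos f1] := Hf _ Tht; apply/integrableP; split; first exact/measurable_EFinP.
  rewrite (_ : (\int[mu]_(x in Z) _)%E = 1%E) ?ltry// -[RHS]f1.
  by apply: eq_integral => x /[!inE] Zx; rewrite /= ger0_norm ?f_pos.
have m_ratio t : Th t -> measurable_fun setT (fun x => fp x t / fp x th0).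
  move=> Tht; apply: measurable_funM; first exact: mfp.
  by apply: measurable_inv_pos; [move=> x; exact: fp_gt0|exact: mfp].
have density := integrable_density mZ mf0 f00 nuE.
have fp_ratio t : Th t ->
    L1 nu (fun x => fp x t / fp x th0) /\ Ex nu (fun x => fp x t / fp x th0) = 1.
  move=> Tht; have [_ _ f1] := Hf _ Tht.
  have ratioE x : Z x -> fp x t / fp x th0 * f x th0 = f x t.
    by move=> Zx; rewrite !fpE// divfK// gt_eqF// -(fpE x)// fp_gt0.
  have l : L1 nu (fun x => fp x t / fp x th0).
    apply/(density _ (m_ratio t Tht)); apply: eq_integrable (intf t Tht) => //.
    by move=> x /[!inE] Zx; rewrite ratioE.
  split=> //; rewrite /Ex (Rintegral_density mZ mf0 f00 nuE l) /Rintegral.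
  rewrite (eq_integral (fun x => (f x t)%:E)) ?f1// => x /[!inE] Zx.
  by rewrite ratioE.
have fp_ident t : Th t -> t != th0 -> (0 < nu [set x | fp x t != fp x th0])%E.
  move=> Tht tth0; pose S := [set x | fp x t != fp x th0].
  have mS : measurable S.
    rewrite (_ : S = [set x | 0 < `|fp x t - fp x th0|]).
      apply: measurable_gtset; apply/measurableT_comp => //.
      by apply: measurable_funB; exact: mfp.
    by apply/seteqP; split=> x /=; rewrite normr_gt0 subr_eq0.
  (* The lower bound [dl] on f gives nu S >= dl mu (S meet Z), carrying identifiability over from
     [mu] to [nu]. *)
  rewrite nuE//; apply: (@lt_le_trans _ _ (dl%:E * mu (S `&` Z))%E).
    rewrite mule_gt0 ?lte_fin//; apply: lt_le_trans (ident t Tht tth0) _.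
    rewrite (_ : [set x | Z x /\ _] = S `&` Z)//.
    by apply/seteqP; split=> x [h1 h2]; split=> //; move: h1 h2; rewrite /S/=; 
      [move=> Zx; rewrite !fpE|move=> h2 Zx; move: h2; rewrite !fpE].
  have mSZ : measurable (S `&` Z) by exact: measurableI.
  rewrite -(integral_cst mu mSZ dl%:E); apply: ge0_le_integral_lower => x [_ Zx].
    by rewrite lee_fin ltW.
  by rewrite lee_fin; exact: f_ge.
have abs_f0 (G : q.-tuple R -> R) x : Z x -> 0 <= G x -> (0 <= (`|G x|%:E * (f x th0)%:E))%E.
  by move=> Zx Gx; rewrite mule_ge0// lee_fin// f00.
have ln_L1 (G : q.-tuple R -> R) : measurable_fun setT G -> (forall x, 0 <= G x) ->
    (forall x B, (forall t, Th t -> `|ln (fp x t)| <= B) -> G x <= B) -> L1 nu G.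
  move=> mG G0 hG; apply/integrableP; split; first exact/measurable_EFinP.
  rewrite (ge0_integral_density mZ mf0 f00 nuE); last by [].
    (* Monotonicity of the lower integral is enough, so the supremum on the right need not be
       measurable. *)
    apply: le_lt_trans EF; apply: ge0_le_integral_lower => x Zx; first exact: abs_f0.
    rewrite lee_wpmul2r ?lee_fin ?f00// /= ger0_norm//.
    apply: (le_ereal_sup_real Th0) => B hB; apply: hG => t Tht; rewrite fpE//.
    exact: hB.
  by apply/measurable_EFinP/measurableT_comp.
have th0_in : `|th0 - th0| < r0 by rewrite subrr normr0.
have hess_L1 (G : q.-tuple R -> R) : measurable_fun setT G -> (forall x, 0 <= G x) ->
    (forall x B, (forall t, `|t - th0| < r0 -> `|hess (fp x) t| <= B) -> G x <= B) ->
    L1 nu (fun x => G x / fp x th0).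
  move=> mG G0 hG; have mGf : measurable_fun setT (fun x => G x / fp x th0).
    apply: measurable_funM => //.
    by apply: measurable_inv_pos; [move=> x; exact: fp_gt0|exact: mfp].
  apply/(density _ mGf).
  have GE x : Z x -> G x / fp x th0 * f x th0 = G x.
    by move=> Zx; rewrite fpE// divfK// gt_eqF// -(fpE x)// fp_gt0.
  apply: (@eq_integrable _ _ _ mu Z mZ (EFin \o G)).
    by move=> x /[!inE] Zx; rewrite GE.
  apply/integrableP; split; first by apply/measurable_EFinP; exact: measurable_funTS.
  apply: le_lt_trans hessN; apply: ge0_le_integral_lower => x Zx //=.
  rewrite ger0_norm//; apply: (le_ereal_sup_real Nth0) => B hB; apply: hG => t /hr0[Nt _].
  rewrite (_ : fp x = f x); first exact: hB.
  by rewrite /fp piE.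
have rho0 : 0 < r0 / 2 by rewrite divr_gt0.
have rho_r0 : r0 / 2 < r0 by rewrite ltr_pdivrMr// ltr_pMr// ltr1n.
have scoreE x : Z x -> score fp th0 x = grad (fun s => ln (f x s)) th0.
  by move=> Zx; rewrite /score /fp piE.
have m_score j : measurable_fun setT (fun x => score fp th0 x 0 j).
  apply: (measurable_score rho0 rho_r0 dl0 fp_diff) => [t /hr0[_ ]|x t /hr0[_]].
    exact: mfp.
  exact: fp_ge.
have sc2E i j x : Z x -> score fp th0 x 0 i * score fp th0 x 0 j * f x th0 =
    (grad (fun s => ln (f x s)) th0) 0 i * (grad (fun s => ln (f x s)) th0) 0 j * f x th0.
  by move=> Zx; rewrite scoreE.
have score_L2 i j : L1 nu (fun x => score fp th0 x 0 i * score fp th0 x 0 j).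
  apply/(density _ (measurable_funM (m_score i) (m_score j))).
  have := sc_int i j; apply: (eq_integrable mZ) => x /[!inE] Zx.
  by congr EFin; apply/esym; exact: sc2E.
have infoE : information nu (score fp th0) = fisher_info mu Z f th0.
  apply/matrixP => i j; rewrite !mxE /Ex (Rintegral_density mZ mf0 f00 nuE (score_L2 i j)).
  apply: (congr1 fine); apply: eq_integral => x /[!inE] Zx.
  by apply: (congr1 EFin); exact: sc2E.
pose err n := approx_err Z Th f ft (Rn n).
have sup1_ge0 n : (0 <= supZT Z Th (fun x t => `|ft (Rn n) x t - f x t|%R))%E.
  by apply: le_trans (supZT_ge _ Zx0 Th0); rewrite lee_fin.
have sup2_ge0 n : (0 <= supZT Z Th (fun x t => `|grad (ft (Rn n) x) t - grad (f x) t|%R))%E.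
  by apply: le_trans (supZT_ge _ Zx0 Th0); rewrite lee_fin.
have err_ge0 n : (0 <= err n)%E by rewrite adde_ge0.
pose eps n := fine (err n).
have eps_ge0 n : 0 <= eps n by rewrite fine_ge0.
have /fine_cvgP[err_fin0 fine_cvg] := Herr.
(* Finiteness passes from sqrt n times the error to the error only for n > 0, as 0 times an infinite
   error is 0. *)
have err_fin : \forall n \near \oo, err n \is a fin_num.
  near=> n; have n0 : (0 < n)%N by near: n; exact: nbhs_infty_gt.
  have : ((Num.sqrt n%:R)%:E * err n)%E \is a fin_num by near: n.
  have := err_ge0 n; case: (err n) => [r| |]//.
  by rewrite gt0_muley// lte_fin sqrtr_gt0 ltr0n.
have eps0 : Num.sqrt n%:R * eps n @[n --> \oo] --> (0 : R).
  apply: cvg_trans fine_cvg; apply: near_eq_cvg; near=> n.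
  by rewrite /= fineM//; near: n; exact: err_fin.
have gf : \forall n \near \oo, forall x t, Th t ->
    `|ft (Rn n) (pi x) t - fp x t| <= eps n /\
    `|grad (ft (Rn n) (pi x)) t - grad (fp x) t| <= eps n.
  apply: filterS err_fin => n fn x t Tht; split; rewrite -lee_fin fineK//.
    apply: le_trans (leeDl _ (sup2_ge0 n)).
    exact: (supZT_ge (fun x t => `|ft (Rn n) x t - f x t|%R) (piZ x) Tht).
  apply: le_trans (leeDr _ (sup1_ge0 n)).
  exact: (supZT_ge (fun x t => `|grad (ft (Rn n) x) t - grad (f x) t|%R) (piZ x) Tht).
(* On this almost sure event the retraction fixes every observation, so the retracted and the
   original likelihoods coincide. *)
pose good := [set w | forall i, Z (z i w)].
have whp_good : \forall nw \near whp P, good nw.2.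
  apply: (whp_all_nat (A := fun i => z i @^-1` Z)) => i.
    by rewrite -[X in measurable X]setTI; exact: (mz i measurableT _ mZ).
  by rewrite preimage_setC zlaw ?setICl ?integral_set0//; exact: measurableC.
have g_C2 n x : C2_on Th (ft (Rn n) (pi x)) by case: (HC2 (Rn n) (pi x) (piZ x)).
have good_max n w : good w -> Th (thhat n w) /\ forall t, Th t ->
    n%:R^-1 * \sum_(i < n) ln (ft (Rn n) (pi (z i w)) t) <=
    n%:R^-1 * \sum_(i < n) ln (ft (Rn n) (pi (z i w)) (thhat n w)).
  move=> gw; have [Tha mx] := Hmax n w; split=> // t Tht.
  have E s : n%:R^-1 * \sum_(i < n) ln (ft (Rn n) (pi (z i w)) s) = Ltilde ft Rn z n w s.
    by rewrite /Ltilde; congr (_ * _); apply: eq_bigr => i _; rewrite piE//; exact: gw.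
  by rewrite !E; exact: mx.
rewrite -infoE in iunit *.
have [dQ [OmQ [Q [Y [mY gY cY]]]]] := mle_asymptotic_normality mz indep zP cTh r0_gt0 dl0 ball_Th
  mfp fp_ge fp_diff fp_ratio fp_ident ln_L1 hess_L1 score_L2 iunit g_C2 eps_ge0 eps0 gf
  whp_good good_max mTh.
exists dQ, OmQ, Q, Y; split=> // h ch [B hB].
have mX n : vmeas (fun w => Num.sqrt n%:R *: (thhat n w - th0)).
  move=> j; under eq_fun do rewrite !mxE.
  by apply: measurable_funM => //; apply: measurable_funB => //; exact: mTh.
have lX n : L1 P (fun w => h (Num.sqrt n%:R *: (thhat n w - th0))).
  apply: (L1_bounded P (M := B)) => //.
  exact: (measurable_continuous_comp P (mX n) ch hB).
have lY : L1 Q (fun w => h (Y w)).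
  apply: (L1_bounded Q (M := B)) => //.
  exact: (measurable_continuous_comp Q mY ch hB).
rewrite -(EFin_Ex lY) (_ : (fun n => _) = (fun n => (Ex P (fun w => h (Num.sqrt n%:R *: (thhat n w - th0))))%:E)).
  by apply: cvg_EFin; [exact: nearW|exact: cY hB].
by apply/funext => n; rewrite -(EFin_Ex (lX n)).
Unshelve. all: by end_near. Qed.
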